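(* Let $p(\cdot)\in\mathcal{P}_0$ with $p(\cdot)\in LH$. Then, for any scalar weight $w$ on $\mathbb{R}^n$, the following two statements are equivalent: (i) $w\in\mathcal{A}_{p(\cdot),\infty}$; (ii) there exist positive constants $r\in(1,\infty)$ and $C$ such that, for any cube $Q$ in $\mathbb{R}^n$, $$\frac{1}{\|\mathbf{1}_Q\|_{L^{rp(\cdot)}}}\|w\mathbf{1}_Q\|_{L^{rp(\cdot)}}\le C\frac{1}{\|\mathbf{1}_Q\|_{L^{p(\cdot)}}}\|w\mathbf{1}_Q\|_{L^{p(\cdot)}}.$$
   Context: Everything is on $\mathbb{R}^n$. $\mathcal{P}_0$ is the set of measurable $p:\mathbb{R}^n\to(0,\infty]$ with $\operatorname{ess\,inf}_{x\in\mathbb{R}^n}p(x)>0$. A measurable real-valued function $r$ on $\mathbb{R}^n$ belongs to $LH$ if there is a positive constant $C_0$ with $|r(x)-r(y)|\le -\frac{C_0}{\log(|x-y|)}$ for any $x,y$ with $|x-y|<\frac12$, and there are positive constants $r_\infty,C_\infty$ with $|r(x)-r_\infty|\le\frac{C_\infty}{\log(e+|x|)}$ for any $x\in\mathbb{R}^n$. For a measurable function $f$ and an exponent $q(\cdot)$, $\|f\|_{L^{q(\cdot)}}:=\inf\{\lambda\in(0,\infty):\int_{\mathbb{R}^n}|f(x)/\lambda|^{q(x)}\,dx\le1\}$. Cubes have finite edge length and edges parallel to the coordinate axes (not necessarily open or closed); $\fint_Q:=\frac1{|Q|}\int_Q$. A scalar weight is a non-negative measurable function on $\mathbb{R}^n$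 that is positive almost everywhere; it is in $\mathcal{A}_{p(\cdot),\infty}$ if $$[w]_{\mathcal{A}_{p(\cdot),\infty}}:=\sup_Q\frac{1}{\|\mathbf{1}_Q\|_{L^{p(\cdot)}}}\|w\mathbf{1}_Q\|_{L^{p(\cdot)}}\exp\left(\fint_Q\log(w^{-1}(y))\,dy\right)<\infty,$$ the supremum being over all cubes $Q$ in $\mathbb{R}^n$.
   Formalization: Both (i) and (ii) are taken to include the condition that ‖w1_Q‖_{L^{p(·)}} is finite for every cube Q; without it (ii) holds vacuously as ∞ ≤ C·∞ for some weights with [w] = ∞, and the equivalence fails. *)

(* Defs.v *)
From HB Require Import structures.
From mathcomp Require Import all_boot all_order all_algebra.
From mathcomp Require Import all_classical all_reals all_analysis.
From mathcomp Require Import measurable_realfun ess_sup_inf.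

Set Implicit Arguments.
Unset Strict Implicit.
Unset Printing Implicit Defensive.
Import Order.TTheory GRing.Theory Num.Theory.
Import numFieldNormedType.Exports.

Local Open Scope classical_set_scope.
Local Open Scope ring_scope.
Local Open Scope ereal_scope.

Section tuple_cons.
Context d (T : measurableType d) (n : nat).

Definition tuple_cons (x : T * n.-tuple T) : n.+1.-tuple T :=
  [tuple of x.1 :: x.2].

Lemma measurable_tuple_cons : measurable_fun [set: T * n.-tuple T] tuple_cons.
Proof. by apply: measurable_cons. Qed.

End tuple_cons.

Section tuple_measure_succ.
Context d (T : measurableType d) (R : realType) (n : nat).
Variables (m1 : {sigma_finite_measure set T -> \bar R})
          (m2 : {sigma_finite_measure set n.-tuple T -> \bar R}).

Definition tuple_measure_succ : set (n.+1.-tuple T) -> \bar R :=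
  pushforward (m1 \x m2) (@tuple_cons d T n).

Let tuple_measure_succ0 : tuple_measure_succ set0 = 0.
Proof. by rewrite /tuple_measure_succ /pushforward preimage_set0 measure0. Qed.

Let tuple_measure_succ_ge0 A : 0 <= tuple_measure_succ A.
Proof. by rewrite /tuple_measure_succ /pushforward; exact: integral_ge0. Qed.

Let tuple_measure_succ_sigma_additive : semi_sigma_additive tuple_measure_succ.
Proof.
move=> F mF tF mUF; rewrite /tuple_measure_succ /pushforward preimage_bigcup.
have mpre A : measurable A -> measurable (@tuple_cons d T n @^-1` A).
  by move=> mA; rewrite -[X in measurable X]setTI; exact: measurable_tuple_cons.
apply: measure_semi_sigma_additive.
- by move=> k; exact: mpre.
- apply/trivIsetP => i j _ _ ij; rewrite -preimage_setI.
  by move/trivIsetP : tF => /(_ _ _ _ _ ij) ->//; rewrite preimage_set0.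
- by rewrite -preimage_bigcup; exact: mpre.
Qed.

HB.instance Definition _ := isMeasure.Build _ _ _ tuple_measure_succ
  tuple_measure_succ0 tuple_measure_succ_ge0 tuple_measure_succ_sigma_additive.

Lemma tuple_measure_succE (A : set T) (B : set (n.-tuple T)) :
  measurable A -> measurable B ->
  let AB := [set t : n.+1.-tuple T | A (thead t) /\ B [tuple of behead t]] in
  measurable AB /\ tuple_measure_succ AB = m1 A * m2 B.
Proof.
move=> mA mB AB; split.
  rewrite (_ : AB = (@thead n T) @^-1` A `&`
      (fun t : n.+1.-tuple T => [tuple of behead t]) @^-1` B) //.
  by apply: measurableI; rewrite -[X in measurable X]setTI;
    [exact: measurable_tnth|exact: measurable_behead].
rewrite /tuple_measure_succ /pushforward (_ : _ @^-1` AB = A `*` B).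
  exact: product_measure1E.
apply/seteqP; split=> -[x t] /=; rewrite /AB /= theadE.
- by move=> [Ax]; rewrite (_ : [tuple of _] = t)//; exact: val_inj.
- by move=> [Ax Bt]; split=> //; rewrite (_ : [tuple of _] = t)//; exact: val_inj.
Qed.

Let tuple_measure_succ_sigma_finite : sigma_finite setT tuple_measure_succ.
Proof.
have /sigma_finiteP[F [FT ndF Foo]] := sigma_finiteT m1.
have /sigma_finiteP[G [GT ndG Goo]] := sigma_finiteT m2.
exists (fun k =>
    [set t : n.+1.-tuple T | F k (thead t) /\ G k [tuple of behead t]]).
  apply/seteqP; split=> // t _.
  have [i _ Fi] : (\bigcup_i F i) (thead t) by rewrite -FT.
  have [j _ Gj] : (\bigcup_i G i) [tuple of behead t] by rewrite -GT.
  exists (maxn i j) => //; split.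
  - by move: Fi; exact/subsetPset/ndF/leq_maxl.
  - by move: Gj; exact/subsetPset/ndG/leq_maxr.
move=> k; have [mF Fk] := Foo k; have [mG Gk] := Goo k.
have [mFG FGE] := tuple_measure_succE mF mG; split=> //.
by rewrite FGE lte_mul_pinfty// ge0_fin_numE.
Qed.

HB.instance Definition _ := Measure_isSigmaFinite.Build _ _ _
  tuple_measure_succ tuple_measure_succ_sigma_finite.

End tuple_measure_succ.

Fixpoint tuple_lebesgue (R : realType) (n : nat) :
    {sigma_finite_measure set n.-tuple (measurableTypeR R) -> \bar R} :=
  if n is n'.+1 then
    tuple_measure_succ (@lebesgue_measure R) (tuple_lebesgue R n')
  else dirac [tuple].

Lemma tuple_lebesgue_box (R : realType) n (A : 'I_n -> set (measurableTypeR R)) :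
  (forall i, measurable (A i)) ->
  let box := [set t : n.-tuple (measurableTypeR R) | forall i, A i (tnth t i)] in
  measurable box /\
  tuple_lebesgue R n box = \prod_(i < n) lebesgue_measure (A i).
Proof.
elim: n A => [|n ih] A mA box.
  have -> : box = setT by apply/seteqP; split=> // t _ [].
  by split; [exact: measurableT|rewrite big_ord0 /= diracT].
have [mB BE] := ih (fun i => A (lift ord0 i)) (fun i => mA _).
set B := [set t | _] in mB BE.
have -> : box = [set t | A ord0 (thead t) /\ B [tuple of behead t]].
  apply/seteqP; split=> t /= tA.
    split=> [|i]; first exact: tA.
    by have := tA (lift ord0 i); rewrite [in tnth t _](tuple_eta t) tnthS.
  move=> i; case: (unliftP ord0 i) => [j ->|->]; last exact: tA.1.
  by have := tA.2 j; rewrite [in tnth t _](tuple_eta t) tnthS.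
have [mbox boxE] := tuple_measure_succE (@lebesgue_measure R) (tuple_lebesgue R n)
  (mA ord0) mB.
by split=> //; rewrite [LHS]boxE BE big_ord_recl.
Qed.

Fact lebesgue_display (R : realType) (n : nat) : measure_display.
Proof. exact. Qed.

(* R^n with the sigma-algebra of Lebesgue measurable sets: the Caratheodory
   sigma-algebra of the outer measure induced by the product Borel measure. *)
Definition euclidean (R : realType) (n : nat) : Type :=
  n.-tuple (measurableTypeR R).

HB.instance Definition _ (R : realType) (n : nat) :=
  Pointed.on (euclidean R n).

HB.instance Definition _ (R : realType) (n : nat) :=
  @isMeasurable.Build (lebesgue_display R n) (euclidean R n)
    ((tuple_lebesgue R n)^*)%mu.-caratheodory
    (caratheodory_measurable_set0 _)
    (@caratheodory_measurable_setC _ _ _)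
    (@caratheodory_measurable_bigcup _ _ _).

Definition lebesgue_n (R : realType) (n : nat) : set (euclidean R n) -> \bar R :=
  ((tuple_lebesgue R n)^*)%mu.

HB.instance Definition _ (R : realType) (n : nat) :=
  isMeasure.Build _ _ _ (@lebesgue_n R n)
    (outer_measure0 ((tuple_lebesgue R n)^*)%mu)
    (outer_measure_ge0 ((tuple_lebesgue R n)^*)%mu)
    (@caratheodory_measure_sigma_additive _ _ ((tuple_lebesgue R n)^*)%mu).

Lemma lebesgue_n_complete (R : realType) (n : nat) :
  measure_is_complete (@lebesgue_n R n).
Proof.
move=> B [A [mA muA0 BA]].
by apply: (@measure_is_complete_caratheodory _ _ ((tuple_lebesgue R n)^*)%mu); exists A.
Qed.

Section variable_exponent.
Variables (R : realType) (n : nat).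
Local Notation euclidean := (euclidean R n).
Local Notation lebesgue_n := (@lebesgue_n R n).

Definition coordinate (x : euclidean) (i : 'I_n) : R :=
  tnth (x : n.-tuple (measurableTypeR R)) i.

Definition edist (x y : euclidean) : R :=
  Num.sqrt (\sum_(i < n) (coordinate x i - coordinate y i) ^+ 2)%R.

Definition enorm (x : euclidean) : R :=
  Num.sqrt (\sum_(i < n) coordinate x i ^+ 2)%R.

(* Each of the 2n faces may or may not belong to the cube. *)
Definition cube (Q : set euclidean) : Prop :=
  exists (a : 'I_n -> R) (l : R) (b c : 'I_n -> bool), (0 < l)%R /\
    Q = [set x | forall i, coordinate x i \in
                   Interval (BSide (b i) (a i)) (BSide (c i) (a i + l)%R)].

Lemma lebesgue_cube (a : 'I_n -> R) (l : R) (b c : 'I_n -> bool) : (0 < l)%R ->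
  let Q := [set x | forall i, coordinate x i \in
                      Interval (BSide (b i) (a i)) (BSide (c i) (a i + l)%R)] in
  measurable (Q : set euclidean) /\ lebesgue_n Q = (l ^+ n)%:E.
Proof.
move=> l0 Q; pose I i : set (measurableTypeR R) :=
  [set` Interval (BSide (b i) (a i)) (BSide (c i) (a i + l)%R)].
have [mQ QE] := tuple_lebesgue_box (fun i => measurable_itv _ : measurable (I i)).
split; first exact: caratheodory_measurable_mu_ext.
apply: (etrans (measurable_mu_extE (tuple_lebesgue R n) mQ)); apply: (etrans QE).
under eq_bigr do
  rewrite /I lebesgue_measure_itv /= lte_fin ltrDl l0 -EFinD addrAC subrr add0r.
by rewrite prodEFin prodr_const card_ord.
Qed.

Definition average (Q : set euclidean) (f : euclidean -> \bar R) : \bar R :=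
  (lebesgue_n Q)^-1 * \int[lebesgue_n]_(y in Q) f y.

Definition exponentP0 (p : euclidean -> \bar R) : Prop :=
  [/\ measurable_fun setT p, forall x, 0 < p x & 0 < ess_inf lebesgue_n p].

(* When x = y the right-hand side of the local condition is 0, as ln 0 = 0. *)
Definition log_Hoelder (r : euclidean -> R) : Prop :=
  [/\ measurable_fun setT r,
      exists2 C0 : R, (0 < C0)%R & forall x y, (edist x y < 2^-1)%R ->
        (`|r x - r y| <= - (C0 / ln (edist x y)))%R
    & exists rinf Cinf : R, [/\ (0 < rinf)%R, (0 < Cinf)%R & forall x,
        (`|r x - rinf| <= Cinf / ln (expR 1 + enorm x))%R]].

(* Only finite exponents are needed, since log-Hoelder exponents are finite. *)
Definition vnorm (q f : euclidean -> R) : \bar R :=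
  ereal_inf [set l%:E | l in [set l : R | (0 < l)%R /\
    \int[lebesgue_n]_x ((`|f x / l| `^ q x)%R)%:E <= 1]].

Definition scalar_weight (w : euclidean -> R) : Prop :=
  [/\ measurable_fun setT w, forall x, (0 <= w x)%R
    & {ae lebesgue_n, forall x, (0 < w x)%R}].

(* The integrand is log (w^-1) off the negligible set where w = 0. *)
Definition Apinfty_constant (p w : euclidean -> R) : \bar R :=
  ereal_sup [set (vnorm p \1_Q)^-1 * vnorm p (w \* \1_Q)%R *
                 expeR (average Q (fun y => (ln (w y)^-1)%:E)) | Q in cube].

(* If vnorm p (w 1_Q) = +oo, then the positive part of log w may fail to be
   integrable on Q, and the product above becomes +oo * 0, which \bar R
   evaluates to 0; the first conjunct keeps such a Q from counting as a finite
   contribution. If vnorm p (w 1_Q) is finite and p is bounded, the positive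
   part of log w is integrable on Q and no such product occurs. *)
Definition Apinfty (p w : euclidean -> R) : Prop :=
  (forall Q, cube Q -> vnorm p (w \* \1_Q)%R < +oo) /\
  Apinfty_constant p w < +oo.

End variable_exponent.

(* Main.v *)
Require Import Defs.
From mathcomp Require Import all_boot all_order all_algebra.
From mathcomp Require Import all_classical all_reals all_analysis.
From mathcomp Require Import measurable_realfun ess_sup_inf.
From mathcomp Require Import ring lra.

Set Implicit Arguments.
Unset Strict Implicit.
Unset Printing Implicit Defensive.
Import Order.TTheory GRing.Theory Num.Theory.
Import numFieldNormedType.Exports.

Local Open Scope classical_set_scope.
Local Open Scope ring_scope.
Local Open Scope ereal_scope.

(** Put phi = log w, and for a cube Q let Lam(Q) and nu(Q) be the logarithms of
the norms of w 1_Q and of 1_Q in L^p: the integrals over Q of v_Q = exp(p (phi -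
Lam(Q))) and of u_Q = exp(- p nu(Q)) both equal 1.  Each of the two conditions
includes the finiteness of the norm of w 1_Q, so that Lam(Q) is a real number.
The number T(Q) = Lam(Q) - nu(Q) is the logarithm of the mean of w over Q
measured in L^p.  In these terms (i) says that the mean over Q of T(Q) - phi is
bounded above, uniformly in Q.  As the norm of 1_Q in L^(rp) is exp(nu(Q) / r),
with r = 1 + s statement (ii) says that the integrals over Q of exp((1 + s) p
(phi - Lam(Q)) + s p nu(Q)) are bounded: a reverse Hoelder inequality with
exponent r for v_Q / u_Q with respect to the probability measure u_Q dx on Q.
The other half of the oscillation, the mean of the positive part of phi - T(Q),
is bounded for every such weight ([upper_oscillation]).

Log-Hoelder continuity enters through |Q| u_Q.  This function is bounded above
and below on Whitney cubes, those of side at most 1 or lying at a distance at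
least their side from the origin ([whitney_flat]).  On a large cube near the
origin it may vary by a power of |Q|, but only on a part of negligible size, so
its logarithm and a power of it are still bounded in mean
([average_estimates]).

From (i) to (ii).  The negative part of log (|Q| v_Q) is bounded in mean, so
|Q| v_Q is bounded below outside a small part of Q.  This makes exp(Lam) both
doubling and reverse doubling.  On a Whitney cube Q the functions v_Q and v_P
are, on a dyadic subcube P, proportional up to a bounded factor: by doubling
Lam(Q) - Lam(P) is at most a multiple of log (|Q| / |P|), and the oscillation of
p on P compensates that.  Hence v_Q is an A_infinity weight on the dyadic
subcubes of Q in the sense of a constant exponent, and a Calderon-Zygmund
argument gives the reverse Hoelder inequality ([reverse_hoelder]).  A large cube
Q is the union of boundedly many pieces of Whitney cubes and of one cube Q' of
half its side.  When s is small, reverse doubling makes the integral in (ii)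
contract from Q' to Q, and an induction on the size of Q concludes
([gehring_bound]).

From (ii) to (i).  The reverse Hoelder inequality makes v_Q dx absolutely
continuous with respect to dx / |Q|, uniformly in Q.  Thus phi > T(Q) - g on a
fixed proportion of Q, and T grows by a bounded amount from a dyadic cube to its
parent.  If t <= T(Q) - g, then around almost every point of the set phi <= t in
Q there is a dyadic cube almost filled by this set; stopping at the parent of
the first one, on which phi <= t + A nearly everywhere, one gets
|phi <= t| <= theta |phi <= t + A| on Q with theta < 1.  So |phi <= T(Q) - x|
decays exponentially in x ([lower_oscillation]). *)

(** * Integrals of nonnegative real functions *)

(** Measurability of expressions built from measurable functions; the goal is
matched syntactically because trial unification would unfold [expR]. *)
Ltac mfun :=
  repeat first [ match goal with
  | |- measurable_fun _ (fun x => (@?f x + @?g x)%R) => apply: (@measurable_funD _ _ _ _ f g)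
  | |- measurable_fun _ (fun x => (- @?f x)%R) =>
      apply: (@measurableT_comp _ _ _ _ _ _ _ _ f); first exact: oppr_measurable
  | |- measurable_fun _ (fun x => (@?f x * @?g x)%R) => apply: (@measurable_funM _ _ _ _ f g)
  | |- measurable_fun _ (fun x => expR (@?f x)) =>
      apply: (@measurableT_comp _ _ _ _ _ _ _ _ f); first exact: measurable_expR
  | |- measurable_fun _ (fun x => (`| @?f x |)%R) =>
      apply: (@measurableT_comp _ _ _ _ _ _ _ _ f); first exact: normr_measurable
  | |- measurable_fun _ (fun x => Num.max (@?f x) (@?g x)) => apply: (@measurable_maxr _ _ _ _ f g)
  end | assumption | exact: measurable_cst ].

Lemma lee_mul_cancel (R : realType) (a b : R) (X : \bar R) :
  (0 < a)%R -> a%:E * X <= (a * b)%:E -> X <= b%:E.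
Proof.
move=> a0; rewrite EFinM => h; rewrite -(@lee_pmul2l _ a%:E)//.
Qed.

Section integral_real.
Context d (T : measurableType d) (R : realType).
Variable mu : {measure set T -> \bar R}.
Implicit Types (E F : set T) (f g : T -> R).

Lemma measurable_EFinT E f :
  measurable_fun setT f -> measurable_fun E (fun x => (f x)%:E).
Proof.
by move=> mf; apply: (measurable_funS measurableT) => //; exact/measurable_EFinP.
Qed.

Lemma le_int E f g : measurable E ->
  measurable_fun setT f -> measurable_fun setT g ->
  (forall x, E x -> 0 <= f x)%R -> (forall x, E x -> f x <= g x)%R ->
  \int[mu]_(x in E) (f x)%:E <= \int[mu]_(x in E) (g x)%:E.
Proof.
move=> mE mf mg f0 fg; apply: ge0_le_integral => //; try exact: measurable_EFinT.
Qed.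

Lemma int_cst E (c : R) : measurable E -> \int[mu]_(x in E) c%:E = c%:E * mu E.
Proof. by move=> mE; rewrite -(integral_cst mu mE). Qed.

Lemma intD E f g : measurable E ->
  measurable_fun setT f -> measurable_fun setT g ->
  (forall x, E x -> 0 <= f x)%R -> (forall x, E x -> 0 <= g x)%R ->
  \int[mu]_(x in E) (f x + g x)%:E =
  \int[mu]_(x in E) (f x)%:E + \int[mu]_(x in E) (g x)%:E.
Proof.
move=> mE mf mg f0 g0; under eq_integral do rewrite EFinD.
rewrite ge0_integralD//; try exact: measurable_EFinT.
Qed.

Lemma intZ E f (c : R) : measurable E -> measurable_fun setT f ->
  (forall x, E x -> 0 <= f x)%R -> (0 <= c)%R ->
  \int[mu]_(x in E) (c * f x)%:E = c%:E * \int[mu]_(x in E) (f x)%:E.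
Proof.
move=> mE mf f0 c0; under eq_integral do rewrite EFinM.
rewrite ge0_integralZl_EFin//; try exact: measurable_EFinT.
Qed.

Lemma int_setU E F f : measurable E -> measurable F -> measurable_fun setT f ->
  (forall x, 0 <= f x)%R -> E `&` F = set0 ->
  \int[mu]_(x in E `|` F) (f x)%:E =
  \int[mu]_(x in E) (f x)%:E + \int[mu]_(x in F) (f x)%:E.
Proof.
move=> mE mF mf f0 EF; rewrite ge0_integral_setU//; try exact: measurable_EFinT.
- by move=> x _; rewrite lee_fin.
- by rewrite disj_set2E EF.
Qed.

Lemma int_subset E F f : measurable E -> measurable F -> measurable_fun setT f ->
  (forall x, 0 <= f x)%R -> E `<=` F ->
  \int[mu]_(x in E) (f x)%:E <= \int[mu]_(x in F) (f x)%:E.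
Proof.
move=> mE mF mf f0 EF; apply: ge0_subset_integral => //; try exact: measurable_EFinT.
by move=> x _; rewrite lee_fin.
Qed.

Lemma measurable_sup_level f (t : R) : measurable_fun setT f ->
  measurable [set x | (t <= f x)%R].
Proof.
move=> mf; rewrite (_ : [set x | _] = setT `&` f @^-1` `[t, +oo[%classic).
  exact: mf.
by rewrite setTI; apply/seteqP; split=> x /=; rewrite in_itv/= andbT.
Qed.

Lemma measurable_sub_level f (t : R) : measurable_fun setT f ->
  measurable [set x | (f x <= t)%R].
Proof.
move=> mf; rewrite (_ : [set x | _] = setT `&` f @^-1` `]-oo, t]%classic).
  exact: mf.
by rewrite setTI; apply/seteqP; split=> x /=; rewrite in_itv/=.
Qed.

Lemma chebyshev E f (t : R) : measurable E -> measurable_fun setT f ->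
  (0 <= t)%R -> (forall x, 0 <= f x)%R ->
  t%:E * mu (E `&` [set x | (t <= f x)%R]) <= \int[mu]_(x in E) (f x)%:E.
Proof.
move=> mE mf t0 f0; have mL := measurable_sup_level t mf.
have mI := measurableI _ _ mE mL.
rewrite -int_cst//; apply: (@le_trans _ _ (\int[mu]_(x in E `&` [set x | (t <= f x)%R]) (f x)%:E)).
  by apply: le_int => // x [].
by apply: int_subset => //; exact: subIsetl.
Qed.

(** Most estimates below compare integrals of exponentials whose exponents
differ by a constant; this form serves both directions. *)
Lemma le_int_expR E f g (k : R) : measurable E ->
  measurable_fun setT f -> measurable_fun setT g ->
  (forall x, E x -> f x <= k + g x)%R ->
  \int[mu]_(x in E) (expR (f x))%:E <= (expR k)%:E * \int[mu]_(x in E) (expR (g x))%:E.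
Proof.
move=> mE mf mg fg; have me (h : T -> R) : measurable_fun setT h ->
    measurable_fun setT (fun x => expR (h x)) by move=> ?; mfun.
rewrite -(intZ mE (me _ mg) (fun x _ => expR_ge0 _) (expR_ge0 k)).
apply: (le_int mE (me _ mf)); first by mfun.
- by move=> x _; exact: expR_ge0.
- by move=> x Ex; rewrite -expRD ler_expR fg.
Qed.

Lemma int_expR_subset E F f : measurable E -> measurable F -> measurable_fun setT f ->
  E `<=` F ->
  \int[mu]_(x in E) (expR (f x))%:E <= \int[mu]_(x in F) (expR (f x))%:E.
Proof.
by move=> mE mF mf EF; apply: int_subset => //; mfun.
Qed.

End integral_real.

(** * Half-open cubes and their dyadic subcubes *)

Section cubes.
Variables (R : realType) (n : nat).
Hypothesis n_gt0 : (0 < n)%N.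
Local Notation E := (euclidean R n).
Local Notation mu := (@lebesgue_n R n).
Local Notation corner := {ffun 'I_n -> bool}.

(** A half-open cube splits into disjoint children, and every cube agrees with a
half-open one up to a null set. *)
Record hcube := Hcube { origin : 'I_n -> R ; side : R }.
Implicit Types (c : hcube) (e : corner) (s : seq corner).

Definition cube_set c : set E :=
  [set x | forall i, (origin c i <= coordinate x i < origin c i + side c)%R].

Coercion cube_set : hcube >-> set.

(** The corner [e] selects, in each direction, the lower or the upper half. *)
Definition child c e :=
  Hcube (fun i => origin c i + (e i)%:R * (side c / 2))%R (side c / 2)%R.

Fixpoint desc c s := if s is e :: s' then desc (child c e) s' else c.

Lemma cube_setE c :
  cube_set c = [set x | forall i, coordinate x i \in
    Interval (BSide true (origin c i)) (BSide true (origin c i + side c)%R)].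
Proof. by apply/seteqP; split=> x cx i; have := cx i; rewrite in_itv. Qed.

Lemma measurable_cube c : measurable (c : set E).
Proof.
have [c0|c0] := ltP 0%R (side c).
  rewrite cube_setE.
  exact: (lebesgue_cube (origin c) (fun=> true) (fun=> true) c0).1.
rewrite (_ : cube_set c = set0)//; apply/seteqP; split=> // x cx.
by have := cx (Ordinal n_gt0) => /andP[]; lra.
Qed.

Lemma mu_cube c : (0 < side c)%R -> mu c = (side c ^+ n)%:E.
Proof.
move=> c0; rewrite cube_setE.
exact: (lebesgue_cube (origin c) (fun=> true) (fun=> true) c0).2.
Qed.

Lemma child_side_gt0 c e : (0 < side c)%R -> (0 < side (child c e))%R.
Proof. by move=> c0 /=; lra. Qed.

Lemma desc_side c s : side (desc c s) = (side c / 2 ^+ size s)%R.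
Proof.
elim: s c => [|e s ih] c /=; first by rewrite expr0 divr1.
by rewrite ih /= exprS invfM mulrA.
Qed.

Lemma desc_side_gt0 c s : (0 < side c)%R -> (0 < side (desc c s))%R.
Proof. by move=> c0; rewrite desc_side divr_gt0// exprn_gt0. Qed.

Lemma children_cover c : cube_set c = \big[setU/set0]_(e : corner) cube_set (child c e).
Proof.
rewrite -bigcup_seq; apply/seteqP; split=> x.
  move=> cx; exists [ffun i => (origin c i + side c / 2 <= coordinate x i)%R].
    by rewrite /= mem_index_enum.
  move=> i /=; rewrite ffunE; have /andP[] := cx i.
  by case: (leP (origin c i + side c / 2)%R (coordinate x i)) => /=;
    rewrite ?mulr1n ?mulr0n => ? ? ?; apply/andP; split; lra.
move=> [e _ cx] i; have /andP[] := cx i => /=.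
by case: (e i) => /=; rewrite ?mulr1n ?mulr0n => ? ?; apply/andP; split; lra.
Qed.

Lemma child_sub c e : cube_set (child c e) `<=` c.
Proof.
move=> x cx i; have /andP[] := cx i => /=.
by case: (e i) => /=; rewrite ?mulr1n ?mulr0n => ? ?; apply/andP; split; lra.
Qed.

Lemma desc_sub c s : cube_set (desc c s) `<=` c.
Proof.
elim: s c => [|e s ih] c //= x /ih; exact: child_sub.
Qed.

Lemma trivIset_children c (D : set corner) : trivIset D (fun e => cube_set (child c e)).
Proof.
move=> e1 e2 _ _ [x [/= x1 x2]]; apply/ffunP => i.
have /andP[] := x1 i; have /andP[] := x2 i => /=.
by case: (e1 i); case: (e2 i) => //=; rewrite ?mulr1n ?mulr0n; lra.
Qed.

Lemma int_children c (f : E -> R) : measurable_fun setT f -> (forall x, 0 <= f x)%R ->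
  \int[mu]_(x in cube_set c) (f x)%:E =
  \sum_(e : corner) \int[mu]_(x in cube_set (child c e)) (f x)%:E.
Proof.
move=> mf f0; rewrite {1}children_cover ge0_integral_bigsetU//.
- by move=> e; exact: measurable_cube.
- exact: index_enum_uniq.
- exact: trivIset_children.
- exact: measurable_EFinT.
- by move=> x _; rewrite lee_fin.
Qed.

Lemma mu_children c (X : set E) : measurable X ->
  mu (X `&` c) = \sum_(e : corner) mu (X `&` child c e).
Proof.
move=> mX; have mc c' : measurable (cube_set c') by exact: measurable_cube.
rewrite -integral_indic//; under [RHS]eq_bigr do rewrite -integral_indic//.
by rewrite int_children.
Qed.

(** This instance and the next restate general facts with the measure as a
function on sets, the form in which rewriting recognizes its values on cubes. *)
Lemma int_const (X : set E) (r : R) : measurable X ->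
  \int[mu]_(x in X) r%:E = r%:E * mu X.
Proof. exact: int_cst. Qed.

Lemma mu_level_le (X : set E) (f : E -> R) (t : R) : measurable X ->
  measurable_fun setT f -> (0 <= t)%R -> (forall x, 0 <= f x)%R ->
  t%:E * mu (X `&` [set x | (t <= f x)%R]) <= \int[mu]_(x in X) (f x)%:E.
Proof. exact: chebyshev. Qed.

Lemma card_corner : #|{: corner}| = (2 ^ n)%N.
Proof. by rewrite card_ffun card_bool card_ord. Qed.

End cubes.

(** * A weak density theorem for dyadic cubes *)

Section dyadic.
Variables (R : realType) (n : nat).
Hypothesis n_gt0 : (0 < n)%N.
Local Notation E := (euclidean R n).
Local Notation mu := (@lebesgue_n R n).
Local Notation corner := {ffun 'I_n -> bool}.
Local Notation hcube := (hcube R n).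
Implicit Types (c : hcube) (e : corner) (s : seq corner) (A B X : set E).

Lemma mu_le A B : A `<=` B -> mu A <= mu B.
Proof. exact: (le_outer_measure ((tuple_lebesgue R n)^*)%mu). Qed.

Lemma mu_setU A B : mu (A `|` B) <= mu A + mu B.
Proof. exact: (outer_measureU2 ((tuple_lebesgue R n)^*)%mu). Qed.

Lemma mu_cube_fin X c : (0 < side c)%R -> mu (X `&` c) \is a fin_num.
Proof.
move=> c0; rewrite ge0_fin_numE//; apply: (@le_lt_trans _ _ (mu c)).
  by apply: mu_le; exact: subIsetr.
by rewrite mu_cube// ltry.
Qed.

(** Finite unions of dyadic subcubes of [c] of generation [K], described through
their trace on [c] only. *)
Fixpoint dyadic_set (K : nat) c A : Prop :=
  if K is K'.+1 then forall e, dyadic_set K' (child c e) A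
  else (c : set E) `<=` A \/ A `&` c = set0.

Lemma dyadic_setS K c A : dyadic_set K c A -> dyadic_set K.+1 c A.
Proof.
elim: K c => [|K ih] c /=; last by move=> cA e; apply: ih; exact: cA.
move=> [cA|cA0] e; [left|right].
  by apply: subset_trans cA; exact: child_sub.
by apply/seteqP; split=> // x [Ax /child_sub cx]; rewrite -cA0.
Qed.

Lemma dyadic_set_le K K' c A : (K <= K')%N -> dyadic_set K c A -> dyadic_set K' c A.
Proof.
move=> /subnK <-; elim: (K' - K)%N => [|m ih]; first by rewrite add0n.
by move=> /ih; rewrite addSn; exact: dyadic_setS.
Qed.

Lemma dyadic_setC K c A : dyadic_set K c A -> dyadic_set K c (~` A).
Proof.
elim: K c => [|K ih] c /=; last by move=> cA e; apply: ih; exact: cA.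
move=> [cA|cA0]; [right|left].
  by apply/seteqP; split=> // x [nAx /cA].
by move=> x cx Ax; have : (A `&` c) x by []; rewrite cA0.
Qed.

Lemma dyadic_setU K c A B :
  dyadic_set K c A -> dyadic_set K c B -> dyadic_set K c (A `|` B).
Proof.
elim: K c => [|K ih] c /=; last by move=> cA cB e; apply: ih.
move=> [cA _|cA0 [cB|cB0]]; [left|left|right].
- by apply: subset_trans cA _; exact: subsetUl.
- by apply: subset_trans cB _; exact: subsetUr.
- by rewrite setIUl cA0 cB0 setU0.
Qed.

Lemma dyadic_set_ext K c A B : A `&` c = B `&` c -> dyadic_set K c A -> dyadic_set K c B.
Proof.
elim: K c => [|K ih] c /= AB.
  move=> [cA|cA0]; [left|right]; last by rewrite -AB.
  by move=> x cx; have [] : (B `&` c) x by rewrite -AB; split => //; exact: cA.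
move=> dA e; apply: ih (dA e); have cc := @child_sub _ _ c e.
by rewrite -(setIidr cc) !setIA AB.
Qed.

Lemma measurable_dyadic_set K c A : dyadic_set K c A -> measurable (A `&` c).
Proof.
elim: K c => [|K ih] c /=.
  by move=> [cA|->//]; rewrite setIidr//; exact: measurable_cube.
move=> dA; rewrite {1}children_cover big_distrr/=; apply: bigsetU_measurable => e _.
exact: ih.
Qed.

Lemma mu_children' X c : measurable (X `&` c) ->
  mu (X `&` c) = \sum_(e : corner) mu (X `&` child c e).
Proof.
move=> mX; rewrite {1}(_ : X `&` c = (X `&` c) `&` c); last first.
  by rewrite -setIA setIid.
rewrite mu_children//; apply: eq_bigr => e _; rewrite -setIA.
by rewrite (setIidr (@child_sub _ _ c e)).
Qed.

(** A bound on the density of [X] in every dyadic cube passes to finite disjoint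
unions of such cubes by additivity. *)
Lemma density_dyadic_set X (al : R) K c A : measurable X ->
  (forall s, mu (X `&` desc c s) <= al%:E * mu (desc c s)) -> (0 < side c)%R ->
  dyadic_set K c A -> mu (X `&` (A `&` c)) <= al%:E * mu (A `&` c).
Proof.
move=> mX; elim: K c => [|K ih] c Xs c0 /=.
  move=> [cA|->]; first by rewrite (setIidr cA); exact: (Xs [::]).
  by rewrite setI0 measure0 mule0.
move=> dA; have mAc : measurable (A `&` c) by exact: (@measurable_dyadic_set K.+1).
rewrite setIA !mu_children' -?setIA//; last exact: measurableI.
rewrite ge0_sume_distrr//; apply: lee_sum => e _; rewrite -setIA.
apply: ih; [by move=> s; exact: (Xs (e :: s))|exact: child_side_gt0|exact: dA].
Qed.

(** Approximability in measure by finite unions of dyadic cubes, inside every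
cube.  This property is stable under the operations of a sigma-algebra, which is
how it reaches all Borel sets. *)
Definition approximable B := measurable B /\
  forall c (eps : R), (0 < side c)%R -> (0 < eps)%R ->
    exists K A, dyadic_set K c A /\
      mu (c `&` ((B `\` A) `|` (A `\` B))) <= eps%:E.

Lemma approximableC B : approximable B -> approximable (~` B).
Proof.
move=> [mB aB]; split; first exact: measurableC.
move=> c eps c0 e0; have [K [A [dA BA]]] := aB c eps c0 e0.
exists K, (~` A); split; first exact: dyadic_setC.
by rewrite !setDE !setCK setUC ![~` _ `&` _]setIC -!setDE.
Qed.

Lemma approximableU B1 B2 :
  approximable B1 -> approximable B2 -> approximable (B1 `|` B2).
Proof.
move=> [mB1 a1] [mB2 a2]; split; first exact: measurableU.
move=> c eps c0 e0; have e20 : (0 < eps / 2)%R by lra.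
have [K1 [A1 [d1 h1]]] := a1 c _ c0 e20; have [K2 [A2 [d2 h2]]] := a2 c _ c0 e20.
exists (maxn K1 K2), (A1 `|` A2); split.
  by apply: dyadic_setU; [apply: dyadic_set_le d1|apply: dyadic_set_le d2];
    rewrite ?leq_maxl ?leq_maxr.
rewrite [eps in leRHS](_ : _ = eps / 2 + eps / 2)%R; last by lra.
rewrite EFinD; apply: le_trans (leeD h1 h2).
apply: le_trans (mu_setU _ _); apply: mu_le => x [cx].
rewrite -setIUr => -[[[B1x|B2x] nA]|[[A1x|A2x] nB]]; split => //.
- by left; left; split => // ?; apply: nA; left.
- by right; left; split => // ?; apply: nA; right.
- by left; right; split => // ?; apply: nB; left.
- by right; right; split => // ?; apply: nB; right.
Qed.

Lemma approximable0 : approximable set0.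
Proof.
split => // c eps c0 e0; exists 0%N, set0; split; first by right; rewrite set0I.
by rewrite setDv setU0 setI0 measure0 lee_fin ltW.
Qed.

(** Inside a cube of finite measure, finitely many terms exhaust the union up to
a small set, and finite unions are already known. *)
Lemma approximable_bigcup (F : (set E)^nat) :
  (forall k, approximable (F k)) -> approximable (\bigcup_k F k).
Proof.
move=> aF; have mF k : measurable (F k) by exact: (aF k).1.
split; first exact: bigcup_measurable.
move=> c eps c0 e0; have e20 : (0 < eps / 2)%R by lra.
pose G m := \big[setU/set0]_(k < m) F k.
have aG m : approximable (G m).
  elim: m => [|m ih]; first by rewrite /G big_ord0; exact: approximable0.
  by rewrite /G big_ord_recr; apply: approximableU.
have mc : measurable (c : set E) by exact: measurable_cube.
have mG m : measurable (G m `&` c) by apply: measurableI => //; exact: (aG m).1.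
have UG : \bigcup_m (G m `&` c) = (\bigcup_k F k) `&` c.
  rewrite -setI_bigcupl; congr (_ `&` _); apply/seteqP; split=> x.
    by move=> [m _]; rewrite /G -bigcup_mkord => -[k _ Fx]; exists k.
  move=> [k _ Fx]; exists k.+1 => //; rewrite /G -bigcup_mkord; exists k => //=.
have cvG : mu (G m `&` c) @[m --> \oo] --> mu ((\bigcup_k F k) `&` c).
  rewrite -UG; apply: nondecreasing_cvg_mu => //.
    by rewrite UG; apply: measurableI => //; exact: bigcup_measurable.
  apply/nondecreasing_seqP => m; apply/subsetPset; apply: setSI.
  by rewrite /G big_ord_recr/=; exact: subsetUl.
have fin := mu_cube_fin (\bigcup_k F k) c0.
have [m hm] : exists m, mu ((\bigcup_k F k) `&` c) - (eps / 2)%:E < mu (G m `&` c).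
  apply/not_existsP => hm.
  have : mu ((\bigcup_k F k) `&` c) <= mu ((\bigcup_k F k) `&` c) - (eps / 2)%:E.
    rewrite -(cvg_lim _ cvG)//; apply: lime_le; first by apply/cvg_ex; eexists; exact: cvG.
    by apply: nearW => m; rewrite (cvg_lim _ cvG)// leNgt; apply/negP/hm.
  rewrite leNgt => /negP; apply.
  by rewrite lteBlDr// -[ltLHS]adde0 lteD2lE// lte_fin.
have [K [A [dA hA]]] := (aG m).2 c _ c0 e20.
exists K, A; split => //.
rewrite [eps in leRHS](_ : _ = eps / 2 + eps / 2)%R; last by lra.
rewrite EFinD; apply: (@le_trans _ _ (mu (((\bigcup_k F k) `&` c) `\` (G m `&` c)) +
    mu (c `&` ((G m `\` A) `|` (A `\` G m))))).
  apply: le_trans (mu_setU _ _); apply: mu_le => x [cx [[Fx nA]|[Ax nF]]].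
    have [Gx|nGx] := pselect (G m x); [right|left].
      by split => //; left.
    by split => // -[].
  right; split => //; right; split => // Gx; apply: nF.
  by move: Gx; rewrite /G -bigcup_mkord => -[k _ Fx]; exists k.
apply: leeD => //; have mFc : measurable ((\bigcup_k F k) `&` c).
  by apply: measurableI => //; exact: bigcup_measurable.
rewrite measureD//; last by rewrite -ge0_fin_numE.
have sub : G m `&` c `<=` (\bigcup_k F k) `&` c by rewrite -UG => x Gx; exists m.
rewrite [X in _ - mu X](setIidr sub).
rewrite leeBlDr; last exact: mu_cube_fin.
by rewrite addeC -leeBlDr// ltW.
Qed.

(** The hyperplane bounding the half-space misses at least one of the 2^n
children of each cube.  Only the other children contribute to the error, so it
is multiplied by 1 - 2^-n at each generation. *)
Lemma ray_approx (i : 'I_n) (t : R) K c : (0 < side c)%R ->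
  exists A, dyadic_set K c A /\
   mu (c `&` (([set x | coordinate x i < t]%R `\` A) `|` (A `\` [set x | coordinate x i < t]%R)))
   <= ((1 - (2 ^+ n)^-1) ^+ K * side c ^+ n)%:E.
Proof.
set B := [set x | _].
elim: K c => [|K ih] c c0.
  exists set0; split; first by right; rewrite set0I.
  by rewrite expr0 mul1r -mu_cube//; apply: mu_le; exact: subIsetl.
have /choice[Ae Aep] : forall e, exists X, dyadic_set K (child c e) X /\
    mu (child c e `&` ((B `\` X) `|` (X `\` B)))
    <= ((1 - (2 ^+ n)^-1) ^+ K * side (child c e) ^+ n)%:E.
  by move=> e; apply: ih; exact: child_side_gt0.
have [e0 [A0 [d0 A0B]]] : exists e0 A0, dyadic_set 0 (child c e0) A0 /\
    child c e0 `&` ((B `\` A0) `|` (A0 `\` B)) = set0.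
  have [tm|mt] := leP t (origin c i + side c / 2)%R.
    (* the child at the upper corner lies outside the half-space *)
    exists [ffun=> true], set0; split; first by right; rewrite set0I.
    apply/seteqP; split => // x [cx [[Bx _]|[]//]].
    have /andP[] := cx i; rewrite /= ffunE mulr1n mul1r => h _.
    by move: Bx; rewrite /B/=; lra.
  (* the child at the lower corner lies inside the half-space *)
  exists [ffun=> false], setT; split; first by left.
  apply/seteqP; split => // x [cx [[_ []//]|[_ nB]]]; apply: nB.
  have /andP[] := cx i; rewrite /= ffunE mulr0n mul0r addr0 => _ h.
  by rewrite /B/=; lra.
pose A e := if e == e0 then A0 else Ae e.
exists [set x | exists e, (child c e : set E) x /\ A e x].
have AE e x : (child c e : set E) x ->
    (exists e', (child c e' : set E) x /\ A e' x) <-> A e x.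
  move=> cx; split=> [[e' [cx' Ax]]|Ax]; last by exists e.
  suff -> : e = e' by [].
  by apply: (@trivIset_children _ _ c setT) => //; exists x.
split.
  move=> e; apply: (@dyadic_set_ext _ _ (A e)).
    apply/seteqP; split=> x [Ax cx]; split => //; last exact/(AE e).
    by exists e.
  rewrite /A; case: eqP => [->|_]; last exact: (Aep e).1.
  exact: (@dyadic_set_le 0).
set A' := [set x | _].
pose r e : R := if e == e0 then 0%R else ((1 - (2 ^+ n)^-1) ^+ K * (side c / 2) ^+ n)%R.
apply: (@le_trans _ _ (\sum_(e : corner) (r e)%:E)).
  rewrite setIC {1}children_cover big_distrr/=.
  apply: (@le_trans _ _ (\sum_(e : corner) mu ((B `\` A' `|` A' `\` B) `&` child c e))).
    elim/big_ind2 : _ => //; first by rewrite measure0.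
    by move=> X x Y y Xx Yy; apply: le_trans (mu_setU _ _) (leeD Xx Yy).
  apply: lee_sum => e _; rewrite setIC.
  have -> : child c e `&` (B `\` A' `|` A' `\` B) = child c e `&` (B `\` A e `|` A e `\` B).
    apply/seteqP; split=> x [cx [[Bx Ax]|[Ax Bx]]]; split => //.
    - by left; split => // h; apply: Ax; exact/(AE e).
    - by right; split => //; apply/(AE e).
    - by left; split => // h; apply: Ax; apply/(AE e).
    - by right; split => //; exact/(AE e).
  rewrite /A /r; case: eqP => [->|_]; first by rewrite A0B measure0.
  exact: (Aep e).2.
rewrite sumEFin lee_fin /r (bigD1 e0)//= eqxx add0r.
rewrite (eq_bigr (fun=> (1 - (2 ^+ n)^-1) ^+ K * (side c / 2) ^+ n)%R); last first.
  by move=> e /negbTE ->.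
rewrite sumr_const cardC1 card_corner exprS.
have n2 : (2 ^+ n != 0 :> R)%R by rewrite expf_neq0.
rewrite -[(_ *+ (_ ^ _).-1)%R]mulr_natl -subn1 natrB ?expn_gt0// natrX expr_div_n.
rewrite le_eqVlt; apply/orP; left; apply/eqP.
by field.
Qed.

Lemma approximable_ray (i : 'I_n) (t : R) : approximable [set x | coordinate x i < t]%R.
Proof.
split.
  apply: caratheodory_measurable_mu_ext.
  suff -> : [set x | coordinate x i < t]%R =
      setT `&` (fun x : n.-tuple (measurableTypeR R) => tnth x i) @^-1` `]-oo, t[%classic.
    exact: measurable_tnth.
  by rewrite setTI; apply/seteqP; split => x /=; rewrite in_itv.
move=> c eps c0 e0.
have n2 : (1 <= 2 ^+ n :> R)%R by rewrite exprn_ege1// ler1n.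
have i1 : ((2 ^+ n)^-1 <= 1 :> R)%R by rewrite invf_le1// (lt_le_trans ltr01).
have i0 : (0 < (2 ^+ n)^-1 :> R)%R by rewrite invr_gt0 (lt_le_trans ltr01).
have [K hK] : exists K, ((1 - (2 ^+ n)^-1) ^+ K * side c ^+ n <= eps)%R.
  have := @cvg_geometric R (side c ^+ n) (1 - (2 ^+ n)^-1)%R.
  rewrite ger0_norm; last lra.
  have th1 : (1 - (2 ^+ n)^-1 < 1 :> R)%R by lra.
  move=> /(_ th1)/cvgrPdist_le/(_ _ e0)[K _ /(_ K (leqnn K))].
  rewrite /geometric/= sub0r normrN => /(le_trans (ler_norm _)).
  by rewrite mulrC => ?; exists K.
have [A [dA hA]] := ray_approx i t K c0.
by exists K, A; split => //; apply: le_trans hA _; rewrite lee_fin.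
Qed.

(** Borel sets of tuples are generated by the coordinates, and Borel sets of the
line by rays. *)
Lemma approximable_borel (B : set (n.-tuple (measurableTypeR R))) :
  measurable B -> approximable B.
Proof.
have sig (T : Type) (f : E -> T) (G : set (set T)) :
    (forall S, G S -> approximable (f @^-1` S)) -> forall S, <<s G >> S -> approximable (f @^-1` S).
  move=> GS; apply: smallest_sub => //; split => /=.
  - by rewrite preimage_set0; exact: approximable0.
  - by move=> S aS; rewrite setTD preimage_setC; exact: approximableC.
  - by move=> F aF; rewrite preimage_bigcup; exact: approximable_bigcup.
have ray i (S : set (measurableTypeR R)) : measurable S ->
    approximable ((fun x : E => coordinate x i) @^-1` S).
  rewrite RGenInftyO.measurableE => mS; apply: sig mS => _ [t ->].
  rewrite (_ : _ @^-1` _ = [set x | coordinate x i < t]%R); first exact: approximable_ray.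
  by apply/seteqP; split => x /=; rewrite in_itv.
move=> mB; apply: (sig _ id _ _ _ mB) => S; rewrite -bigcup_seq => -[k /= _ [Y mY <-]].
by rewrite setTI; exact: ray.
Qed.

(** A substitute for the Lebesgue density theorem: a set of positive measure has
density close to 1 in some dyadic cube.  Indeed, cover X in c by a Borel set of
almost the same measure and approximate this Borel set by a finite union A of
dyadic cubes; then |X| is about |X in A| <= al |A|, and |A| is about |X|. *)
Lemma null_of_density X (al : R) c : measurable X -> (0 < side c)%R -> (al < 1)%R ->
  (forall s, mu (X `&` desc c s) <= al%:E * mu (desc c s)) -> mu (X `&` c) = 0.
Proof.
move=> mX c0 al1 Xs.
have mc : measurable (c : set E) by exact: measurable_cube.
have al0 : (0 <= al)%R.
  have := Xs [::]; rewrite /= mu_cube// => h.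
  have : 0 <= al%:E * (side c ^+ n)%:E by apply: le_trans h.
  by rewrite -EFinM lee_fin pmulr_lge0// exprn_gt0.
have afin := mu_cube_fin X c0.
set a := mu (X `&` c) in afin *.
suff : (fine a <= 0)%R.
  move=> a0; apply/eqP; rewrite eq_le measure_ge0 andbT.
  by move: a0; rewrite -lee_fin fineK.
apply/ler_addgt0Pl => eps eps0; rewrite addr0.
(* the three approximations below cost h each *)
pose h : R := (eps * (1 - al) / 3)%R.
have h0 : (0 < h)%R by rewrite /h !mulr_gt0//; lra.
have [_ [F [mF XF] <-] hF] : exists2 x,
    [set \sum_(k <oo) tuple_lebesgue R n (A k)
      | A in measurable_cover (X `&` c : set (n.-tuple (measurableTypeR R)))] x & x < a + h%:E.
  exact: lb_ereal_inf_adherent.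
pose B : set E := \bigcup_k F k.
have mB : measurable (B : set (n.-tuple (measurableTypeR R))) by exact: bigcup_measurable.
have muB : mu B <= a + h%:E.
  apply: le_trans (ltW hF).
  apply: le_trans (outer_measure_sigma_subadditive ((tuple_lebesgue R n)^*)%mu F) _.
  have EF k := measurable_mu_extE (tuple_lebesgue R n) (mF k).
  by rewrite (eq_eseriesr (fun k _ => EF k)).
have [K [A [dA hA]]] := (approximable_borel mB).2 c h c0 h0.
have A1 : mu (A `&` c) <= a + h%:E + h%:E.
  apply: le_trans (leeD muB hA); apply: le_trans (mu_setU _ _).
  apply: mu_le => x [Ax cx]; have [Bx|nBx] := pselect (B x); first by left.
  by right; split => //; right.
have A2 : a <= al%:E * (a + h%:E + h%:E) + h%:E.
  apply: (@le_trans _ _ (mu (X `&` (A `&` c)) + h%:E)).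
    apply: le_trans (leeD2l _ hA); apply: le_trans (mu_setU _ _).
    apply: mu_le => x Xc; have Bx := XF _ Xc; have [Xx cx] := Xc.
    have [Ax|nAx] := pselect (A x); first by left.
    by right; split => //; left.
  apply: leeD => //; apply: le_trans (density_dyadic_set mX Xs c0 dA) _.
  by apply: lee_pmul => //; rewrite lee_fin.
have [r ar] : exists r, a = r%:E by exists (fine a); rewrite fineK.
move: A2; rewrite ar -!EFinD lee_fin /= => A2.
have : (r * (1 - al) <= eps * (1 - al))%R.
  have -> : (eps * (1 - al) = 3 * h)%R by rewrite /h; field.
  have : (al * h <= h)%R by rewrite ler_piMl// ltW.
  lra.
by rewrite ler_pM2r//; lra.
Qed.
End dyadic.

(** * Stopping times and the dyadic reverse Hoelder inequality *)

Section stopping.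
Variables (R : realType) (n : nat).
Hypothesis n_gt0 : (0 < n)%N.
Local Notation E := (euclidean R n).
Local Notation mu := (@lebesgue_n R n).
Local Notation corner := {ffun 'I_n -> bool}.
Local Notation hcube := (hcube R n).
Implicit Types (c : hcube) (e : corner) (s : seq corner) (A B X : set E).

(** Locates a positive number on an arithmetic scale; it turns estimates on level
sets into estimates on integrals. *)
Lemma ladder (b y : R) : (0 < b)%R -> (0 < y)%R ->
  exists k : nat, (k%:R * b < y <= k.+1%:R * b)%R.
Proof.
move=> b0 y0.
have ex : exists j : nat, (y <= j%:R * b)%R.
  exists (Num.truncn (y / b)).+1; rewrite -ler_pdivrMr//; apply: ltW.
  by rewrite truncnS_gt.
have := ex_minnP ex; case: ex_minnP => j yj jmin _.
case: j yj jmin => [|k] yk kmin; first by move: yk; rewrite mul0r; lra.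
exists k; rewrite yk andbT ltNge; apply/negP => /kmin.
by rewrite ltnn.
Qed.

Lemma geometric_le (q : R) m : (0 <= q < 1)%R -> (\sum_(k < m) q ^+ k <= (1 - q)^-1)%R.
Proof.
move=> /andP[q0 q1]; have q1' : (0 < 1 - q)%R by lra.
rewrite -[leRHS]mul1r ler_pdivlMr// mulrC.
have -> : ((1 - q) * (\sum_(k < m) q ^+ k) = 1 - q ^+ m)%R.
  by rewrite -opprB mulNr -subrX1 opprB.
by have := exprn_ge0 m q0; lra.
Qed.

Lemma nneseries_le (u : nat -> R) (C : R) : (forall k, 0 <= u k)%R ->
  (forall m, \sum_(k < m) u k <= C)%R -> \sum_(k <oo) (u k)%:E <= C%:E.
Proof.
move=> u0 uC; apply: lime_le.
  by apply: is_cvg_nneseries => k _ _; rewrite lee_fin.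
by apply: nearW => m; rewrite big_mkord sumEFin lee_fin.
Qed.

Lemma nneseries_ge_term (u : nat -> R) k : (forall k, 0 <= u k)%R ->
  (u k)%:E <= \sum_(k <oo) (u k)%:E.
Proof.
move=> u0; apply: le_trans (nneseries_lim_ge k.+1 _); last first.
  by move=> j _ _; rewrite lee_fin.
by rewrite big_nat_recr//= leeDr// sume_ge0// => j _; rewrite lee_fin.
Qed.

(** The union of the dyadic subcubes of generation at most [K] that satisfy
[bad].  The recursion stops at the first such cube on each branch, so that the
pieces are disjoint and statements about them go by induction on [K]. *)
Fixpoint stopped (bad : hcube -> Prop) (K : nat) c : set E :=
  if pselect (bad c) then c : set E
  else if K is K'.+1 then \big[setU/set0]_(e : corner) stopped bad K' (child c e)
  else set0.

Section bad.
Variable bad : hcube -> Prop.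
Local Notation stopped := (stopped bad).

Lemma stopped_bad K c : bad c -> stopped K c = c.
Proof. by case: K => [|K] /=; case: pselect. Qed.

Lemma stopped0 c : ~ bad c -> stopped 0 c = set0.
Proof. by rewrite /=; case: pselect. Qed.

Lemma stoppedS K c : ~ bad c ->
  stopped K.+1 c = \big[setU/set0]_(e : corner) stopped K (child c e).
Proof. by rewrite /=; case: pselect. Qed.

Lemma stopped_sub K c : stopped K c `<=` c.
Proof.
elim: K c => [|K ih] c.
  by have [b|b] := pselect (bad c); [rewrite stopped_bad|rewrite stopped0].
have [b|b] := pselect (bad c); first by rewrite stopped_bad.
rewrite stoppedS// -bigcup_seq => x [e _ /ih]; exact: child_sub.
Qed.

Lemma measurable_stopped K c : measurable (stopped K c).
Proof.
have mc c' : measurable (c' : set E) by exact: measurable_cube.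
elim: K c => [|K ih] c; have [b|b] := pselect (bad c); rewrite ?(stopped_bad _ b)//.
  by rewrite stopped0.
by rewrite stoppedS//; apply: bigsetU_measurable => e _.
Qed.

Lemma le_stoppedS K c : stopped K c `<=` stopped K.+1 c.
Proof.
elim: K c => [|K ih] c; have [b|b] := pselect (bad c); rewrite ?(stopped_bad _ b)//.
  by rewrite stopped0.
rewrite !stoppedS// -!bigcup_seq => x [e me /ih]; by exists e.
Qed.

Lemma le_stopped K K' c : (K <= K')%N -> stopped K c `<=` stopped K' c.
Proof.
move=> /subnK <-; elim: (K' - K)%N => [|m ih]; first by rewrite add0n.
by apply: subset_trans ih _; rewrite addSn; exact: le_stoppedS.
Qed.

Lemma desc_stopped c s : bad (desc c s) -> desc c s `<=` stopped (size s) c.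
Proof.
elim: s c => [|e s ih] c b; first by rewrite stopped_bad.
have [bc|nb] := pselect (bad c).
  by rewrite (stopped_bad _ bc); exact: (@desc_sub _ _ c (e :: s)).
rewrite [size _]/= stoppedS// -bigcup_seq => x /(ih _ b) ?.
by exists e => //=; rewrite mem_index_enum.
Qed.

Lemma int_stoppedS K c (f : E -> R) : ~ bad c -> measurable_fun setT f ->
  (forall x, 0 <= f x)%R ->
  \int[mu]_(x in stopped K.+1 c) (f x)%:E =
  \sum_(e : corner) \int[mu]_(x in stopped K (child c e)) (f x)%:E.
Proof.
move=> b mf f0; rewrite stoppedS// ge0_integral_bigsetU//.
- by move=> e; exact: measurable_stopped.
- exact: index_enum_uniq.
- move=> e1 e2 _ _ [x [/stopped_sub x1 /stopped_sub x2]].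
  by apply: (@trivIset_children _ _ c setT) => //; exists x.
- exact: measurable_EFinT.
- by move=> x _; rewrite lee_fin.
Qed.

Lemma int_stopped_le K c (f g : E -> R) :
  measurable_fun setT f -> measurable_fun setT g ->
  (forall x, 0 <= f x)%R -> (forall x, 0 <= g x)%R ->
  (forall s, bad (desc c s) ->
    \int[mu]_(x in cube_set (desc c s)) (f x)%:E <= \int[mu]_(x in cube_set (desc c s)) (g x)%:E) ->
  \int[mu]_(x in stopped K c) (f x)%:E <= \int[mu]_(x in stopped K c) (g x)%:E.
Proof.
move=> mf mg f0 g0; elim: K c => [|K ih] c fg; have [b|b] := pselect (bad c);
  rewrite ?(stopped_bad _ b); try exact: (fg [::]).
  by rewrite stopped0// !integral_set0.
rewrite !int_stoppedS//; apply: lee_sum => e _; apply: ih => s.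
exact: (fg (e :: s)).
Qed.

End bad.

Section reverse_hoelder.
Variables (psi : E -> R) (mpsi : measurable_fun setT psi).
Let v x := expR (psi x).
Let V c := \int[mu]_(x in cube_set c) (v x)%:E.
Let bad (th : R) c := (th * side c ^+ n)%:E < V c.
Let A : R := (2 ^+ n.+2)%R.
Variable gam : R.
Hypotheses (gam0 : (0 < gam)%R) (gam1 : (gam <= 1)%R).
(** The A_infinity condition for the weight v: it falls below a fixed multiple of
its mean on at most a quarter of the cube. *)
Let Ainfty_on c := mu (c `&` [set x | side c ^+ n * v x < gam * fine (V c)]%R) <= (4^-1 * side c ^+ n)%:E.
Let del : R := (1 - gam / 2)%R.

Let mv : measurable_fun setT v. Proof. by rewrite /v; mfun. Qed.
Let v0 x : (0 <= v x)%R. Proof. exact: expR_ge0. Qed.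
Let mc c : measurable (c : set E). Proof. exact: measurable_cube. Qed.
Let A0 : (0 < A)%R. Proof. by rewrite exprn_gt0. Qed.

(** The stopped cubes are disjoint and v has mean above [th] on each. *)
Let weak_type th K c : (0 <= th)%R -> (0 < side c)%R ->
  th%:E * mu (stopped (bad th) K c) <= V c.
Proof.
move=> th0 c0; rewrite -int_const; last exact: measurable_stopped.
apply: (@le_trans _ _ (\int[mu]_(x in stopped (bad th) K c) (v x)%:E)).
  apply: (@int_stopped_le _ _ _ (cst th) v) => // s bs.
  rewrite [leLHS](int_const th (mc _)) mu_cube ?desc_side_gt0// -EFinM; exact: ltW.
by apply: int_subset => //; [exact: measurable_stopped|exact: stopped_sub].
Qed.

(** As the mean of v over the parent is at most [th], the cubes where the mean
exceeds [A * th] fill at most a quarter of the child; with [A = 2 ^+ n.+2] this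
is the weak type estimate.  At most another quarter is lost to small values of
v.  On the remaining half v is at least [gam] times its mean, which takes the
proportion [gam / 2] of the mass away. *)
Let local_decay th K c e : (0 < th)%R -> (0 < side c)%R -> Ainfty_on (child c e) ->
  V c <= (th * side c ^+ n)%:E ->
  \int[mu]_(x in stopped (bad (A * th)) K (child c e)) (v x)%:E <= del%:E * V (child c e).
Proof.
move=> th0 c0 fatP Vc; set P := child c e; set S := stopped _ _ _.
have P0 : (0 < side P)%R by exact: child_side_gt0.
have VPc : V P <= V c by apply: int_subset => //; exact: child_sub.
have VP0 : 0 <= V P by apply: integral_ge0 => x _; rewrite lee_fin.
have Vfin : V P \is a fin_num.
  by rewrite ge0_fin_numE//; apply: le_lt_trans (le_trans VPc Vc) (ltry _).
have mS : measurable S by exact: measurable_stopped.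
have muS : mu S <= (4^-1 * side P ^+ n)%:E.
  have Ath : (0 < A * th)%R by rewrite mulr_gt0.
  apply: (lee_mul_cancel Ath).
  apply: le_trans (weak_type _ (ltW Ath) P0) _; apply: le_trans VPc _.
  apply: le_trans Vc _; rewrite lee_fin /P/= /A exprS exprS expr_div_n.
  rewrite le_eqVlt; apply/orP; left; apply/eqP.
  have n2 : (2 ^+ n != 0 :> R)%R by rewrite expf_neq0.
  by field.
pose Low := P `&` [set x | side P ^+ n * v x < gam * fine (V P)]%R.
rewrite /Ainfty_on -/P -/Low in fatP.
have mLow : measurable Low.
  apply: measurableI => //; rewrite (_ : [set x | _] = ~` [set x | gam * fine (V P) <= side P ^+ n * v x]%R).
    by apply: measurableC; apply: measurable_sup_level; mfun.
  by apply/seteqP; split => x /=; rewrite ltNge => /negP.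
pose F := (P : set E) `\` (S `|` Low).
have mF : measurable F by apply: measurableD => //; exact: measurableU.
have muF : (2^-1 * side P ^+ n)%:E <= mu F.
  have : mu P <= mu F + (mu S + mu Low).
    apply: le_trans (leeD2l _ (mu_setU _ _)).
    apply: le_trans (mu_setU _ _); apply: mu_le => x Px.
    by have [?|?] := pselect ((S `|` Low) x); [right|left].
  rewrite mu_cube// => h; have := le_trans h (leeD2l _ (leeD muS fatP)).
  rewrite -EFinD -leeBlDr// -EFinB; apply: le_trans; rewrite lee_fin.
  lra.
have intF : (gam / 2)%:E * V P <= \int[mu]_(x in F) (v x)%:E.
  have Pn : (0 < side P ^+ n)%R by rewrite exprn_gt0.
  have V0 : (0 <= gam * fine (V P) / side P ^+ n)%R.
    by rewrite divr_ge0 ?(ltW Pn)// mulr_ge0 ?fine_ge0 ?(ltW gam0).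
  apply: (@le_trans _ _ (\int[mu]_(x in F) (gam * fine (V P) / side P ^+ n)%:E)).
    rewrite int_const//; apply: (@le_trans _ _ ((gam * fine (V P) / side P ^+ n)%:E *
        (2^-1 * side P ^+ n)%:E)).
      rewrite -{1}[V P]fineK// -!EFinM lee_fin le_eqVlt; apply/orP; left; apply/eqP.
      by field; rewrite gt_eqF.
    by apply: lee_wpmul2l => //; rewrite ?lee_fin ?V0.
  apply: le_int => // x Fx.
  rewrite ler_pdivrMr// leNgt; apply/negP => h; apply: Fx.2; right.
  by split; [exact: Fx.1|rewrite /= [X in (X < _)%R]mulrC].
have : \int[mu]_(x in S) (v x)%:E + \int[mu]_(x in F) (v x)%:E <= V P.
  rewrite -int_setU//.
    apply: int_subset => //; first exact: measurableU.
    by move=> x [/stopped_sub//|[]].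
  by apply/seteqP; split => // x [Sx [_ []]]; left.
move=> h; have : \int[mu]_(x in S) (v x)%:E + (gam / 2)%:E * V P <= V P.
  by apply: le_trans h; exact: leeD2l.
rewrite -leeBrDr; last by rewrite fin_numM.
by move/le_trans; apply; rewrite -{1 2 3}[V P]fineK// -!EFinM -EFinB lee_fin /del; lra.
Qed.

Let global_decay th K c : (0 < th)%R -> (0 < side c)%R ->
  (forall s, Ainfty_on (desc c s)) -> V c <= (th * side c ^+ n)%:E ->
  \int[mu]_(x in stopped (bad (A * th)) K c) (v x)%:E <=
  del%:E * \int[mu]_(x in stopped (bad th) K c) (v x)%:E.
Proof.
move=> th0; elim: K c => [|K ih] c c0 fc Vc; (have nb : ~ bad th c by
  rewrite /bad; apply/negP; rewrite -leNgt);
  (have nbA : ~ bad (A * th) c by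
  rewrite /bad; apply/negP; rewrite -leNgt (le_trans Vc)// lee_fin ler_pM2r ?exprn_gt0//
    ler_peMl ?(ltW th0)// exprn_ege1// ler1n).
  by rewrite !stopped0// !integral_set0 mule0.
rewrite !int_stoppedS// ge0_sume_distrr; last first.
  by move=> e _; apply: integral_ge0 => x _; rewrite lee_fin.
apply: lee_sum => e _; have [b|b] := pselect (bad th (child c e)).
  by rewrite (stopped_bad _ b); apply: local_decay => //; exact: (fc [:: e]).
apply: ih; [exact: child_side_gt0|by move=> s; exact: (fc (e :: s))|].
by rewrite leNgt; apply/negP.
Qed.

Variable c : hcube.
Hypotheses (c0 : (0 < side c)%R) (Vc : V c = (side c ^+ n)%:E)
  (fc : forall s, Ainfty_on (desc c s)).
Let D k : set E := \bigcup_K stopped (bad (A ^+ k)) K c.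

Let mD k : measurable (D k).
Proof. by apply: bigcup_measurable => K _; exact: measurable_stopped. Qed.

Let del0 : (0 <= del)%R.
Proof. rewrite /del; move: gam1; lra. Qed.

(** The thresholds [A ^+ k] are compared successively, starting from the mean 1
of v over c. *)
Let decay k : \int[mu]_(x in D k) (v x)%:E <= (del ^+ k * side c ^+ n)%:E.
Proof.
have st K : \int[mu]_(x in stopped (bad (A ^+ k)) K c) (v x)%:E <= (del ^+ k * side c ^+ n)%:E.
  elim: k => [|k ih].
    rewrite expr0 mul1r -Vc; apply: int_subset => //; first exact: measurable_stopped.
    exact: stopped_sub.
  rewrite !exprS; apply: le_trans (global_decay _ _ c0 fc _) _.
  - by rewrite exprn_gt0.
  - by rewrite Vc lee_fin ler_peMl ?exprn_ge0 ?(ltW c0)// exprn_ege1// exprn_ege1// ler1n.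
  - by rewrite -mulrA EFinM lee_wpmul2l// lee_fin.
have cv : \int[mu]_(x in stopped (bad (A ^+ k)) K c) (v x)%:E @[K --> \oo] -->
    \int[mu]_(x in D k) (v x)%:E.
  apply: ge0_nondecreasing_set_cvg_integral.
  - by move=> K K' KK'; apply/subsetPset; exact: le_stopped.
  - by move=> K; exact: measurable_stopped.
  - by move=> K; exact: measurable_EFinT.
  - by move=> K x _; rewrite lee_fin.
rewrite -(cvg_lim _ cv)//; apply: lime_le; first by apply/cvg_ex; eexists; exact: cv.
exact: nearW.
Qed.

(** Outside the stopped cubes every dyadic mean of v is at most [A ^+ k]; by the
weak density theorem v cannot exceed twice that value on a set of positive
measure. *)
Let large k : mu (([set x | ~ (psi x <= ln 2 + k%:R * ln A)%R] `\` D k) `&` c) = 0.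
Proof.
have mX : measurable ([set x | ~ (psi x <= ln 2 + k%:R * ln A)%R] `\` D k).
  by apply: measurableD => //; apply/measurableC/measurable_sub_level.
apply: (@null_of_density _ _ n_gt0 _ 2^-1) => //; first lra.
move=> s; set P := desc c s; have P0 : (0 < side P)%R by exact: desc_side_gt0.
have [b|b] := pselect (bad (A ^+ k) P).
  rewrite (_ : _ `&` _ = set0) ?measure0 ?mule_ge0//.
  apply/seteqP; split => // x [[_ nD] Px]; apply: nD.
  by exists (size s) => //; exact: desc_stopped b _ Px.
rewrite (mu_cube P0) -EFinM.
have Ak : (0 < A ^+ k)%R by rewrite exprn_gt0.
have A2k : (0 < 2 * A ^+ k)%R by rewrite mulr_gt0.
apply: (lee_mul_cancel A2k).
have -> : (2 * A ^+ k * (2^-1 * side P ^+ n) = A ^+ k * side P ^+ n)%R by field.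
apply: (@le_trans _ _ (V P)); last by rewrite leNgt; exact/negP.
apply: le_trans (mu_level_le (mc P) mv (ltW A2k) v0).
apply: lee_wpmul2l; first by rewrite lee_fin ltW.
apply: mu_le => x [[/negP]]; rewrite -ltNge => h _ Px; split => //=.
rewrite -[leLHS]lnK// /v ler_expR lnM ?posrE// lnXn//.
by rewrite mulr_natl in h; exact: ltW.
Qed.

(** The part of c where v is of size [A ^+ k] lies in [D k], whose v-mass decays
like [del ^+ k]; the condition on [s] makes the sum over k of
[A ^+ (s * k) * del ^+ k] a convergent geometric series. *)
Theorem reverse_hoelder (s : R) : (0 <= s)%R -> (expR (s * ln A) * del < 1)%R ->
  \int[mu]_(x in cube_set c) (expR ((1 + s) * psi x))%:E <=
   (expR (s * ln 2) * (1 + expR (s * ln A) / (1 - expR (s * ln A) * del)) * side c ^+ n)%:E.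
Proof.
move=> s0 q1; set a := expR (s * ln A); set b := expR (s * ln 2).
have a0 : (0 < a)%R := expR_gt0 _; have b0 : (0 < b)%R := expR_gt0 _.
have lA : (0 < ln A)%R by rewrite ln_gt0// exprn_egt1// ltr1n.
pose N := \bigcup_k (([set x | ~ (psi x <= ln 2 + k%:R * ln A)%R] `\` D k) `&` c).
pose g k x : R := (b * a ^+ k.+1 * (\1_(D k) x * v x))%R.
have mX k : measurable (([set x | ~ (psi x <= ln 2 + k%:R * ln A)%R] `\` D k) `&` c).
  by apply: measurableI => //; apply: measurableD => //; apply/measurableC/measurable_sub_level.
have mN : measurable N by exact: bigcup_measurable.
have N0 : mu.-negligible N.
  apply: negligible_bigcup => k.
  exists (([set x | ~ (psi x <= ln 2 + k%:R * ln A)%R] `\` D k) `&` c).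
  by split; [exact: mX|exact: large|].
have mh k : measurable_fun setT (fun x => \1_(D k) x * v x)%R.
  by apply: measurable_funM; [exact: measurable_indic|exact: mv].
have h0 k x : (0 <= \1_(D k) x * v x)%R by exact: mulr_ge0.
have mg k : measurable_fun setT (g k).
  by rewrite /g; apply: measurable_funM => //; exact: mh.
have g0 k x : (0 <= g k x)%R.
  by rewrite /g !mulr_ge0// ltW ?exprn_gt0.
have cn : (0 <= side c ^+ n)%R by rewrite exprn_ge0// ltW.
have intg k : \int[mu]_(x in cube_set c) (g k x)%:E <= (b * a ^+ k.+1 * (del ^+ k * side c ^+ n))%:E.
  have ba j : (0 <= b * a ^+ j)%R by rewrite mulr_ge0 ?exprn_ge0 ?(ltW a0) ?(ltW b0).
  rewrite (intZ mu (mc c) (mh k) (fun x _ => h0 k x) (ba _)).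
  rewrite [leRHS]EFinM; apply: lee_wpmul2l.
    by rewrite lee_fin mulr_ge0 ?exprn_ge0 ?(ltW a0) ?(ltW b0).
  have Dc : (c : set E) `&` D k = D k by apply/setIidr => x [K _ /stopped_sub].
  apply: le_trans (decay k); rewrite -[in leRHS]Dc.
  rewrite integral_mkcondr le_eqVlt; apply/orP; left; apply/eqP.
  apply: eq_integral => x _; rewrite patchE indicE /=.
  have [xD|xD] := boolP (x \in D k); last by rewrite mul0r.
  by rewrite mul1r.
have pw : {ae mu, forall x, (c : set E) x ->
   (expR ((1 + s) * psi x))%:E <= (b * v x)%:E + \sum_(k <oo) (g k x)%:E}.
  apply: (negligibleS _ N0) => x /= /not_implyP[cx]; apply: contra_notP => nN.
  have S0 : 0 <= \sum_(k <oo) (g k x)%:E by apply: nneseries_ge0 => k _ _; rewrite lee_fin.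
  rewrite mulrDl mul1r expRD -/(v x).
  have [x2|x2] := leP (psi x) (ln 2).
    apply: (@le_trans _ _ (b * v x)%:E); last exact: leeDl.
    rewrite lee_fin mulrC ler_pM2r ?expR_gt0// ler_expR.
    by rewrite ler_wpM2l.
  have y0 : (0 < psi x - ln 2)%R by rewrite subr_gt0.
  have [k /andP[k1 k2]] := ladder lA y0.
  have Dx : D k x.
    apply: contra_notP nN => nD; exists k => //; split => //; split => //.
    by apply/negP; rewrite -ltNge; lra.
  apply: (@le_trans _ _ (\sum_(k <oo) (g k x)%:E)); last first.
    by apply: leeDr; rewrite lee_fin mulr_ge0// ltW.
  apply: (@le_trans _ _ (g k x)%:E).
    rewrite lee_fin /g indicE mem_set// mul1r [leLHS]mulrC ler_pM2r ?expR_gt0//.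
    rewrite /a -expRM_natl -expRD ler_expR mulrCA -mulrDr ler_wpM2l//; lra.
  by apply: (@nneseries_ge_term (fun k => g k x)).
have mS : measurable_fun (cube_set c) (fun x => \sum_(k <oo) (g k x)%:E).
  apply: ge0_emeasurable_sum => k; first by move=> x _ _; rewrite lee_fin.
  by move=> _; exact: measurable_EFinT.
have S0 x : 0 <= \sum_(k <oo) (g k x)%:E by apply: nneseries_ge0 => k _ _; rewrite lee_fin.
have mbv : measurable_fun setT (fun x => b * v x)%R by mfun.
have bv0 x : (0 <= b * v x)%R by rewrite mulr_ge0// ltW.
have mbvE : measurable_fun (cube_set c) (fun x => (b * v x)%:E) by exact: measurable_EFinT.
have bvE0 x : (c : set E) x -> 0 <= (b * v x)%:E by rewrite lee_fin.
apply: (@le_trans _ _ (\int[mu]_(x in cube_set c) ((b * v x)%:E + \sum_(k <oo) (g k x)%:E))).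
  apply: (ae_ge0_le_integral (mc c) _ _ _ _ pw).
  - by move=> x _; rewrite lee_fin expR_ge0.
  - by apply: measurable_EFinT; mfun.
  - by move=> x cx; apply: adde_ge0; [exact: bvE0|exact: S0].
  - exact: emeasurable_funD.
rewrite (ge0_integralD mu (mc c) bvE0 mbvE (fun x _ => S0 x) mS).
rewrite integral_nneseries; first last.
- by move=> k x _; rewrite lee_fin.
- by move=> k; exact: measurable_EFinT.
- exact: mc.
rewrite (intZ mu (mc c) mv (fun x _ => v0 x) (ltW b0)).
rewrite -/(V c) Vc -EFinM mulrDr mulr1 mulrDl EFinD; apply: leeD => //.
apply: (@le_trans _ _ (\sum_(k <oo) (b * a ^+ k.+1 * (del ^+ k * side c ^+ n))%:E)).
  apply: lee_nneseries => [k _ _|k _]; last exact: intg.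
  by apply: integral_ge0 => x _; rewrite lee_fin.
apply: nneseries_le => [k|m].
  by rewrite !mulr_ge0 ?exprn_ge0 ?(ltW b0) ?(ltW a0)// ltW.
rewrite (eq_bigr (fun k : 'I_m => (b * a * side c ^+ n) * (a * del) ^+ k)%R); last first.
  by move=> k _; rewrite exprMn exprS; ring.
rewrite -mulr_sumr mulrA [leRHS](_ : _ = b * a * side c ^+ n * (1 - a * del)^-1)%R; last by ring.
apply: ler_wpM2l; first by rewrite !mulr_ge0// ltW.
by apply: geometric_le; rewrite q1 mulr_ge0// ltW.
Qed.

End reverse_hoelder.
End stopping.

(** * Modulars, norms and doubling *)

Section scaling.
Variables (R : realType) (n : nat).
Hypothesis n_gt0 : (0 < n)%N.
Local Notation E := (euclidean R n).
Local Notation mu := (@lebesgue_n R n).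
Local Notation corner := {ffun 'I_n -> bool}.
Local Notation hcube := (hcube R n).
Variables (p : E -> R) (m M : R).
Hypotheses (mp : measurable_fun setT p) (m0 : (0 < m)%R)
  (pm : forall x, (m <= p x)%R) (pM : forall x, (p x <= M)%R).

(** With w = exp phi and l = exp a this is the modular of w 1_X / l, whose value
1 characterizes the norm l. *)
Definition modular (phi : E -> R) (X : set E) (a : R) :=
  \int[mu]_(x in X) (expR (p x * (phi x - a)))%:E.

Section one_function.
Variables (phi : E -> R) (mphi : measurable_fun setT phi).
Local Notation J := (modular phi).

Lemma measurable_modular a : measurable_fun setT (fun x => expR (p x * (phi x - a))).
Proof. by mfun. Qed.

Lemma modular_ge0 X a : 0 <= J X a.
Proof. by apply: integral_ge0 => x _; rewrite lee_fin expR_ge0. Qed.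

Lemma measurable_modular_arg a : measurable_fun setT (fun x => p x * (phi x - a))%R.
Proof. by mfun. Qed.

(** Together with the next bound: since m <= p <= M, moving the parameter by d
changes the modular by a factor between exp(- M d) and exp(- m d).  All
comparisons of norms rest on these two inequalities. *)
Lemma modular_shift_le X a d : measurable X -> (0 <= d)%R ->
  J X (a + d) <= (expR (- (m * d)))%:E * J X a.
Proof.
move=> mX d0; have ma := measurable_modular_arg.
apply: (le_int_expR mu mX (ma _) (ma _)) => x _.
have : (m * d <= p x * d)%R by rewrite ler_wpM2r.
lra.
Qed.

Lemma modular_shift_ge X a d : measurable X -> (0 <= d)%R ->
  J X a <= (expR (M * d))%:E * J X (a + d).
Proof.
move=> mX d0; have ma := measurable_modular_arg.
apply: (le_int_expR mu mX (ma _) (ma _)) => x _.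
have : (p x * d <= M * d)%R by rewrite ler_wpM2r.
lra.
Qed.

Lemma modular_subset X Y a : measurable X -> measurable Y -> X `<=` Y -> J X a <= J Y a.
Proof. by move=> mX mY; exact: (int_expR_subset mu mX mY (measurable_modular_arg a)). Qed.

Lemma modular_lower X a b k : measurable X -> J X a <= 1 -> k%:E <= J X b ->
  (0 < k <= 1)%R -> (b + ln k / m <= a)%R.
Proof.
move=> mX Ja Jb /andP[k0 k1]; rewrite leNgt; apply/negP => h.
have lk : (ln k <= 0)%R by rewrite ln_le0.
have : (ln k / m <= 0)%R by rewrite pmulr_lle0// invr_gt0.
move=> lkm; have d0 : (0 <= b - a)%R by lra.
have := modular_shift_le a mX d0; rewrite (_ : a + (b - a) = b)%R; last by ring.
move=> /(le_trans Jb); apply/negP; rewrite -ltNge.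
apply: (@le_lt_trans _ _ (expR (- (m * (b - a))))%:E).
  by rewrite -[leRHS]mule1; exact: lee_wpmul2l.
rewrite lte_fin -[ltRHS]lnK ?posrE// ltr_expR.
have : (- (b - a) * m < ln k / m * m)%R by rewrite ltr_pM2r//; lra.
by rewrite divfK ?gt_eqF//; lra.
Qed.

Lemma modular_upper X a b k : measurable X -> 1 <= J X a -> J X b <= k%:E ->
  (0 < k <= 1)%R -> (0 < M)%R -> (a <= b + ln k / M)%R.
Proof.
move=> mX Ja Jb /andP[k0 k1] M0.
have [ab|ba] := leP a b; last first.
  have d0 : (0 <= a - b)%R by lra.
  have := modular_shift_le b mX d0; rewrite (_ : b + (a - b) = a)%R; last by ring.
  move=> /(le_trans Ja) h.
  have : 1%:E <= (expR (- (m * (a - b))) * k)%:E.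
    apply: le_trans h _; rewrite EFinM; exact: lee_wpmul2l.
  rewrite lee_fin => h'; have : (expR (- (m * (a - b))) < 1)%R.
    by rewrite expR_lt1 oppr_lt0 mulr_gt0//; lra.
  have := expR_ge0 (- (m * (a - b))).
  move: h'; set e := expR _ => h' e0 e1.
  have : (e * k <= e)%R by rewrite ler_piMr.
  lra.
have d0 : (0 <= b - a)%R by lra.
have := modular_shift_ge a mX d0; rewrite (_ : a + (b - a) = b)%R; last by ring.
move=> /(le_trans Ja) h; have : 1%:E <= (expR (M * (b - a)) * k)%:E.
  by apply: le_trans h _; rewrite EFinM; exact: lee_wpmul2l.
rewrite lee_fin -[X in (_ * X)%R]lnK ?posrE// -expRD -[leLHS]expR0 ler_expR => {}h.
rewrite -lerBlDl; have : ((a - b) * M <= ln k)%R by lra.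
by rewrite -ler_pdivlMr.
Qed.

Lemma modular_upper_large X a b k : measurable X -> 1 <= J X a -> J X b <= k%:E ->
  (1 <= k)%R -> (a <= b + ln k / m)%R.
Proof.
move=> mX Ja Jb k1; rewrite leNgt; apply/negP => h.
have k0 : (0 < k)%R by lra.
have : (0 <= ln k / m)%R by rewrite divr_ge0 ?ln_ge0// ltW.
move=> lkm; have d0 : (0 <= a - b)%R by lra.
have := modular_shift_le b mX d0; rewrite (_ : b + (a - b) = a)%R; last by ring.
move=> /(le_trans Ja); apply/negP; rewrite -ltNge.
apply: (@le_lt_trans _ _ (expR (- (m * (a - b))) * k)%:E).
  rewrite EFinM; exact: lee_wpmul2l.
rewrite lte_fin -[X in (_ * X)%R]lnK ?posrE// -expRD expR_lt1.
have : (ln k / m * m < (a - b) * m)%R by rewrite ltr_pM2r//; lra.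
by rewrite divfK ?gt_eqF//; lra.
Qed.

End one_function.

Definition lnvol (c : hcube) : R := (n%:R * ln (side c))%R.

Lemma expR_lnvol c : (0 < side c)%R -> expR (lnvol c) = (side c ^+ n)%R.
Proof. by move=> c0; rewrite /lnvol expRM_natl lnK. Qed.

Section norm.
Variables (phi : E -> R) (mphi : measurable_fun setT phi) (Lam : hcube -> R).
Hypothesis LamP : forall c, (0 < side c)%R -> modular phi c (Lam c) = 1.
Local Notation J := (modular phi).
Let mc (c : hcube) : measurable (c : set E). Proof. exact: measurable_cube. Qed.

(** The logarithm of |Q| v_Q for Q = c; its exponential has mean 1 over c. *)
Definition log_density c x := (p x * (phi x - Lam c) + lnvol c)%R.

Lemma measurable_log_density c : measurable_fun setT (log_density c).
Proof. by rewrite /log_density; mfun. Qed.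

Lemma int_exp_log_density c : (0 < side c)%R ->
  \int[mu]_(x in cube_set c) (expR (log_density c x))%:E = (side c ^+ n)%:E.
Proof.
move=> c0; under eq_integral do rewrite /log_density addrC expRD.
rewrite (intZ mu (mc c) (measurable_modular mphi _) (fun x _ => expR_ge0 _) (expR_ge0 _)).
by rewrite -/(modular _ _ _) LamP// mule1 expR_lnvol.
Qed.

Lemma lnorm_mono (P Q : hcube) : (0 < side P)%R -> (0 < side Q)%R -> (P : set E) `<=` Q ->
  (Lam P <= Lam Q)%R.
Proof.
move=> P0 Q0 PQ.
have := @modular_upper_large _ mphi P (Lam P) (Lam Q) 1 (mc P).
rewrite ln1 mul0r addr0; apply => //; first by rewrite LamP.
rewrite -[leRHS](LamP Q0); exact: modular_subset.
Qed.

Section low.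
Variable C : R.
Hypothesis C0 : (0 < C)%R.

Lemma log_density_level c (h : R) : (0 < side c)%R -> (0 < h)%R ->
  \int[mu]_(x in cube_set c) (Num.max 0%R (- log_density c x))%:E <= (C * side c ^+ n)%:E ->
  mu (c `&` [set x | h <= - log_density c x]%R) <= (C / h * side c ^+ n)%:E.
Proof.
move=> c0 h0 low; apply: (lee_mul_cancel h0).
rewrite [leRHS](_ : _ = (C * side c ^+ n)%:E); last first.
  by congr EFin; field; rewrite gt_eqF.
have md := measurable_log_density c.
apply: le_trans low.
have mmax : measurable_fun setT (fun x => Num.max 0 (- log_density c x))%R by mfun.
apply: le_trans (mu_level_le (mc c) mmax (ltW h0) _).
  apply: lee_wpmul2l; first by rewrite lee_fin ltW.
  by apply: mu_le => x [cx /= hx]; split => //=; rewrite le_max hx orbT.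
by move=> x; rewrite le_max lexx.
Qed.

(** If the negative part of the logarithm of |Q| v_Q is bounded in mean, then
|Q| v_Q is bounded below outside a small part of Q by the Chebyshev inequality;
so any set filling a fixed proportion of Q carries a fixed mass. *)
Lemma modular_mass (X : set E) c (eta : R) : (0 < side c)%R ->
  \int[mu]_(x in cube_set c) (Num.max 0%R (- log_density c x))%:E <= (C * side c ^+ n)%:E ->
  measurable X -> X `<=` c ->
  (0 < eta)%R -> (2 * eta * side c ^+ n)%:E <= mu X ->
  (eta * expR (- (C / eta)))%:E <= J X (Lam c).
Proof.
move=> c0 low mX Xc e0 Xm; have h0 : (0 < C / eta)%R by rewrite divr_gt0.
have := log_density_level c0 h0 low.
set Y := (c : set E) `&` _ => Ym; have md := measurable_log_density c.
have mY : measurable Y by apply: measurableI => //; apply: measurable_sup_level; mfun.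
have cn : (0 < side c ^+ n)%R by rewrite exprn_gt0.
have muXY : (eta * side c ^+ n)%:E <= mu (X `\` Y).
  have : mu X <= mu (X `\` Y) + mu Y.
    apply: le_trans (mu_setU _ _); apply: mu_le => x Xx.
    by have [?|?] := pselect (Y x); [right|left].
  move=> /(le_trans Xm)/le_trans/(_ (leeD2l _ Ym)).
  rewrite -leeBlDr// -EFinB; apply: le_trans; rewrite lee_fin.
  have -> : (C / (C / eta) = eta)%R by field; rewrite !gt_eqF.
  lra.
have mXY : measurable (X `\` Y) by exact: measurableD.
apply: (@le_trans _ _ (J (X `\` Y) (Lam c))); last first.
  by apply: modular_subset => //; exact: subDsetl.
have mk : measurable_fun setT (fun _ : E => - (C / eta) - lnvol c)%R by exact: measurable_cst.
have := le_int_expR mu (k := 0%R) mXY mk (measurable_modular_arg mphi (Lam c)).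
rewrite expR0 mul1e => h; apply: le_trans (h _); last first.
  move=> x [Xx nY]; rewrite add0r.
  have : ~ (C / eta <= - log_density c x)%R.
    by move=> ?; apply: nY; split => //; exact: Xc.
  by move=> /negP; rewrite -ltNge /log_density; lra.
rewrite int_const//.
apply: (@le_trans _ _ ((expR (- (C / eta) - lnvol c))%:E * (eta * side c ^+ n)%:E)).
  rewrite -EFinM lee_fin expRD [expR (- lnvol c)]expRN expR_lnvol//.
  rewrite le_eqVlt; apply/orP; left; apply/eqP; field.
  by rewrite gt_eqF.
by exact: lee_wpmul2l.
Qed.

Hypothesis low : forall c, (0 < side c)%R ->
  \int[mu]_(x in cube_set c) (Num.max 0%R (- log_density c x))%:E <= (C * side c ^+ n)%:E.

(** The smaller cube fills the proportion 2^-n of the larger one, hence carries a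
fixed part of its mass. *)
Lemma doubling : exists d0 : R, (0 <= d0)%R /\ forall P Q : hcube, (0 < side P)%R ->
  side Q = (2 * side P)%R -> (P : set E) `<=` Q -> (Lam Q - d0 <= Lam P)%R.
Proof.
pose eta : R := ((2 ^+ n.+1)^-1)%R.
have e0 : (0 < eta)%R by rewrite invr_gt0 exprn_gt0.
pose k : R := (eta * expR (- (C / eta)))%R.
have k0 : (0 < k)%R by rewrite mulr_gt0// expR_gt0.
have k1 : (k <= 1)%R.
  rewrite mulr_ile1 ?expR_ge0// ?(ltW e0)//.
    by rewrite invf_le1 ?exprn_gt0// exprn_ege1// ler1n.
  by rewrite expR_le1 oppr_le0 divr_ge0// ltW.
exists (- (ln k / m))%R; split.
  by rewrite oppr_ge0 pmulr_lle0 ?invr_gt0// ln_le0.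
move=> P Q P0 QP PQ; have Q0 : (0 < side Q)%R by lra.
rewrite opprK; apply: (@modular_lower _ mphi P _ _ k) => //.
- by rewrite LamP.
- apply: (modular_mass Q0 (low Q0)) => //; rewrite mu_cube// lee_fin QP exprMn /eta exprS.
  rewrite le_eqVlt; apply/orP; left; apply/eqP; field.
  by rewrite expf_neq0.
- by rewrite k0 k1.
Qed.

(** The complement of the smaller cube fills at least half of the larger one,
hence the smaller cube cannot carry almost all the mass. *)
Lemma reverse_doubling : exists d1 : R, (0 < d1)%R /\ forall P Q : hcube, (0 < side P)%R ->
  side Q = (2 * side P)%R -> (P : set E) `<=` Q -> (Lam P <= Lam Q - d1)%R.
Proof.
have e0 : (0 < 4^-1 :> R)%R by rewrite invr_gt0.
pose k : R := (4^-1 * expR (- (C / 4^-1)))%R.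
have k0 : (0 < k)%R by rewrite mulr_gt0// expR_gt0.
have k1 : (k < 1)%R.
  have : (expR (- (C / 4^-1)) <= 1)%R.
    by rewrite expR_le1 oppr_le0 divr_ge0// ltW.
  by rewrite /k; lra.
have M0 : (0 < M)%R by exact: lt_le_trans m0 (le_trans (pm point) (pM point)).
exists (- (ln (1 - k) / M))%R; split.
  by rewrite oppr_gt0 pmulr_llt0 ?invr_gt0// ln_lt0//; lra.
move=> P Q P0 QP PQ; have Q0 : (0 < side Q)%R by lra.
rewrite opprK; apply: (@modular_upper _ mphi P _ _ (1 - k)) => //.
- by rewrite LamP.
- have mQP : measurable ((Q : set E) `\` P) by exact: measurableD.
  have : k%:E <= J (Q `\` P) (Lam Q).
    apply: (modular_mass Q0 (low Q0)) => //.
    have : mu Q <= mu (Q `\` P) + mu P.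
      apply: le_trans (mu_setU _ _); apply: mu_le => x Qx.
      by have [?|?] := pselect ((P : set E) x); [right|left].
    rewrite (mu_cube P0) (mu_cube Q0) -leeBlDr// -EFinB; apply: le_trans; rewrite lee_fin.
    have : (2 * side P ^+ n <= side Q ^+ n)%R.
      rewrite QP exprMn ler_pM2r ?exprn_gt0// -[leLHS]expr1 ler_eXn2l//; lra.
    lra.
  have : J (Q `\` P) (Lam Q) + J P (Lam Q) = 1.
    have QPP : ((Q : set E) `\` P) `&` P = set0 by rewrite setIC setDIK.
    rewrite -(LamP Q0) /modular -(int_setU mu mQP (mc P) (measurable_modular mphi (Lam Q))
      (fun x => expR_ge0 _) QPP).
    by rewrite setUC setDUK.
  have := modular_ge0 phi P (Lam Q); have := modular_ge0 phi (Q `\` P) (Lam Q).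
  case: (J P _) => [x||]; case: (J (Q `\` P) _) => [y||] //=.
  rewrite !lee_fin => _ _ [/= xy]; lra.
- lra.
Qed.

End low.
End norm.
End scaling.

(** * From the A_infinity condition to the reverse Hoelder inequality *)

Section upper.
Variables (R : realType) (n : nat).
Hypothesis n_gt0 : (0 < n)%N.
Local Notation E := (euclidean R n).
Local Notation mu := (@lebesgue_n R n).
Local Notation corner := {ffun 'I_n -> bool}.
Local Notation hcube := (hcube R n).
Variables (p : E -> R) (m M : R).
Hypotheses (mp : measurable_fun setT p) (m0 : (0 < m)%R)
  (pm : forall x, (m <= p x)%R) (pM : forall x, (p x <= M)%R).

(** Cubes on which log-Hoelder continuity controls p at the scale of the cube.
The class is stable under passing to dyadic subcubes. *)
Definition whitney (c : hcube) := (side c <= 1)%R \/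
  forall x, (c : set E) x -> exists i, (side c <= `|coordinate x i|)%R.

Lemma whitney_desc c s : (0 < side c)%R -> whitney c -> whitney (desc c s).
Proof.
move=> c0 gc; have dc : (side (desc c s) <= side c)%R.
  by rewrite desc_side ler_pdivrMr ?exprn_gt0// ler_peMr ?(ltW c0)// exprn_ege1// ler1n.
case: gc => [c1|gc]; [left|right]; first exact: le_trans dc c1.
by move=> x /desc_sub /gc[i ci]; exists i; exact: le_trans dc ci.
Qed.

Lemma int_desc_le (f : E -> R) (X : set E) (B : R) k c : measurable X ->
  measurable_fun setT f -> (forall x, 0 <= f x)%R ->
  (forall s, size s = k -> \int[mu]_(x in X `&` desc c s) (f x)%:E <= B%:E) ->
  \int[mu]_(x in X `&` c) (f x)%:E <= ((2 ^+ n) ^+ k * B)%:E.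
Proof.
move=> mX mf f0; elim: k c => [|k ih] c kB.
  by rewrite expr0 mul1r; exact: (kB [::]).
rewrite {1}children_cover big_distrr/= ge0_integral_bigsetU//.
- apply: (@le_trans _ _ (\sum_(e : corner) ((2 ^+ n) ^+ k * B)%:E)).
    apply: lee_sum => e _; apply: ih => s ss; apply: (kB (e :: s)).
    by rewrite /= ss.
  rewrite sumEFin lee_fin sumr_const card_corner -[leLHS]mulr_natl natrX exprS mulrA.
  by rewrite lexx.
- by move=> e; apply: measurableI => //; exact: measurable_cube.
- exact: index_enum_uniq.
- by apply: trivIset_setIl; exact: trivIset_children.
- exact: measurable_EFinT.
- by move=> x _; rewrite lee_fin.
Qed.

(** Clamping the cube centred at the origin with half the side into Q covers the
part of Q near the origin. *)
Lemma shrink_to_origin (Q : hcube) : (0 < side Q)%R ->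
  exists P : hcube, [/\ side Q = (2 * side P)%R, (P : set E) `<=` Q &
    forall x, ((Q : set E) `\` P) x -> exists i, (side Q / 4 <= `|coordinate x i|)%R].
Proof.
move=> Q0; set l := side Q; have l0 : (0 < l)%R by [].
exists (Hcube (fun i => Num.min (Num.max (origin Q i) (- (l / 4))) (origin Q i + l / 2))%R
  (l / 2)%R); split => /=.
- lra.
- move=> x Px i; have /andP[] := Px i => /=; rewrite -/l.
  case: (leP (origin Q i) (- (l / 4))%R) => ?;
    [case: (leP (- (l / 4)) (origin Q i + l / 2))%R
    |case: (leP (origin Q i) (origin Q i + l / 2))%R] => ? ? ?; apply/andP; split; lra.
- move=> x [Qx nP]; apply: contrapT => nx; apply: nP => i /=.
  have xi : (`|coordinate x i| < l / 4)%R.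
    by rewrite ltNge; apply/negP => h; apply: nx; exists i.
  move: xi; rewrite ltr_norml => /andP[x1 x2].
  have /andP[] := Qx i; rewrite -/l.
  case: (leP (origin Q i) (- (l / 4))%R) => ?;
    [case: (leP (- (l / 4)) (origin Q i + l / 2))%R
    |case: (leP (origin Q i) (origin Q i + l / 2))%R] => ? ? ?; apply/andP; split; lra.
Qed.

Variables (phi : E -> R) (mphi : measurable_fun setT phi) (Lam nu : hcube -> R).
Hypothesis LamP : forall c, (0 < side c)%R -> modular p phi c (Lam c) = 1.
Hypothesis nuP : forall c, (0 < side c)%R -> modular p (fun=> 0%R) c (nu c) = 1.
Local Notation psi := (log_density p phi Lam).
Local Notation lnvol := (@lnvol R n).
Variables C C' K Ch : R.
Hypotheses (C0 : (0 < C)%R) (low : forall c, (0 < side c)%R ->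
  \int[mu]_(x in cube_set c) (Num.max 0%R (- psi c x))%:E <= (C * side c ^+ n)%:E).
Hypotheses (C0' : (0 < C')%R) (low' : forall c, (0 < side c)%R ->
  \int[mu]_(x in cube_set c) (Num.max 0%R (- log_density p (fun=> 0%R) nu c x))%:E <= (C' * side c ^+ n)%:E).
Hypothesis tame : forall c x y, (0 < side c)%R -> whitney c -> (c : set E) x -> (c : set E) y ->
  (`|p x - p y| * `|ln (side c)| <= K)%R.
Hypothesis flat : forall c x, (0 < side c)%R -> whitney c -> (c : set E) x ->
  (`|lnvol c - p x * nu c| <= Ch)%R.
Let mc (c : hcube) : measurable (c : set E). Proof. exact: measurable_cube. Qed.
Let mpsi c : measurable_fun setT (psi c). Proof. exact: measurable_log_density. Qed.

(** On a dyadic subcube P of Q one has v_Q = v_P exp(- p (Lam(Q) - Lam(P))).  By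
doubling, Lam(Q) - Lam(P) is at most a multiple of log (side Q) - log (side P),
and p oscillates on P by at most the inverse of either logarithm.  So the second
factor is constant on P up to the bounded factor exp CT, and the lower bound for
|P| v_P gives the A_infinity condition for v_Q on P. *)
Let whitney_Ainfty (d0 : R) : (0 <= d0)%R -> (forall P Q : hcube, (0 < side P)%R ->
    side Q = (2 * side P)%R -> (P : set E) `<=` Q -> (Lam Q - d0 <= Lam P)%R) ->
  exists gam : R, [/\ (0 < gam)%R, (gam <= 1)%R & forall Q P s, P = desc Q s -> (0 < side Q)%R -> whitney Q ->
   mu (P `&` [set x | side P ^+ n * expR (psi Q x) <
     gam * fine (\int[mu]_(x in cube_set P) (expR (psi Q x))%:E)]%R) <= (4^-1 * side P ^+ n)%:E].
Proof.
move=> d00 dbl; have ln20 : (0 < ln 2 :> R)%R by rewrite ln_gt0// ltr1n.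
have K0 : (0 <= K)%R.
  pose c : hcube := Hcube (fun=> 0%R) 1%R.
  have cx : (c : set E) [tuple 0%R | i < n].
    by move=> i; rewrite /coordinate tnth_mktuple/=; lra.
  apply: le_trans (tame _ _ cx cx); rewrite ?mulr_ge0//; left => /=; exact: lexx.
have [CT [CT0 CTE]] : exists CT : R, (0 <= CT)%R /\ CT = (d0 * (2 * K) / ln 2)%R.
  by eexists; split; last reflexivity; rewrite divr_ge0 ?(ltW ln20)// mulr_ge0// mulr_ge0.
pose gam : R := expR (- (4 * C) - CT).
have g1 : (- (4 * C) - CT <= 0)%R by move: C0; lra.
exists gam; split; [exact: expR_gt0|by rewrite /gam expR_le1|].
move=> Q P s PE Q0 gQ; have P0 : (0 < side P)%R by rewrite PE; exact: desc_side_gt0.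
have gP : whitney P by rewrite PE; exact: whitney_desc.
have PQ : (P : set E) `<=` Q by rewrite PE; exact: desc_sub.
have LPQ : (Lam P <= Lam Q)%R by exact: (lnorm_mono n_gt0 mp m0 pm mphi LamP).
have chain : (Lam Q - (size s)%:R * d0 <= Lam P)%R.
  rewrite PE; elim: (s) Q Q0 {gQ P PE P0 gP PQ LPQ} => [|e s' ih] Q Q0 /=; first by rewrite mul0r subr0.
  have := ih (child Q e) (child_side_gt0 e Q0).
  have := dbl (child Q e) Q (child_side_gt0 e Q0).
  rewrite /= (_ : 2 * (side Q / 2) = side Q)%R; last by field.
  by move=> /(_ erefl (@child_sub _ _ Q e)); rewrite -(natr1 (size s')); lra.
have osc x y : (P : set E) x -> (P : set E) y ->
    (`|p x - p y| * (Lam Q - Lam P) <= CT)%R.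
  move=> Px Py; have xy0 : (0 <= `|p x - p y|)%R by [].
  have := tame P0 gP Px Py; have := tame Q0 gQ (PQ _ Px) (PQ _ Py).
  have lnP : ((size s)%:R * ln 2 = ln (side Q) - ln (side P))%R.
    rewrite PE desc_side ln_div ?posrE ?exprn_gt0// lnXn// mulr_natl; lra.
  move=> hQ hP.
  have h1 : (`|p x - p y| * ((size s)%:R * ln 2) <= 2 * K)%R.
    rewrite lnP; apply: (@le_trans _ _ (`|p x - p y| * (`|ln (side Q)| + `|ln (side P)|))%R).
      apply: ler_wpM2l => //; have := ler_norm (ln (side Q)); have := ler_norm (- ln (side P))%R.
      rewrite normrN; lra.
    by rewrite mulrDr; lra.
  have h2 : (`|p x - p y| * (Lam Q - Lam P) <= `|p x - p y| * ((size s)%:R * d0))%R.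
    by apply: ler_wpM2l => //; lra.
  apply: le_trans h2 _; rewrite CTE ler_pdivlMr//.
  have := ler_wpM2r d00 h1; lra.
have h4 : (0 < 4 * C)%R by move: C0; lra.
have := log_density_level n_gt0 mp mphi P0 h4 (low P0).
rewrite (_ : C / (4 * C) = 4^-1)%R; last by field; rewrite gt_eqF.
apply: le_trans; apply: mu_le => x [Px hx]; split => //.
apply: contrapT => /negP; rewrite -ltNge => psiP.
move: hx => /=; apply/negP; rewrite -leNgt.
pose be : R := (p x * (Lam Q - Lam P))%R.
have VP : \int[mu]_(y in cube_set P) (expR (psi Q y))%:E <= (expR (lnvol Q - be + CT))%:E.
  rewrite -[leRHS]mule1 -(LamP P0).
  apply: (le_int_expR mu (mc P) (mpsi Q) (measurable_modular_arg mp mphi _)) => y Py.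
  have := osc x y Px Py.
  have : ((p y - p x) * (Lam P - Lam Q) <= `|p x - p y| * (Lam Q - Lam P))%R.
    have -> : ((p y - p x) * (Lam P - Lam Q) = (p x - p y) * (Lam Q - Lam P))%R by ring.
    by apply: ler_wpM2r; [lra|exact: ler_norm].
  rewrite /log_density /be; lra.
have VP' : (fine (\int[mu]_(y in cube_set P) (expR (psi Q y))%:E) <= expR (lnvol Q - be + CT))%R.
  rewrite -lee_fin fineK// ge0_fin_numE; first exact: le_lt_trans VP (ltry _).
  by apply: integral_ge0 => y _; rewrite lee_fin expR_ge0.
apply: le_trans (ler_wpM2l (expR_ge0 _) VP') _.
rewrite -(expR_lnvol P0) -!expRD ler_expR.
move: psiP; rewrite /log_density /be; lra.
Qed.

Let whitney_reverse_hoelder : exists s0 : R, (0 < s0)%R /\ forall s : R, (0 <= s <= s0)%R ->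
  exists B : R, (0 <= B)%R /\ forall c, (0 < side c)%R -> whitney c ->
    \int[mu]_(x in cube_set c) (expR ((1 + s) * psi c x))%:E <= (B * side c ^+ n)%:E.
Proof.
have [d0 [d00 dbl]] := doubling n_gt0 mp m0 pm mphi LamP C0 low.
have [gam [g0 g1 Ainfty_on]] := whitney_Ainfty d00 dbl.
pose A : R := (2 ^+ n.+2)%R; pose del : R := (1 - gam / 2)%R.
have lA : (0 < ln A)%R by rewrite ln_gt0// exprn_egt1// ltr1n.
have del0 : (0 < del)%R by rewrite /del; lra.
have del1 : (del < 1)%R by rewrite /del; lra.
have ld : (ln del < 0)%R by rewrite ln_lt0// del0.
(* with this value [A ^+ s * del] is at most the square root of [del] *)
exists (- ln del / (2 * ln A))%R; split; first by rewrite divr_gt0// ?oppr_gt0// mulr_gt0.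
move=> s /andP[s0 s1].
have q1 : (expR (s * ln A) * del < 1)%R.
  rewrite -[X in (_ * X)%R]lnK ?posrE// -expRD expR_lt1.
  move: s1; rewrite ler_pdivlMr ?mulr_gt0//; lra.
pose B : R := (expR (s * ln 2) * (1 + expR (s * ln A) / (1 - expR (s * ln A) * del)))%R.
exists B; split.
  rewrite /B mulr_ge0 ?expR_ge0// addr_ge0// divr_ge0 ?expR_ge0// subr_ge0 ltW//.
move=> c c0 gc; apply: (reverse_hoelder n_gt0 (mpsi c) g0 g1 c0 _ _ s0 q1).
- exact: int_exp_log_density.
- by move=> t; exact: (Ainfty_on c (desc c t) t erefl c0 gc).
Qed.

(** The logarithm of the integrand v_Q^r u_Q^(1-r) of the reverse Hoelder
inequality with exponent r = 1 + s. *)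
Definition gehring (phi' : E -> R) (Lam' nu' : hcube -> R) (s : R) c x :=
  ((1 + s) * (p x * (phi' x - Lam' c)) + s * (p x * nu' c))%R.

Local Notation F := (gehring phi Lam nu).

Lemma measurable_gehring s c : measurable_fun setT (F s c).
Proof. by rewrite /gehring; mfun. Qed.

(** On a Whitney cube u_Q is comparable to 1 / |Q|, which turns the reverse
Hoelder inequality for Lebesgue measure into the one for u_Q dx. *)
Let whitney_gehring (s B : R) c : (0 < side c)%R -> (0 <= s)%R -> whitney c ->
  \int[mu]_(x in cube_set c) (expR ((1 + s) * psi c x))%:E <= (B * side c ^+ n)%:E ->
  \int[mu]_(x in cube_set c) (expR (F s c x))%:E <= (expR (s * Ch) * B)%:E.
Proof.
move=> c0 s0 gc h.
have mh : measurable_fun setT (fun x => (1 + s) * psi c x)%R.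
  by apply: measurable_funM => //; exact: mpsi.
apply: le_trans (le_int_expR mu (k := s * Ch - lnvol c)%R (mc c) (measurable_gehring s c) mh _) _.
  move=> x cx; have := flat c0 gc cx; rewrite ler_norml => /andP[h1 h2].
  have := ler_wpM2l s0 h1; rewrite /gehring /log_density; lra.
apply: le_trans (lee_wpmul2l _ h) _; first by rewrite lee_fin expR_ge0.
rewrite -EFinM lee_fin expRD expRN expR_lnvol//.
rewrite le_eqVlt; apply/orP; left; apply/eqP; field.
by rewrite expf_neq0// gt_eqF.
Qed.

(** Induction on the size of the cube c.  Pieces of Whitney cubes at the third
generation cover c minus the half-size cube P near the origin.  On P the
integrand for c is the one for P times
exp(p ((1 + s) (Lam(P) - Lam(c)) + s (nu(c) - nu(P)))).  Reverse doubling of Lam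
bounds the first term by - d1, and doubling of nu bounds the second by s d0, so
the factor is smaller than 1 as soon as s d0 <= d1 / 2. *)
Theorem gehring_bound : exists s B : R, (0 < s)%R /\ forall c, (0 < side c)%R ->
  \int[mu]_(x in cube_set c) (expR (F s c x))%:E <= B%:E.
Proof.
have [s0 [s00 rh]] := whitney_reverse_hoelder.
have [d1 [d10 rdbl]] := reverse_doubling n_gt0 mp m0 pm pM mphi LamP C0 low.
have mz : measurable_fun setT (fun _ : E => 0%R : R) by exact: measurable_cst.
have [d0 [d00 dbl]] := doubling n_gt0 mp m0 pm mz nuP C0' low'.
pose s : R := Num.min s0 (d1 / (2 * (d0 + 1)))%R.
have d01 : (0 < 2 * (d0 + 1))%R by lra.
have sp : (0 < s)%R by rewrite lt_min s00 divr_gt0.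
have sd : (s * d0 <= d1 / 2)%R.
  have : (s <= d1 / (2 * (d0 + 1)))%R by rewrite ge_min lexx orbT.
  rewrite ler_pdivlMr//; lra.
have M0 : (0 < M)%R by exact: lt_le_trans m0 (le_trans (pm point) (pM point)).
have ss : (0 <= s <= s0)%R by rewrite (ltW sp)/= ge_min lexx.
have [B [B0 hB]] := rh s ss.
have whitney_le c : (0 < side c)%R -> whitney c ->
    \int[mu]_(x in cube_set c) (expR (F s c x))%:E <= (expR (s * Ch) * B)%:E.
  by move=> c0 gc; apply: whitney_gehring => //; [exact: ltW|exact: hB].
set B1 : R := (expR (s * Ch) * B)%R in whitney_le.
have B10 : (0 <= B1)%R by rewrite mulr_ge0// expR_ge0.
pose th : R := expR (- (m * (d1 / 2))).
have th1 : (th < 1)%R by rewrite expR_lt1 oppr_lt0 mulr_gt0// divr_gt0.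
pose B2 : R := ((2 ^+ n) ^+ 3 * (expR (M * (s * (3 * d0))) * B1))%R.
pose B3 : R := Num.max B1 (B2 / (1 - th))%R.
exists s, B3; split => // c c0.
have [k ck] : exists k, (side c <= 2 ^+ k)%R.
  exists (Num.truncn (side c)).+1; apply: (@le_trans _ _ ((Num.truncn (side c)).+1%:R)).
    by apply: ltW; rewrite truncnS_gt.
  by rewrite -natrX ler_nat ltnW// ltn_expl.
elim: k c c0 ck => [|k ih] c c0 ck.
  apply: le_trans (whitney_le c c0 _) _; first by left.
  by rewrite lee_fin /B3 le_max lexx.
have [P [cP Pc far]] := shrink_to_origin c0.
have P0 : (0 < side P)%R by lra.
have mcP : measurable ((c : set E) `\` P) by exact: measurableD.
have me : measurable_fun setT (fun x => expR (F s c x)).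
  by have := measurable_gehring s c => ?; mfun.
have -> : (c : set E) = P `|` ((c : set E) `\` P) by rewrite setDUK.
rewrite (int_setU mu (mc P) mcP me (fun x => expR_ge0 _) (setDIK _ _)).
have in_P : \int[mu]_(x in cube_set P) (expR (F s c x))%:E <= (th * B3)%:E.
  apply: le_trans (le_int_expR mu (mc P) (measurable_gehring s c)
    (measurable_gehring s P) (k := - (m * (d1 / 2)))%R _) _.
    move=> x Px; have rd := rdbl P c P0 cP Pc; have db := dbl P c P0 cP Pc.
    have h1 : (s * (nu c - nu P) <= d1 / 2)%R.
      by apply: le_trans sd; apply: ler_wpM2l; [exact: ltW|lra].
    have h2 : ((1 + s) * (Lam P - Lam c) <= - d1)%R.
      have : (0 <= s * (Lam c - Lam P))%R by rewrite mulr_ge0//; lra.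
      lra.
    have h3 : ((1 + s) * (Lam P - Lam c) + s * (nu c - nu P) <= - (d1 / 2))%R by lra.
    have p0 : (0 <= p x)%R by apply: le_trans (pm x); exact: ltW.
    have := ler_wpM2l p0 h3.
    have : (m * (d1 / 2) <= p x * (d1 / 2))%R by apply: ler_wpM2r => //; lra.
    rewrite /gehring; lra.
  rewrite EFinM; apply: lee_wpmul2l; first by rewrite lee_fin expR_ge0.
  by apply: ih => //; move: ck; rewrite cP exprS; lra.
have out_P : \int[mu]_(x in (c : set E) `\` P) (expR (F s c x))%:E <= B2%:E.
  have -> : (c : set E) `\` P = ((c : set E) `\` P) `&` c by rewrite setDE setIAC setIid.
  apply: (int_desc_le mcP me (fun x => expR_ge0 _)) => t t3.
  set S := desc c t; have S0 : (0 < side S)%R by exact: desc_side_gt0.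
  have Sc : (S : set E) `<=` c by exact: desc_sub.
  have [[x [cPx Sx]]|nX] := pselect (((c : set E) `\` P) `&` S !=set0); last first.
    have -> : ((c : set E) `\` P) `&` S = set0.
      by apply/seteqP; split => // x ?; apply: nX; exists x.
    by rewrite integral_set0 lee_fin mulr_ge0// expR_ge0.
  have gS : whitney S.
    right => y Sy; have [i xi] := far x cPx; exists i.
    have /andP[x1 x2] := Sx i; have /andP[y1 y2] := Sy i.
    have sS : side S = (side c / 8)%R by rewrite /S desc_side t3; congr (_ / _)%R; rewrite !exprS expr0; ring.
    have : (`|coordinate x i - coordinate y i| <= side S)%R by rewrite ler_norml; apply/andP; split; lra.
    have := ler_normD (coordinate x i - coordinate y i)%R (coordinate y i).
    rewrite subrK sS; lra.
  have nuS : (nu c - 3 * d0 <= nu S)%R.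
    have step c' e : (0 < side c')%R -> (nu c' - d0 <= nu (child c' e))%R.
      move=> c'0; apply: (dbl (child c' e) c') => /=; [lra| |exact: child_sub].
      by field.
    rewrite /S; case: t t3 {S S0 Sc Sx gS} => [//|e1 [//|e2 [//|e3 [|//]]]] _ /=.
    have c1 := child_side_gt0 e1 c0; have c2 := child_side_gt0 e2 c1.
    have := step _ e1 c0; have := step _ e2 c1; have := step _ e3 c2; lra.
  have LS : (Lam S <= Lam c)%R by exact: (lnorm_mono n_gt0 mp m0 pm mphi LamP).
  have mXS : measurable (((c : set E) `\` P) `&` S) by exact: measurableI.
  apply: le_trans (int_expR_subset mu mXS (mc S) (measurable_gehring s c) (@subIsetr _ _ _)) _.
  apply: le_trans (le_int_expR mu (mc S) (measurable_gehring s c)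
    (measurable_gehring s S) (k := M * (s * (3 * d0)))%R _) _.
    move=> y Sy; have p0 : (0 <= p y)%R by apply: le_trans (pm y); exact: ltW.
    have h1 : ((1 + s) * (Lam S - Lam c) <= 0)%R by rewrite pmulr_rle0; lra.
    have h2 : (s * (nu c - nu S) <= s * (3 * d0))%R by apply: ler_wpM2l; lra.
    have h3 : ((1 + s) * (Lam S - Lam c) + s * (nu c - nu S) <= s * (3 * d0))%R by lra.
    have := ler_wpM2l p0 h3.
    have : (p y * (s * (3 * d0)) <= M * (s * (3 * d0)))%R.
      by apply: ler_wpM2r => //; rewrite !mulr_ge0// ltW.
    rewrite /gehring; lra.
  rewrite EFinM; apply: lee_wpmul2l; first by rewrite lee_fin expR_ge0.
  exact: whitney_le.
apply: le_trans (leeD in_P out_P) _; rewrite -EFinD lee_fin.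
have : (B2 / (1 - th) <= B3)%R by rewrite /B3 le_max lexx orbT.
rewrite ler_pdivrMr; lra.
Qed.

End upper.

(** * Consequences of log-Hoelder continuity *)

Section log_hoelder_estimates.
Variables (R : realType) (n : nat).
Hypothesis n_gt0 : (0 < n)%N.
Local Notation E := (euclidean R n).
Local Notation mu := (@lebesgue_n R n).
Local Notation hcube := (hcube R n).

Lemma edist_cube (c : hcube) (x y : E) : (0 < side c)%R -> (c : set E) x -> (c : set E) y ->
  (Defs.edist x y <= n%:R * side c)%R.
Proof.
move=> c0 cx cy; rewrite /Defs.edist -[leRHS]ger0_norm ?mulr_ge0 ?(ltW c0)// -sqrtr_sqr.
apply: ler_wsqrtr; apply: (@le_trans _ _ (\sum_(i < n) side c ^+ 2)%R).
  apply: ler_sum => i _; have /andP[x1 x2] := cx i; have /andP[y1 y2] := cy i.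
  rewrite -ler_sqrt ?exprn_ge0 ?(ltW c0)// !sqrtr_sqr [leRHS]ger0_norm ?(ltW c0)//.
  by rewrite ler_norml; apply/andP; split; lra.
rewrite sumr_const card_ord -[leLHS]mulr_natl exprMn ler_wpM2r ?exprn_ge0 ?(ltW c0)//.
by rewrite expr2 ler_peMl// ler1n.
Qed.

Lemma coordinate_enorm (x : E) i : (`|coordinate x i| <= Defs.enorm x)%R.
Proof.
rewrite /Defs.enorm -sqrtr_sqr; apply: ler_wsqrtr; rewrite (bigD1 i)//= lerDl.
by apply: sumr_ge0 => j _; rewrite sqr_ge0.
Qed.

Variables (p : E -> R) (m C0 pinf Cinf : R).
Hypotheses (mp : measurable_fun setT p) (m0 : (0 < m)%R)
  (pm : forall x, (m <= p x)%R) (C00 : (0 < C0)%R) (mpinf : (m <= pinf)%R)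
  (Cinf0 : (0 < Cinf)%R).
Hypothesis LH0 : forall x y, (Defs.edist x y < 2^-1)%R ->
  (`|p x - p y| <= - (C0 / ln (Defs.edist x y)))%R.
Hypothesis LHinf : forall x, (`|p x - pinf| <= Cinf / ln (expR 1 + Defs.enorm x))%R.
Let M : R := (pinf + Cinf)%R.

Lemma enorm_ge0 (x : E) : (0 <= Defs.enorm x)%R. Proof. exact: sqrtr_ge0. Qed.

Let pinf0 : (0 < pinf)%R. Proof. exact: lt_le_trans m0 mpinf. Qed.

Let M0 : (0 <= M)%R.
Proof. by rewrite /M addr_ge0// ltW. Qed.

Let ln_e_ge1 (x : E) : (1 <= ln (expR 1 + Defs.enorm x))%R.
Proof.
have := enorm_ge0 x => x0; have e0 := expR_gt0 (1 : R).
by rewrite -[leLHS]expRK ler_ln ?posrE//; lra.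
Qed.

Lemma dist_pinf x : (`|p x - pinf| <= Cinf)%R.
Proof.
apply: le_trans (LHinf x) _; have h := ln_e_ge1 x.
rewrite ler_pdivrMr; last lra.
by rewrite ler_peMr// ltW.
Qed.

Lemma p_bounded x : (p x <= M)%R.
Proof. by have := dist_pinf x; rewrite ler_norml /M => /andP[]; lra. Qed.

(** At a distance at least l^a from the origin the decay condition at infinity
controls p at the scale l. *)
Lemma far_decay (l a : R) x i : (1 < l)%R -> (0 < a)%R ->
  (expR (a * ln l) <= `|coordinate x i|)%R -> (`|p x - pinf| * ln l <= Cinf / a)%R.
Proof.
move=> l1 a0 xi; have ll : (0 < ln l)%R by rewrite ln_gt0.
have h : (a * ln l <= ln (expR 1 + Defs.enorm x))%R.
  have e0 := expR_gt0 (1 : R); have x0 := enorm_ge0 x.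
  rewrite -[leLHS]expRK ler_ln ?posrE ?expR_gt0//; last lra.
  by have := coordinate_enorm x i; lra.
have al0 : (0 < a * ln l)%R by rewrite mulr_gt0.
rewrite -ler_pdivlMr//; apply: le_trans (LHinf x) _.
rewrite -mulrA -invfM; apply: ler_wpM2l; first exact: ltW.
by rewrite lef_pV2 ?posrE//; lra.
Qed.

(** Small cubes are controlled by the local condition, since their diameter is at
most the square root of the side; cubes of intermediate side by the boundedness
of p; large ones by the decay condition, being far from the origin. *)
Lemma whitney_tame : exists K : R, forall (c : hcube) x y, (0 < side c)%R -> whitney c ->
  (c : set E) x -> (c : set E) y -> (`|p x - p y| * `|ln (side c)| <= K)%R.
Proof.
have n2 : (1 <= (4 * n%:R ^+ 2) :> R)%R.
  have : (1 <= n%:R :> R)%R by rewrite ler1n.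
  by move=> n1; have := exprn_ege1 2 n1; lra.
have ln4 : (0 <= ln (4 * n%:R ^+ 2 : R))%R by rewrite ln_ge0.
exists (2 * C0 + M * ln (4 * n%:R ^+ 2) + 2 * Cinf)%R => c x y c0 gc cx cy.
have t1 : (0 <= M * ln (4 * n%:R ^+ 2))%R by rewrite mulr_ge0.
have t2 : (0 <= C0)%R by exact: ltW.
have t3 : (0 <= Cinf)%R by exact: ltW.
have [l1|l1] := leP (side c) 1%R.
  rewrite [`|ln _|%R]ler0_norm ?ln_le0//.
  have [small|big] := ltP (side c) (4 * n%:R ^+ 2)^-1%R.
    apply: (@le_trans _ _ (2 * C0)%R); last lra.
    have d0 : (0 <= Defs.edist x y)%R by exact: sqrtr_ge0.
    have d1 := edist_cube c0 cx cy.
    have d2 : (Defs.edist x y ^+ 2 <= side c / 4)%R.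
      apply: (@le_trans _ _ ((n%:R * side c) ^+ 2)%R).
        by rewrite lerXn2r// nnegrE mulr_ge0// ltW.
      rewrite exprMn [(side c ^+ 2)%R]expr2 mulrA [leRHS]mulrC ler_pM2r//.
      have n4 : (0 < 4 * n%:R ^+ 2 :> R)%R by lra.
      have := ltW small; rewrite -[leRHS]mul1r ler_pdivlMr//; lra.
    have d3 : (Defs.edist x y < 2^-1)%R.
      rewrite -(@ltr_pXn2r _ 2) ?nnegrE// ?invr_ge0//.
      have : ((4 * n%:R ^+ 2)^-1 <= 1 :> R)%R by rewrite invf_le1//; lra.
      rewrite [ltRHS]expr2; lra.
    have := LH0 d3; have [->|dn] := eqVneq (Defs.edist x y) 0%R.
      rewrite ln0// invr0 mulr0 oppr0 => h.
      have -> : (`|p x - p y| = 0)%R by apply/eqP; rewrite eq_le h normr_ge0.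
      by rewrite mul0r; lra.
    have dp : (0 < Defs.edist x y)%R by rewrite lt_neqAle eq_sym dn.
    have ld : (ln (Defs.edist x y) < 0)%R by rewrite ln_lt0// dp/=; lra.
    have l2 : (2 * ln (Defs.edist x y) <= ln (side c))%R.
      rewrite mulr_natl -lnXn// ler_ln ?posrE ?exprn_gt0//; lra.
    have ll : (0 <= - ln (side c))%R by rewrite oppr_ge0 ln_le0.
    move=> h; apply: le_trans (ler_wpM2r ll h) _.
    rewrite -mulrN -invrN mulrAC ler_pdivrMr ?oppr_gt0//.
    have : (- ln (side c) <= 2 * (- ln (Defs.edist x y)))%R by lra.
    move=> h2; have := ler_wpM2l t2 h2; lra.
  apply: (@le_trans _ _ (M * ln (4 * n%:R ^+ 2))%R); last lra.
  apply: ler_pM => //.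
  - by rewrite oppr_ge0 ln_le0.
  - have := pm x; have := pm y; have := p_bounded x; have := p_bounded y; move: m0.
    by rewrite ler_norml => *; apply/andP; split; lra.
  - by rewrite -lnV ?posrE// ler_ln ?posrE ?invr_gt0//;
      [rewrite -[leRHS]invrK lef_pV2 ?posrE ?invr_gt0//|]; lra.
case: gc => [|far]; first lra.
apply: (@le_trans _ _ (2 * Cinf)%R); last lra.
have fd z : (c : set E) z -> (`|p z - pinf| * ln (side c) <= Cinf)%R.
  move=> cz; have [i zi] := far z cz; have := @far_decay (side c) 1 z i l1 ltr01.
  by rewrite mul1r lnK ?posrE// divr1; exact.
have lc : (0 < ln (side c))%R by rewrite ln_gt0.
rewrite [`|ln _|%R]gtr0_norm//.
have := ler_normB (p x - pinf)%R (p y - pinf)%R.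
rewrite (_ : p x - pinf - (p y - pinf) = p x - p y)%R; last by ring.
move=> /(ler_wpM2r (ltW lc)); have := fd x cx; have := fd y cy; lra.
Qed.

Variable nu : hcube -> R.
Hypothesis nuP : forall c, (0 < side c)%R -> modular p (fun=> 0%R) c (nu c) = 1.
Local Notation lnvol := (@lnvol R n).
Let mc (c : hcube) : measurable (c : set E). Proof. exact: measurable_cube. Qed.
Let mz : measurable_fun setT (fun _ : E => 0%R : R). Proof. exact: measurable_cst. Qed.

(** If |Q| exp(- p s0) has its logarithm and a power bounded in mean, then the
integral of exp(- p s0) over Q is bounded above and below, so that s0 is within
a bounded distance of nu(Q).  The upper bound uses e^h <= 1 + e^((1 + tau) h),
the lower one the Chebyshev inequality. *)
Let compare (C1 C2 tau : R) : (0 < C1)%R -> (0 <= C2)%R -> (0 < tau)%R ->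
  exists D : R, (0 <= D)%R /\ forall (c : hcube) (s0 : R), (0 < side c)%R ->
  \int[mu]_(x in cube_set c) (`|lnvol c - p x * s0|)%:E <= (C1 * side c ^+ n)%:E ->
  \int[mu]_(x in cube_set c) (expR ((1 + tau) * (lnvol c - p x * s0)))%:E <= (C2 * side c ^+ n)%:E ->
  (`|nu c - s0| <= D)%R.
Proof.
move=> C10 C20 tau0; pose k : R := (2^-1 * expR (- (C1 / 2^-1)))%R.
have k0 : (0 < k)%R by rewrite mulr_gt0// ?expR_gt0// invr_gt0.
have k1 : (k <= 1)%R.
  have : (expR (- (C1 / 2^-1)) <= 1)%R.
    by rewrite expR_le1 oppr_le0 divr_ge0 ?ltW// invr_gt0.
  rewrite /k; have := expR_ge0 (- (C1 / 2^-1))%R; lra.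
have lk : (ln k / m <= 0)%R by rewrite pmulr_lle0 ?invr_gt0// ln_le0.
have lC : (0 <= ln (1 + C2) / m)%R by rewrite divr_ge0 ?(ltW m0)// ln_ge0; lra.
exists (ln (1 + C2) / m - ln k / m)%R; split; first lra.
move=> c s0 c0 h1 h2.
have mf : measurable_fun setT (fun x => lnvol c - p x * s0)%R by mfun.
have cn : (0 < side c ^+ n)%R by rewrite exprn_gt0.
have up : (nu c <= s0 + ln (1 + C2) / m)%R.
  apply: (modular_upper_large mp m0 pm mz (mc c) (a := nu c)); [by rewrite nuP| |lra].
  rewrite -(@lee_pmul2l _ (side c ^+ n)%:E)//.
  rewrite -EFinM (_ : side c ^+ n * (1 + C2) = side c ^+ n + C2 * side c ^+ n)%R; last by ring.
  rewrite EFinD.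
  apply: (@le_trans _ _ (\int[mu]_(x in cube_set c) (1 + expR ((1 + tau) * (lnvol c - p x * s0)))%:E)); last first.
    rewrite (intD mu (mc c) _ _ (fun x _ => ler01) (fun x _ => expR_ge0 _)); last 2 first.
    - exact: measurable_cst.
    - by mfun.
    by rewrite int_const// mul1e mu_cube//; apply: leeD.
  rewrite -expR_lnvol// /modular -(intZ mu (mc c) _ (fun x _ => expR_ge0 _) (expR_ge0 _)); last by mfun.
  apply: (le_int mu (mc c)); [by mfun|by mfun|by move=> x _; rewrite mulr_ge0 ?expR_ge0|].
  move=> x _; rewrite -expRD.
  have [h|h] := leP (lnvol c - p x * s0)%R 0%R.
    apply: (@le_trans _ _ 1%R); last by rewrite lerDl expR_ge0.
    by rewrite expR_le1; lra.
  apply: (@le_trans _ _ (expR ((1 + tau) * (lnvol c - p x * s0))))%R; last by rewrite lerDr.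
  rewrite ler_expR; have := mulr_gt0 tau0 h; lra.
have dn : (s0 + ln k / m <= nu c)%R.
  apply: (modular_lower mp m0 pm mz (mc c)).
  - by rewrite nuP.
  - apply: (@modular_mass _ _ n_gt0 p mp _ mz (fun=> s0) C1 C10 c c 2^-1 c0) => //.
    + apply: le_trans h1; apply: (le_int mu (mc c)).
      * by rewrite /log_density; mfun.
      * by mfun.
      * by move=> x _; rewrite le_max lexx.
      * move=> x _; rewrite ge_max normr_ge0/= -normrN (le_trans _ (ler_norm _))//.
        by rewrite /log_density; lra.
    + by rewrite mu_cube// divff ?mul1r.
  - by rewrite k0 k1.
rewrite ler_norml; apply/andP; split; lra.
Qed.

(** The comparison applies with s0 = log |Q| / p(x) for any x in Q: the exponent
of |Q| exp(- p s0) is then proportional to (p(x) - p) log |Q|. *)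
Lemma whitney_flat : exists Ch : R, (0 <= Ch)%R /\ forall (c : hcube) x, (0 < side c)%R -> whitney c ->
  (c : set E) x -> (`|lnvol c - p x * nu c| <= Ch)%R.
Proof.
have [K0 tame0] := whitney_tame.
pose K : R := Num.max 0%R K0; have KK : (0 <= K)%R by rewrite le_max lexx.
have tame c x y : (0 < side c)%R -> whitney c -> (c : set E) x -> (c : set E) y ->
    (`|p x - p y| * `|ln (side c)| <= K)%R.
  by move=> *; rewrite /K le_max tame0 ?orbT.
pose C1 : R := (n%:R * K / m + 1)%R.
have C11 : (0 <= n%:R * K / m)%R by rewrite divr_ge0 ?(ltW m0)// mulr_ge0.
have C10 : (0 < C1)%R by rewrite /C1; lra.
have [D [D0 hD]] := compare C10 (expR_ge0 ((1 + 1) * C1)%R) ltr01.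
exists (C1 + M * D)%R; split; first by rewrite addr_ge0 ?(ltW C10)// mulr_ge0.
move=> c x c0 gc cx; pose s0 : R := (lnvol c / p x)%R.
have px y : (0 < p y)%R by exact: lt_le_trans m0 (pm y).
have h y : (c : set E) y -> (`|lnvol c - p y * s0| <= C1)%R.
  move=> cy; have -> : (lnvol c - p y * s0 = n%:R * ((p x - p y) * ln (side c)) / p x)%R.
    by rewrite /s0 /lnvol; field; rewrite gt_eqF.
  rewrite !normrM normfV [`|p x|%R]gtr0_norm// [`|n%:R|%R]ger0_norm//.
  apply: (@le_trans _ _ (n%:R * K / m)%R); last by rewrite /C1; lra.
  apply: ler_pM; rewrite ?invr_ge0 ?(ltW (px _))//.
    by apply: ler_wpM2l => //; exact: tame.
  by rewrite lef_pV2 ?posrE.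
have := hD c s0 c0; set I1 := \int[mu]_(x in _) _; set I2 := \int[mu]_(x in _) _ => hD'.
have D' : (`|nu c - s0| <= D)%R.
  apply: hD'.
  - rewrite /I1 EFinM -mu_cube// -int_const//; apply: (le_int mu (mc c)).
    + by mfun.
    + exact: measurable_cst.
    + by [].
    + exact: h.
  - rewrite /I2 EFinM -mu_cube// -int_const//; apply: (le_int mu (mc c)).
    + by mfun.
    + exact: measurable_cst.
    + by move=> ? _; exact: expR_ge0.
    + move=> y cy; rewrite ler_expR; apply: ler_wpM2l => //.
      by have := h y cy; rewrite ler_norml => /andP[].
have -> : (lnvol c - p x * nu c = (lnvol c - p x * s0) - p x * (nu c - s0))%R by ring.
apply: le_trans (ler_normB _ _) _; apply: lerD; first exact: h.
rewrite normrM [`|p x|%R]gtr0_norm//; apply: ler_pM => //; first exact: ltW.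
exact: p_bounded.
Qed.

(** Separates the cube of half-side rho around the origin, on which only a crude
bound is available but whose measure is small. *)
Let wild_split (f : E -> R) (A B rho : R) (c : hcube) : measurable_fun setT f ->
  (forall x, 0 <= f x)%R -> (0 < side c)%R -> (0 < rho)%R -> (0 <= A)%R -> (0 <= B)%R ->
  (forall x, (c : set E) x -> (exists i, (rho <= `|coordinate x i|)%R) -> (f x <= A)%R) ->
  (forall x, (c : set E) x -> (f x <= B)%R) ->
  \int[mu]_(x in cube_set c) (f x)%:E <= (A * side c ^+ n + B * (2 * rho) ^+ n)%:E.
Proof.
move=> mf f0 c0 rho0 A0 B0 fA fB.
pose W : hcube := Hcube (fun=> - rho)%R (2 * rho)%R.
have W0 : (0 < side W)%R by rewrite /= mulr_gt0.
have mcW : measurable ((c : set E) `&` W) by exact: measurableI.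
have mcD : measurable ((c : set E) `\` W) by exact: measurableD.
have -> : (c : set E) = (c `&` W) `|` (c `\` W) by rewrite setUIDK.
rewrite (int_setU mu mcW mcD mf f0); last first.
  by apply/seteqP; split => // x [[_ Wx] [_]].
rewrite addeC EFinD; apply: leeD.
  apply: (@le_trans _ _ (\int[mu]_(x in (c : set E) `\` W) A%:E)).
    apply: (le_int mu mcD mf (measurable_cst A) (fun x _ => f0 x)) => x [cx nW].
    apply: fA => //; apply: contrapT => nx; apply: nW => i /=.
    have : (`|coordinate x i| < rho)%R by rewrite ltNge; apply/negP => h; apply: nx; exists i.
    by rewrite ltr_norml => /andP[? ?]; apply/andP; split; lra.
  rewrite int_const// EFinM; apply: lee_wpmul2l; first by rewrite lee_fin.
  by rewrite -mu_cube//; apply: mu_le; exact: subDsetl.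
apply: (@le_trans _ _ (\int[mu]_(x in (c : set E) `&` W) B%:E)).
  by apply: (le_int mu mcW mf (measurable_cst B) (fun x _ => f0 x)) => x [cx _]; exact: fB.
rewrite int_const// EFinM; apply: lee_wpmul2l; first by rewrite lee_fin.
by rewrite -(mu_cube W0); apply: mu_le; exact: subIsetr.
Qed.

(** For a cube of side l > 1 compare nu(Q) with s0 = log |Q| / pinf, so that
|Q| exp(- p s0) = |Q|^(1 - p / pinf).  At distance at least l^a from the origin
this is bounded.  Elsewhere it is at most |Q|^(1 - 2 a) with 2 a = m / pinf,
while the exceptional cube has measure of order |Q|^a; and
(1 + a) (1 - 2 a) + a <= 1 leaves room for the power 1 + a. *)
Theorem average_estimates : exists C tau : R, [/\ (0 < C)%R, (0 < tau)%R & forall c : hcube, (0 < side c)%R ->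
  \int[mu]_(x in cube_set c) (`|lnvol c - p x * nu c|)%:E <= (C * side c ^+ n)%:E /\
  \int[mu]_(x in cube_set c) (expR ((1 + tau) * (lnvol c - p x * nu c)))%:E <= (C * side c ^+ n)%:E].
Proof.
have [Ch [Ch0 flat]] := whitney_flat.
pose a : R := (m / pinf / 2)%R.
have a0 : (0 < a)%R by rewrite /a !divr_gt0.
have a1 : (2 * a <= 1)%R by rewrite /a mulrC divfK// ler_pdivrMr// mul1r.
pose Cf : R := (n%:R * (Cinf / a) / pinf)%R.
have Cf0 : (0 < Cf)%R by rewrite /Cf !(mulr_gt0, divr_gt0, invr_gt0)// ltr0n.
pose B : R := (Cinf / pinf)%R; have B0 : (0 < B)%R by rewrite divr_gt0.
pose C1 : R := (Cf + 2 * B * 2 ^+ n)%R.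
have n2 : (0 < 2 ^+ n :> R)%R by rewrite exprn_gt0.
have B2n : (0 < 2 * B * 2 ^+ n)%R by apply: mulr_gt0 => //; apply: mulr_gt0.
have C10 : (0 < C1)%R by rewrite /C1; lra.
pose C2 : R := (expR ((1 + a) * Cf) + 2 ^+ n)%R.
have C20 : (0 <= C2)%R by rewrite /C2 addr_ge0 ?expR_ge0// ltW.
have [D [D0 hD]] := compare C10 C20 a0.
exists (C1 + M * D + expR ((1 + a) * (M * D)) * C2 + Ch + expR ((1 + a) * Ch))%R, a.
have s1 : (0 < C1 + M * D)%R by have := mulr_ge0 M0 D0; lra.
have s2 : (0 <= expR ((1 + a) * (M * D)) * C2)%R by rewrite mulr_ge0// expR_ge0.
have s3 : (0 < expR ((1 + a) * Ch))%R by exact: expR_gt0.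
split; [lra|exact: a0|].
move=> c c0; have cn : (0 < side c ^+ n)%R by rewrite exprn_gt0.
have mh s0 : measurable_fun setT (fun x => lnvol c - p x * s0)%R by mfun.
have ma s0 : measurable_fun setT (fun x => `|lnvol c - p x * s0|)%R by mfun.
have me s0 : measurable_fun setT (fun x => expR ((1 + a) * (lnvol c - p x * s0))) by mfun.
have [l1|l1] := leP (side c) 1%R.
  have gc : whitney c by left.
  split.
    apply: (@le_trans _ _ (Ch * side c ^+ n)%:E); last first.
      by rewrite lee_fin ler_pM2r//; lra.
    rewrite EFinM -mu_cube// -int_const//.
    apply: (le_int mu (mc c) (ma _) (measurable_cst Ch) (fun x _ => normr_ge0 _)) => x cx; exact: flat.
  apply: (@le_trans _ _ (expR ((1 + a) * Ch) * side c ^+ n)%:E); last first.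
    by rewrite lee_fin ler_pM2r//; lra.
  rewrite EFinM -mu_cube// -int_const//.
  apply: (le_int mu (mc c) (me _) (measurable_cst (expR ((1 + a) * Ch))) (fun x _ => expR_ge0 _)) => x cx.
  rewrite ler_expR; apply: ler_wpM2l; first lra.
  by have := flat c x c0 gc cx; rewrite ler_norml => /andP[].
have lc : (0 < ln (side c))%R by rewrite ln_gt0.
pose rho : R := expR (a * ln (side c)); pose s0 : R := (lnvol c / pinf)%R.
have rho0 : (0 < rho)%R by exact: expR_gt0.
have t0 : (0 <= lnvol c)%R by rewrite /lnvol mulr_ge0// ltW.
have rhon : ((2 * rho) ^+ n = 2 ^+ n * expR (a * lnvol c))%R.
  by rewrite exprMn /rho -expRM_natl /lnvol; congr (_ * expR _)%R; ring.
have hE x : (lnvol c - p x * s0 = lnvol c * (pinf - p x) / pinf)%R.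
  by rewrite /s0; field; rewrite gt_eqF.
have hA x : (`|lnvol c - p x * s0| = lnvol c * `|p x - pinf| / pinf)%R.
  by rewrite hE 2!normrM normfV [`|pinf|%R]gtr0_norm// [`|lnvol c|%R]ger0_norm// distrC.
have h_all x : (`|lnvol c - p x * s0| <= lnvol c * B)%R.
  rewrite hA -mulrA; apply: ler_wpM2l => //.
  by rewrite ler_pM2r ?invr_gt0//; exact: dist_pinf.
have h_far x : (exists i, (rho <= `|coordinate x i|)%R) -> (`|lnvol c - p x * s0| <= Cf)%R.
  move=> [i xi]; have h := far_decay l1 a0 xi.
  rewrite hA /Cf ler_pM2r ?invr_gt0// /lnvol -mulrA [(ln _ * _)%R]mulrC.
  exact: ler_wpM2l.
have h_up x : (lnvol c - p x * s0 <= lnvol c * (1 - 2 * a))%R.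
  rewrite hE -mulrA; apply: ler_wpM2l => //.
  have -> : (1 - 2 * a = (pinf - m) / pinf)%R by rewrite /a; field; rewrite gt_eqF.
  by rewrite ler_pM2r ?invr_gt0// lerB.
have A1 : \int[mu]_(x in cube_set c) (`|lnvol c - p x * s0|)%:E <= (C1 * side c ^+ n)%:E.
  apply: le_trans (wild_split (A := Cf) (B := lnvol c * B) (ma s0) (fun x => normr_ge0 _) c0 rho0 _ _ _ _) _.
  - exact: ltW.
  - by rewrite mulr_ge0// ltW.
  - by move=> x _; exact: h_far.
  - by move=> x _; exact: h_all.
  rewrite lee_fin rhon /C1 mulrDl lerD2l -expR_lnvol//.
  set t := lnvol c; have {}t0 : (0 <= t)%R by [].
  have e1 : (t <= 2 * expR ((1 - a) * t))%R.
    have := expR_ge1Dx ((1 - a) * t)%R.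
    have : (0 <= (1 - 2 * a) * t)%R by rewrite mulr_ge0//; lra.
    lra.
  have -> : (expR t = expR ((1 - a) * t) * expR (a * t))%R by rewrite -expRD; congr expR; ring.
  have X0 : (0 <= B * 2 ^+ n * expR (a * t))%R.
    by apply: mulr_ge0; [apply: mulr_ge0; exact: ltW|exact: expR_ge0].
  have := ler_wpM2r X0 e1; lra.
have A2 : \int[mu]_(x in cube_set c) (expR ((1 + a) * (lnvol c - p x * s0)))%:E <= (C2 * side c ^+ n)%:E.
  have a1' : (0 <= 1 + a)%R by lra.
  apply: le_trans (wild_split (A := expR ((1 + a) * Cf))
    (B := expR ((1 + a) * (lnvol c * (1 - 2 * a)))) (me s0) (fun x => expR_ge0 _) c0 rho0 (expR_ge0 _) (expR_ge0 _) _ _) _.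
  - move=> x _ hx; rewrite ler_expR; apply: ler_wpM2l => //.
    by have := h_far x hx; rewrite ler_norml => /andP[].
  - by move=> x _; rewrite ler_expR; apply: ler_wpM2l.
  rewrite lee_fin rhon /C2 [leRHS]mulrDl lerD2l -expR_lnvol// mulrCA ler_pM2l// -expRD ler_expR.
  have : (0 <= a * a * lnvol c)%R by apply: mulr_ge0 => //; apply: mulr_ge0; exact: ltW.
  lra.
have hDc := hD c s0 c0 A1 A2.
have sh x : (`|p x * (nu c - s0)| <= M * D)%R.
  have p0 : (0 < p x)%R := lt_le_trans m0 (pm x).
  rewrite normrM [`|p x|%R]gtr0_norm//; apply: ler_pM => //; first exact: ltW.
  exact: p_bounded.
have E1 x : (lnvol c - p x * nu c = (lnvol c - p x * s0) - p x * (nu c - s0))%R by ring.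
split.
  apply: (@le_trans _ _ ((C1 + M * D) * side c ^+ n)%:E); last first.
    by rewrite lee_fin ler_pM2r//; lra.
  rewrite mulrDl EFinD.
  apply: (@le_trans _ _ (\int[mu]_(x in cube_set c) (`|lnvol c - p x * s0| + M * D)%:E)).
    apply: (le_int mu (mc c) (ma _) _ (fun x _ => normr_ge0 _)); first by mfun.
    by move=> x _; rewrite E1 (le_trans (ler_normB _ _))// lerD2l.
  have MD : (0 <= M * D)%R by rewrite mulr_ge0.
  rewrite (intD mu (mc c) (ma s0) (measurable_cst _) (fun x _ => normr_ge0 _) (fun x _ => MD)).
  by apply: leeD => //; rewrite int_const// mu_cube// EFinM.
apply: (@le_trans _ _ (expR ((1 + a) * (M * D)) * C2 * side c ^+ n)%:E); last first.
  by rewrite lee_fin ler_pM2r//; lra.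
have mk s1' : measurable_fun setT (fun x => (1 + a) * (lnvol c - p x * s1'))%R by mfun.
apply: le_trans (le_int_expR mu (mc c) (mk (nu c)) (mk s0) (k := (1 + a) * (M * D))%R _) _.
  move=> x _; rewrite -mulrDr; apply: ler_wpM2l; first lra.
  by rewrite E1; have := sh x; rewrite ler_norml => /andP[]; lra.
rewrite -mulrA EFinM; apply: lee_wpmul2l => //; by rewrite lee_fin expR_ge0.
Qed.

End log_hoelder_estimates.

(** * From the reverse Hoelder inequality to the A_infinity condition *)

Section lower.
Variables (R : realType) (n : nat).
Hypothesis n_gt0 : (0 < n)%N.
Local Notation E := (euclidean R n).
Local Notation mu := (@lebesgue_n R n).
Local Notation corner := {ffun 'I_n -> bool}.
Local Notation hcube := (hcube R n).
Local Notation lnvol := (@lnvol R n).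
Variables (p : E -> R) (m M : R).
Hypotheses (mp : measurable_fun setT p) (m0 : (0 < m)%R)
  (pm : forall x, (m <= p x)%R) (pM : forall x, (p x <= M)%R).
Variables (phi : E -> R) (mphi : measurable_fun setT phi) (Lam nu : hcube -> R).
Hypothesis LamP : forall c, (0 < side c)%R -> modular p phi c (Lam c) = 1.
Hypothesis nuP : forall c, (0 < side c)%R -> modular p (fun=> 0%R) c (nu c) = 1.
Variables (CL tau : R).
Hypotheses (CL0 : (0 < CL)%R) (tau0 : (0 < tau)%R).
Hypothesis avg : forall c : hcube, (0 < side c)%R ->
  \int[mu]_(x in cube_set c) (`|lnvol c - p x * nu c|)%:E <= (CL * side c ^+ n)%:E.
Hypothesis avg_exp : forall c : hcube, (0 < side c)%R ->
  \int[mu]_(x in cube_set c) (expR ((1 + tau) * (lnvol c - p x * nu c)))%:E <= (CL * side c ^+ n)%:E.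
Let mc (c : hcube) : measurable (c : set E). Proof. exact: measurable_cube. Qed.
Let mz : measurable_fun setT (fun _ : E => 0%R : R). Proof. exact: measurable_cst. Qed.
Local Notation psi := (log_density p phi Lam).

(** The logarithm T(Q) of the mean of w over Q = c in L^p. *)
Definition log_mean c : R := (Lam c - nu c)%R.

Let mabs c : measurable_fun setT (fun x => `|lnvol c - p x * nu c|)%R.
Proof. by mfun. Qed.

(** Since p (phi - T(Q)) is log (|Q| v_Q) minus log (|Q| u_Q), the bound x <= e^x
reduces the estimate to the normalization of v_Q and to the mean of
|log (|Q| u_Q)|. *)
Lemma upper_oscillation c : (0 < side c)%R ->
  \int[mu]_(x in cube_set c) (Num.max 0 (phi x - log_mean c))%:E <=
  ((1 + CL) / m * side c ^+ n)%:E.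
Proof.
move=> c0; have mpsi : measurable_fun setT (psi c) by exact: measurable_log_density.
have me : measurable_fun setT (fun x => expR (psi c x)) by mfun.
have ms : measurable_fun setT (fun x => expR (psi c x) + `|lnvol c - p x * nu c|)%R by mfun.
have mi : (0 <= m^-1)%R by rewrite invr_ge0 ltW.
apply: (@le_trans _ _ (\int[mu]_(x in cube_set c)
    (m^-1 * (expR (psi c x) + `|lnvol c - p x * nu c|))%:E)).
  apply: (le_int mu (mc c)); [by mfun|by mfun|by move=> x _; rewrite le_max lexx|].
  move=> x _; rewrite ge_max; apply/andP; split.
    by rewrite mulr_ge0// addr_ge0// expR_ge0.
  rewrite mulrC ler_pdivlMr//.
  have [h|h] := leP (phi x - log_mean c)%R 0%R.
    apply: (@le_trans _ _ 0%R); last by rewrite addr_ge0// expR_ge0.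
    by rewrite pmulr_lle0.
  have := ler_wpM2r (ltW h) (pm x).
  have := expR_ge1Dx (psi c x); have := ler_norm (- (lnvol c - p x * nu c))%R.
  rewrite normrN /psi /log_density /log_mean; lra.
have s0 x : (0 <= expR (psi c x) + `|lnvol c - p x * nu c|)%R by rewrite addr_ge0// expR_ge0.
rewrite (intZ mu (mc c) ms (fun x _ => s0 x) mi).
rewrite (intD mu (mc c) me (mabs c) (fun x _ => expR_ge0 _) (fun x _ => normr_ge0 _)).
rewrite (int_exp_log_density n_gt0 mp mphi LamP c0) mulrAC mulrDl mul1r.
rewrite [leRHS](_ : _ = m^-1%:E * (side c ^+ n + CL * side c ^+ n)%:E); last first.
  by rewrite -EFinM; congr EFin; ring.
by apply: lee_wpmul2l; [rewrite lee_fin|rewrite EFinD; apply: leeD => //; exact: avg].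
Qed.

(** The same decomposition, for the other sign. *)
Lemma log_density_low (C : R) c : (0 <= C)%R -> (0 < side c)%R ->
  \int[mu]_(x in cube_set c) (Num.max 0 (log_mean c - phi x))%:E <= (C * side c ^+ n)%:E ->
  \int[mu]_(x in cube_set c) (Num.max 0%R (- psi c x))%:E <= ((M * C + CL) * side c ^+ n)%:E.
Proof.
move=> C0 c0 h; have mpsi : measurable_fun setT (psi c) by exact: measurable_log_density.
have M0 : (0 <= M)%R by exact: le_trans (ltW m0) (le_trans (pm point) (pM point)).
have mm : measurable_fun setT (fun x => Num.max 0 (log_mean c - phi x))%R by mfun.
have mM : measurable_fun setT (fun x => M * Num.max 0 (log_mean c - phi x))%R by mfun.
have mx0 x : (0 <= Num.max 0 (log_mean c - phi x))%R by rewrite le_max lexx.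
have Mx0 x : (0 <= M * Num.max 0 (log_mean c - phi x))%R by rewrite mulr_ge0.
apply: (@le_trans _ _ (\int[mu]_(x in cube_set c)
    (M * Num.max 0 (log_mean c - phi x) + `|lnvol c - p x * nu c|)%:E)).
  apply: (le_int mu (mc c)); [by mfun|by mfun|by move=> x _; rewrite le_max lexx|].
  move=> x _; rewrite ge_max addr_ge0//=.
  have h1 : (p x * (log_mean c - phi x) <= M * Num.max 0 (log_mean c - phi x))%R.
    apply: (@le_trans _ _ (p x * Num.max 0 (log_mean c - phi x))%R).
      by apply: ler_wpM2l; [exact: le_trans (ltW m0) (pm x)|rewrite le_max lexx orbT].
    exact: ler_wpM2r.
  have := ler_norm (- (lnvol c - p x * nu c))%R.
  move: h1; set X := Num.max _ _; rewrite normrN /psi /log_density /log_mean; lra.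
rewrite (intD mu (mc c) mM (mabs c) (fun x _ => Mx0 x) (fun x _ => normr_ge0 _)).
rewrite (intZ mu (mc c) mm (fun x _ => mx0 x) M0) mulrDl -mulrA EFinD EFinM.
by apply: leeD; [exact: lee_wpmul2l|exact: avg].
Qed.

Lemma unit_log_density_low c : (0 < side c)%R ->
  \int[mu]_(x in cube_set c) (Num.max 0%R (- log_density p (fun=> 0%R) nu c x))%:E <=
  (CL * side c ^+ n)%:E.
Proof.
move=> c0; apply: le_trans (avg c0).
have md := measurable_log_density mp mz nu c.
apply: (le_int mu (mc c)); [by mfun|by mfun|by move=> x _; rewrite le_max lexx|].
move=> x _; rewrite ge_max normr_ge0/= -normrN (le_trans _ (ler_norm _))//.
by rewrite /log_density; lra.
Qed.

Section from_gehring.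
Variables (s B : R).
Hypotheses (s0 : (0 < s)%R) (B0 : (0 < B)%R).
Hypothesis geh : forall c : hcube, (0 < side c)%R ->
  \int[mu]_(x in cube_set c) (expR (gehring p phi Lam nu s c x))%:E <= B%:E.

(** Splits an exponential at a level: with h - g proportional to f - g, the
second alternative holds wherever f - g is large.  This replaces the Hoelder
inequality in the two proofs of absolute continuity below. *)
Let truncate (X : set E) (f g h : E -> R) (k t : R) : measurable X ->
  measurable_fun setT f -> measurable_fun setT g -> measurable_fun setT h ->
  (forall x, f x <= k + g x \/ f x <= - t + h x)%R ->
  \int[mu]_(x in X) (expR (f x))%:E <=
  (expR k)%:E * \int[mu]_(x in X) (expR (g x))%:E +
  (expR (- t))%:E * \int[mu]_(x in X) (expR (h x))%:E.
Proof.
move=> mX mf mg mh fgh.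
have me (a : R) u : measurable_fun setT u ->
    measurable_fun setT (fun x : E => expR a * expR (u x))%R by move=> ?; mfun.
have me1 u : measurable_fun setT u -> measurable_fun setT (fun x : E => expR (u x) : R) by move=> ?; mfun.
have e0 (a : R) (u : E -> R) x : (0 <= expR a * expR (u x))%R by rewrite mulr_ge0 ?expR_ge0.
rewrite -(intZ mu mX (me1 _ mg) (fun x _ => expR_ge0 _) (expR_ge0 _)).
rewrite -(intZ mu mX (me1 _ mh) (fun x _ => expR_ge0 _) (expR_ge0 _)).
rewrite -(intD mu mX (me k g mg) (me (- t)%R h mh) (fun x _ => e0 _ _ x) (fun x _ => e0 _ _ x)).
apply: (le_int mu mX (me1 _ mf)); [by mfun|by move=> x _; exact: expR_ge0|].
move=> x _; rewrite -!expRD; have [h1|h1] := fgh x.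
  by rewrite (@le_trans _ _ (expR (k + g x)))// ?ler_expR// lerDl expR_ge0.
by rewrite (@le_trans _ _ (expR (- t + h x)))// ?ler_expR// lerDr expR_ge0.
Qed.

Let exp_level (e C q : R) : (0 < e)%R -> (0 < C)%R -> (0 < q)%R ->
  exists k : R, (expR (- (q * k)) * C = e)%R.
Proof.
move=> e0 C0 q0; exists (ln (C / e) / q)%R.
rewrite (_ : q * _ = ln (C / e))%R; last by field; rewrite gt_eqF.
rewrite expRN lnK ?posrE ?divr_gt0//; field.
by rewrite !gt_eqF.
Qed.

(** Uniform absolute continuity of u_Q dx: |Q| u_Q is bounded in L^(1 + tau) with
respect to dx / |Q|. *)
Let abs_cont_cst (e : R) : (0 < e)%R -> exists del : R, (0 < del)%R /\
  forall c (X : set E), (0 < side c)%R -> measurable X -> X `<=` c ->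
    mu X <= (del * side c ^+ n)%:E -> modular p (fun=> 0%R) X (nu c) <= e%:E.
Proof.
move=> e0; have e20 : (0 < e / 2)%R by lra.
have [k kE] := exp_level e20 CL0 tau0.
exists (e / 2 * expR (- k))%R; split; first by rewrite mulr_gt0// expR_gt0.
move=> c X c0 mX Xc Xd; have cn : (0 < side c ^+ n)%R by rewrite exprn_gt0.
have ma := measurable_modular_arg mp mz (nu c).
have mh : measurable_fun setT (fun x => (1 + tau) * (lnvol c - p x * nu c) - lnvol c)%R by mfun.
have mh' : measurable_fun setT (fun x => (1 + tau) * (lnvol c - p x * nu c))%R by mfun.
have mk : measurable_fun setT (fun _ : E => - lnvol c)%R by exact: measurable_cst.
apply: le_trans (truncate (k := k) (t := tau * k)%R mX ma mk mh _) _.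
  move=> x; have [h|h] := leP (lnvol c - p x * nu c)%R k; [left; lra|right].
  by have := ltr_pM2l tau0 k (lnvol c - p x * nu c)%R; rewrite h; lra.
rewrite [e in leRHS](_ : _ = e / 2 + e / 2)%R; last by lra.
rewrite EFinD; apply: leeD.
  rewrite int_const// muleA -EFinM -expRD.
  apply: le_trans (lee_wpmul2l _ Xd) _; first by rewrite lee_fin expR_ge0.
  rewrite -EFinM lee_fin expRD [expR (- lnvol c)]expRN expR_lnvol// expRN.
  rewrite le_eqVlt; apply/orP; left; apply/eqP; field.
  by rewrite !gt_eqF// expR_gt0.
rewrite -[in leRHS]kE EFinM; apply: lee_wpmul2l; first by rewrite lee_fin expR_ge0.
apply: le_trans (le_int_expR mu (k := - lnvol c)%R mX mh mh' _) _; first by move=> x _; lra.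
apply: le_trans (lee_wpmul2l _ (le_trans (int_expR_subset mu mX (mc c) mh' Xc) (avg_exp c0))) _.
  by rewrite lee_fin expR_ge0.
by rewrite -EFinM lee_fin expRN expR_lnvol// mulrCA mulVf ?mulr1// gt_eqF.
Qed.

(** Uniform absolute continuity of v_Q dx: by the reverse Hoelder inequality
v_Q / u_Q is bounded in L^(1 + s) with respect to u_Q dx, and u_Q dx is
absolutely continuous itself. *)
Let abs_cont (e : R) : (0 < e)%R -> exists del : R, (0 < del)%R /\
  forall c (X : set E), (0 < side c)%R -> measurable X -> X `<=` c ->
    mu X <= (del * side c ^+ n)%:E -> modular p phi X (Lam c) <= e%:E.
Proof.
move=> e0; have e20 : (0 < e / 2)%R by lra.
have [k kE] := exp_level e20 B0 s0.
have ek : (0 < e / 2 * expR (- k))%R by rewrite mulr_gt0// expR_gt0.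
have [del [d0 hd]] := abs_cont_cst ek.
exists del; split => // c X c0 mX Xc Xd.
have ma := measurable_modular_arg mp mz (nu c).
have mb := measurable_modular_arg mp mphi (Lam c).
have mg := measurable_gehring mp mphi Lam nu s c.
apply: le_trans (truncate (k := k) (t := s * k)%R mX mb ma mg _) _.
  move=> x; have [h|h] := leP (p x * (phi x - Lam c + nu c))%R k; [left; lra|right].
  have := ltr_pM2l s0 k (p x * (phi x - Lam c + nu c))%R; rewrite h /gehring; lra.
rewrite [e in leRHS](_ : _ = e / 2 + e / 2)%R; last by lra.
rewrite EFinD; apply: leeD.
  apply: le_trans (lee_wpmul2l _ (hd c X c0 mX Xc Xd)) _; first by rewrite lee_fin expR_ge0.
  by rewrite -EFinM lee_fin mulrCA -expRD subrr expR0 mulr1.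
rewrite -[in leRHS]kE EFinM; apply: lee_wpmul2l; first by rewrite lee_fin expR_ge0.
exact: le_trans (int_expR_subset mu mX (mc c) mg Xc) (geh c0).
Qed.

Let sub_lev (t : R) : set E := [set x | (phi x <= t)%R].
Let msub t : measurable (sub_lev t). Proof. exact: measurable_sub_level. Qed.

(** Where phi <= T(Q) - g with g = log 2 / m, one has v_Q <= u_Q / 2.  So half of
the mass of v_Q sits on the complement, which by absolute continuity fills a
fixed proportion of Q. *)
Let not_low : exists g al : R, [/\ (0 < g)%R, (0 < al)%R, (al < 1)%R &
  forall c, (0 < side c)%R -> mu (sub_lev (log_mean c - g) `&` c) <= (al * side c ^+ n)%:E].
Proof.
have e4 : (0 < 4^-1 :> R)%R by rewrite invr_gt0.
have [del [d0 hd]] := abs_cont e4.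
have l2 : (0 < ln 2 :> R)%R by rewrite ln_gt0// ltr1n.
pose d : R := Num.min del 2^-1%R.
have dd : (0 < d)%R by rewrite lt_min d0/= invr_gt0.
have d2 : (d <= 2^-1)%R by rewrite ge_min lexx orbT.
exists (ln 2 / m)%R, (1 - d)%R; split; [by rewrite divr_gt0| lra|lra|].
move=> c c0; set g := (ln 2 / m)%R; set X := sub_lev _ `&` _.
have cn : (0 < side c ^+ n)%R by rewrite exprn_gt0.
have mX : measurable X by apply: measurableI; [exact: msub|exact: mc].
have mF : measurable ((c : set E) `\` X) by exact: measurableD.
have Xc : X `<=` c by exact: subIsetr.
have JX : modular p phi X (Lam c) <= (2^-1)%:E.
  have ma := measurable_modular_arg mp mz (nu c).
  have mb := measurable_modular_arg mp mphi (Lam c).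
  apply: le_trans (le_int_expR mu (k := - ln 2)%R mX mb ma _) _.
    move=> x [hx _]; have gm : (g * m = ln 2)%R by rewrite /g divfK// gt_eqF.
    have := pm x; have h : (phi x - log_mean c <= - g)%R by move: hx; rewrite /sub_lev/=; lra.
    have g0 : (0 < g)%R by rewrite /g divr_gt0.
    move=> /(ler_wpM2l (ltW g0)) h1.
    have p0 : (0 <= p x)%R by exact: le_trans (ltW m0) (pm x).
    have := ler_wpM2l p0 h; rewrite /log_mean; lra.
  have := modular_subset mp mz (nu c) mX (mc c) Xc; rewrite (nuP c0) => h.
  apply: le_trans (lee_wpmul2l _ h) _; first by rewrite lee_fin expR_ge0.
  by rewrite mule1 lee_fin expRN lnK// posrE.
have sumJ : modular p phi X (Lam c) + modular p phi (c `\` X) (Lam c) = 1.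
  rewrite -(LamP c0) /modular -(int_setU mu mX mF
    (measurable_modular mp mphi (Lam c)) (fun x => expR_ge0 _) (setDIK _ _)).
  by rewrite setDUK.
have big : (d * side c ^+ n)%:E <= mu (c `\` X).
  rewrite leNgt; apply/negP => small.
  have : modular p phi (c `\` X) (Lam c) <= (4^-1)%:E.
    apply: hd => //; apply: le_trans (ltW small) _; rewrite lee_fin ler_pM2r// ge_min lexx//.
  move=> h; have := leeD JX h; rewrite sumJ -EFinD lee_fin; lra.
have sum_mu : mu X + mu ((c : set E) `\` X) = (side c ^+ n)%:E.
  rewrite -mu_cube// -[in RHS](setDUK Xc); apply/esym; apply: measureU => //.
  exact: setDIK.
have f1 : mu X \is a fin_num by exact: mu_cube_fin.
have f2 : mu ((c : set E) `\` X) \is a fin_num by rewrite setDE setIC; exact: mu_cube_fin.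
move: sum_mu big; rewrite -(fineK f1) -(fineK f2) -EFinD !lee_fin => -[]; lra.
Qed.

Let not_high (e : R) : (0 < e)%R -> exists h : R, (0 < h)%R /\
  forall c, (0 < side c)%R ->
   mu (c `&` [set x | h <= Num.max 0 (phi x - log_mean c)]%R) <= (e * side c ^+ n)%:E.
Proof.
move=> e0; exists ((1 + CL) / m / e)%R.
have K0 : (0 < (1 + CL) / m)%R by rewrite divr_gt0// addr_gt0.
have h0 : (0 < (1 + CL) / m / e)%R by rewrite divr_gt0.
split => // c c0; apply: (lee_mul_cancel h0).
have mm : measurable_fun setT (fun x => Num.max 0 (phi x - log_mean c))%R by mfun.
apply: le_trans (mu_level_le (mc c) mm (ltW h0) _) _.
  by move=> x; rewrite le_max lexx.
apply: le_trans (upper_oscillation c0) _; rewrite lee_fin mulrA divfK// gt_eqF//.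
Qed.

Lemma bernoulli_le (x : R) k : (0 <= x <= 1)%R -> (1 - k%:R * x <= (1 - x) ^+ k)%R.
Proof.
move=> /andP[x0 x1]; elim: k => [|k ih]; first by rewrite mul0r expr0; lra.
rewrite exprS -natr1; have x1' : (0 <= 1 - x)%R by lra.
have := ler_wpM2l x1' ih; have : (0 <= k%:R * x * x)%R by rewrite !mulr_ge0.
lra.
Qed.

(** The intervals that interpolate linearly between a half of an interval and the
whole of it are nested. *)
Let interp (o dk l q u z : R) : (0 <= u)%R -> (0 <= dk)%R -> (dk <= l)%R ->
  (o - q * dk <= z)%R -> (z < o - q * dk + l * (1 + q))%R ->
  (o - (q + u) * dk <= z < o - (q + u) * dk + l * (1 + (q + u)))%R.
Proof.
move=> u0 d0 dl h1 h2; have := mulr_ge0 u0 d0; have := ler_wpM2l u0 dl.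
by move=> ? ?; apply/andP; split; lra.
Qed.

(** A thin shell around a cube has small relative volume, hence by absolute
continuity carries at most half of the mass of v; removing it changes Lam by at
most log 2 / m.  A child is joined to its parent by a fixed number of thin
shells. *)
Let log_mean_doubling : exists D : R, (0 < D)%R /\ forall c e, (0 < side c)%R ->
  (log_mean c <= log_mean (child c e) + D)%R.
Proof.
have e2 : (0 < 2^-1 :> R)%R by rewrite invr_gt0.
have [del [d0 hd]] := abs_cont e2.
have [j hj] : exists j : nat, (n%:R / j.+2%:R <= del)%R.
  exists (Num.truncn (n%:R / del)); rewrite ler_pdivrMr// mulrC -ler_pdivrMr//.
  by apply: ltW; apply: lt_trans (truncnS_gt _) _; rewrite ltr_nat.
have j0 : (0 < j.+1%:R :> R)%R by rewrite ltr0n.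
have l2 : (0 < ln 2 :> R)%R by rewrite ln_gt0// ltr1n.
have ji : (0 < j.+1%:R^-1 :> R)%R by rewrite invr_gt0.
have j1 : (0 < 1 + j.+1%:R^-1 :> R)%R by rewrite addr_gt0.
have step (P Q : hcube) : (0 < side P)%R -> (P : set E) `<=` Q ->
    (side P <= side Q)%R -> (side Q <= side P * (1 + j.+1%:R^-1))%R -> (Lam Q - ln 2 / m <= Lam P)%R.
  move=> P0 PQ sPQ sQP; have Q0 : (0 < side Q)%R by lra.
  have mD : measurable ((Q : set E) `\` P) by exact: measurableD.
  have mu_shell : mu ((Q : set E) `\` P) <= (del * side Q ^+ n)%:E.
    have f2 : mu ((Q : set E) `\` P) \is a fin_num by rewrite setDE setIC; exact: mu_cube_fin.
    have : mu P + mu ((Q : set E) `\` P) = mu Q.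
      by rewrite -[in RHS](setDUK PQ); apply/esym; apply: measureU => //; exact: setDIK.
    rewrite !mu_cube// -(fineK f2) -EFinD lee_fin => -[] eqQ.
    pose x : R := (1 - side P / side Q)%R.
    have x01 : (0 <= x <= 1)%R.
      rewrite /x; have : (side P / side Q <= 1)%R by rewrite ler_pdivrMr// mul1r.
      have : (0 <= side P / side Q)%R by rewrite divr_ge0 ?ltW.
      by move=> ? ?; apply/andP; split; lra.
    have xj : (x <= j.+2%:R^-1)%R.
      rewrite /x lerBlDr -lerBlDl ler_pdivlMr//.
      have -> : (1 - j.+2%:R^-1 = (1 + j.+1%:R^-1)^-1 :> R)%R.
        by rewrite -(natr1 j.+1); field; rewrite !gt_eqF//; lra.
      by rewrite mulrC ler_pdivrMr.
    have := bernoulli_le n x01.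
    have -> : (1 - x = side P / side Q)%R by rewrite /x; ring.
    rewrite expr_div_n ler_pdivlMr ?exprn_gt0// => hb.
    have : (n%:R * x <= del)%R by apply: le_trans hj; exact: ler_wpM2l.
    have Qn : (0 <= side Q ^+ n)%R by rewrite exprn_ge0// ltW.
    by move=> /(ler_wpM2r Qn); lra.
  have Jsmall := hd Q _ Q0 mD (@subDsetl _ _ _) mu_shell.
  have Jsum : modular p phi P (Lam Q) + modular p phi ((Q : set E) `\` P) (Lam Q) = 1.
    rewrite -(LamP Q0) /modular -(int_setU mu (mc P) mD
      (measurable_modular mp mphi (Lam Q)) (fun x => expR_ge0 _) (setDIK _ _)).
    by rewrite setDUK.
  have := modular_lower mp m0 pm mphi (mc P) (a := Lam P) (b := Lam Q) (k := 2^-1%R).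
  rewrite LamP// lnV ?posrE// mulNr; apply => //; last by apply/andP; split; lra.
  have := modular_ge0 p phi P (Lam Q); have := modular_ge0 p phi ((Q : set E) `\` P) (Lam Q).
  move: Jsum Jsmall; case: (modular p phi P _) => [x||];
    case: (modular p phi ((Q : set E) `\` P) _) => [y||] //=.
  rewrite -EFinD !lee_fin => -[xy]; lra.
exists (j.+1%:R * (ln 2 / m))%R; split; first by rewrite mulr_gt0// divr_gt0.
move=> c e c0; set P := child c e; have P0 : (0 < side P)%R by exact: child_side_gt0.
(* the cubes interpolating linearly between the child, i = 0, and c, i = j.+1 *)
pose Pj i : hcube := Hcube (fun k => origin P k - i%:R / j.+1%:R * (origin P k - origin c k))%R
  (side P * (1 + i%:R / j.+1%:R))%R.
have Pj0 i : (0 < side (Pj i))%R.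
  by rewrite /= mulr_gt0// ltr_pwDl// divr_ge0.
have chain i : (Lam (Pj i) <= Lam P + i%:R * (ln 2 / m))%R.
  elim: i => [|i ih].
    rewrite mul0r addr0; apply: (lnorm_mono n_gt0 mp m0 pm mphi LamP) => //.
    by move=> x Px k; have := Px k; rewrite /= !mul0r subr0 addr0 mulr1.
  have u0 : (0 <= i%:R / j.+1%:R :> R)%R by rewrite divr_ge0.
  have uS : (i.+1%:R / j.+1%:R = i%:R / j.+1%:R + j.+1%:R^-1 :> R)%R.
    by rewrite -natr1 mulrDl mul1r.
  have incl : (Pj i : set E) `<=` Pj i.+1.
    move=> x Px k; have /andP[h1 h2] := Px k.
    have [d0k d1k] : (0 <= origin P k - origin c k /\ origin P k - origin c k <= side P)%R.
      have -> : (origin P k - origin c k = (e k)%:R * (side c / 2))%R by rewrite /P/=; ring.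
      by case: (e k); rewrite /P/= ?mulr1n ?mulr0n; split; lra.
    have := interp (ltW ji) d0k d1k h1 h2.
    by rewrite -uS.
  have h1 : (side (Pj i) <= side (Pj i.+1))%R.
    by rewrite /Pj [side _]/= [in leRHS]/= uS; apply: ler_wpM2l; [exact: ltW|by rewrite lerD2l lerDl ltW].
  have h2 : (side (Pj i.+1) <= side (Pj i) * (1 + j.+1%:R^-1))%R.
    have -> : side (Pj i.+1) = (side P * (1 + (i%:R / j.+1%:R + j.+1%:R^-1)))%R.
      by rewrite /Pj [side _]/= uS.
    have -> : (side (Pj i) * (1 + j.+1%:R^-1) =
        side P * ((1 + i%:R / j.+1%:R) * (1 + j.+1%:R^-1)))%R by rewrite [RHS]mulrA.
    apply: ler_wpM2l; first exact: ltW.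
    by move: (mulr_ge0 u0 (ltW ji)); set a := (i%:R / _)%R; set b := (_^-1)%R; lra.
  have := step (Pj i) (Pj i.+1) (Pj0 i) incl h1 h2.
  by rewrite -(natr1 i); lra.
have cP : (Lam c <= Lam (Pj j.+1))%R.
  apply: (lnorm_mono n_gt0 mp m0 pm mphi LamP) => // x cx k; have := cx k.
  rewrite [origin (Pj _) k]/= [side (Pj _)]/= divff ?gt_eqF// mul1r => /andP[h1 h2].
  by apply/andP; split; lra.
have nuc : (nu P <= nu c)%R by apply: (lnorm_mono n_gt0 mp m0 pm mz nuP) => //; exact: child_sub.
have := chain j.+1; rewrite /log_mean; lra.
Qed.

(** A cube is bad when the set phi <= t fills more than the proportion [al] of it;
then t > T - g there.  If a cube is not bad but one of its children is, the
doubling of T puts t + A far above its own T, so that phi <= t + A on almost all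
of it while phi <= t holds on a proportion at most [al].  Stopping at such cubes
exhausts the set phi <= t by the weak density theorem. *)
Let decay : exists g A th : R, [/\ (0 < g)%R, (0 < A)%R, (0 <= th < 1)%R &
  forall c (t : R), (0 < side c)%R -> (t <= log_mean c - g)%R ->
    mu (sub_lev t `&` c) <= th%:E * mu (sub_lev (t + A) `&` c)].
Proof.
have [g [al [g0 al0 al1 lowP]]] := not_low.
have [D [D0 dbl]] := log_mean_doubling.
(* [th = al / (1 - (1 - al) / 2)] is the ratio of the two proportions *)
have e0 : (0 < (1 - al) / 2)%R by lra.
have [h [h0 highP]] := not_high e0.
pose th : R := (2 * al / (1 + al))%R.
have al1' : (0 < 1 + al)%R by lra.
have th0 : (0 <= th)%R by rewrite /th divr_ge0 ?(ltW al1')//; lra.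
have th1 : (th < 1)%R by rewrite /th ltr_pdivrMr//; lra.
exists g, (g + D + h)%R, th; split; [by []|lra|by rewrite th0 th1|].
move=> c t c0 tc; pose bad (P : hcube) := ~ (mu (sub_lev t `&` P) <= (al * side P ^+ n)%:E).
have not_bad (P : hcube) : (0 < side P)%R -> (t <= log_mean P - g)%R -> ~ bad P.
  move=> P0 tP; apply; apply: le_trans (lowP P P0); apply: mu_le => x [xt Px].
  by split => //; exact: le_trans xt tP.
have mS (c' : hcube) t' : measurable (sub_lev t' `&` c') by apply: measurableI; [exact: msub|exact: mc].
have crossing (P : hcube) e : (0 < side P)%R -> ~ bad P -> bad (child P e) ->
    mu (sub_lev t `&` P) <= th%:E * mu (sub_lev (t + (g + D + h)) `&` P).
  move=> P0 nbP be; have Pn : (0 < side P ^+ n)%R by rewrite exprn_gt0.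
  have te : (log_mean (child P e) - g < t)%R.
    rewrite ltNge; apply/negP => h1; exact: not_bad (child_side_gt0 e P0) h1 be.
  have tP : (log_mean P + h < t + (g + D + h))%R by have := dbl P e P0; lra.
  have big : ((1 - (1 - al) / 2) * side P ^+ n)%:E <= mu (sub_lev (t + (g + D + h)) `&` P).
    have : mu P <= mu (sub_lev (t + (g + D + h)) `&` P) +
        mu (P `&` [set x | h <= Num.max 0 (phi x - log_mean P)]%R).
      apply: le_trans (mu_setU _ _); apply: mu_le => x Px.
      have [xt|xt] := leP (phi x) (t + (g + D + h))%R; [by left|right].
      split => //=; rewrite le_max; apply/orP; right; lra.
    rewrite mu_cube// => /le_trans/(_ (leeD2l _ (highP P P0))).
    rewrite -leeBlDr// -EFinB; apply: le_trans; rewrite lee_fin; lra.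
  have : mu (sub_lev t `&` P) <= (al * side P ^+ n)%:E by apply: contrapT.
  move=> /le_trans; apply.
  apply: le_trans (lee_wpmul2l _ big); last by rewrite lee_fin.
  rewrite -EFinM lee_fin /th le_eqVlt; apply/orP; left; apply/eqP; field.
  by rewrite gt_eqF.
have nbc : ~ bad c by exact: not_bad.
have fin_decay K (P : hcube) : (0 < side P)%R -> ~ bad P ->
    mu (sub_lev t `&` stopped bad K P) <= th%:E * mu (sub_lev (t + (g + D + h)) `&` P).
  elim: K P => [|K ih] P P0 nbP.
    by rewrite stopped0// setI0 measure0 mule_ge0.
  have [[e be]|nbe] := pselect (exists e, bad (child P e)).
    apply: le_trans (crossing P e P0 nbP be); apply: mu_le; apply: setIS.
    exact: stopped_sub.
  rewrite stoppedS// (mu_children n_gt0 P (msub _)) ge0_sume_distrr//.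
  rewrite big_distrr/=.
  apply: (@le_trans _ _ (\sum_(e : corner) mu (sub_lev t `&` stopped bad K (child P e)))).
    elim/big_ind2 : _ => //; first by rewrite measure0.
    by move=> X x Y y Xx Yy; apply: le_trans (mu_setU _ _) (leeD Xx Yy).
  apply: lee_sum => e _; apply: ih; first exact: child_side_gt0.
  by move=> be; apply: nbe; exists e.
pose S := \bigcup_K stopped bad K c.
have mst K : measurable (stopped bad K c) by exact: measurable_stopped.
have mSS : measurable S by exact: bigcup_measurable.
have rest : mu ((sub_lev t `\` S) `&` c) = 0.
  apply: (null_of_density n_gt0 (al := al)) => //; first exact: measurableD.
  move=> u; set P := desc c u; have P0 : (0 < side P)%R by exact: desc_side_gt0.
  have [b|b] := pselect (bad P).
    have -> : (sub_lev t `\` S) `&` P = set0.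
      apply/seteqP; split => // x [[_ nS] Px]; apply: nS.
      by exists (size u) => //; exact: desc_stopped b _ Px.
    by rewrite measure0 mule_ge0// lee_fin ltW.
  rewrite mu_cube// -EFinM; apply: (@le_trans _ _ (mu (sub_lev t `&` P))); last exact: contrapT.
  by apply: mu_le => x [[]].
have main : mu (sub_lev t `&` S) <= th%:E * mu (sub_lev (t + (g + D + h)) `&` c).
  have cv : mu (sub_lev t `&` stopped bad K c) @[K --> \oo] --> mu (sub_lev t `&` S).
    rewrite /S setI_bigcupr; apply: nondecreasing_cvg_mu.
    - by move=> K; apply: measurableI; [exact: msub|exact: mst].
    - by apply: bigcup_measurable => K _; apply: measurableI; [exact: msub|exact: mst].
    - by move=> K K' KK'; apply/subsetPset; apply: setIS; exact: le_stopped.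
  rewrite -(cvg_lim _ cv)//; apply: lime_le; first by apply/cvg_ex; eexists; exact: cv.
  by apply: nearW => K; exact: fin_decay.
apply: le_trans main; rewrite -[leRHS]add0e -rest.
apply: le_trans (mu_setU _ _); apply: mu_le => x [xt cx].
by have [Sx|Sx] := pselect (S x); [right|left].
Qed.

(** Iterating the decay from the level T(Q) - g downwards bounds the distribution
function of T(Q) - phi by a geometric sequence. *)
Theorem lower_oscillation : exists C : R, (0 <= C)%R /\ forall c, (0 < side c)%R ->
  \int[mu]_(x in cube_set c) (Num.max 0 (log_mean c - phi x))%:E <= (C * side c ^+ n)%:E.
Proof.
have [g [A [th [g0 A0 /andP[th0 th1] dec]]]] := decay.
have th1' : (0 < 1 - th)%R by lra.
exists (g + A / (1 - th))%R; split; first by rewrite addr_ge0 ?(ltW g0)// divr_ge0// ltW.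
move=> c c0; pose t k : R := (log_mean c - g - k%:R * A)%R.
have cn : (0 < side c ^+ n)%R by rewrite exprn_gt0.
have level k : mu (sub_lev (t k) `&` c) <= (th ^+ k * side c ^+ n)%:E.
  elim: k => [|k ih].
    by rewrite expr0 mul1r -mu_cube//; apply: mu_le; exact: subIsetr.
  have tk : (t k.+1 <= log_mean c - g)%R by rewrite /t gerBl mulr_ge0// ltW.
  apply: le_trans (dec c (t k.+1) c0 tk) _.
  rewrite (_ : t k.+1 + A = t k)%R; last by rewrite /t -natr1; ring.
  by rewrite exprS -mulrA EFinM; apply: lee_wpmul2l.
pose u k x : R := (A * \1_(sub_lev (t k)) x)%R.
have mi k : measurable_fun setT (\1_(sub_lev (t k)) : E -> R) by exact: measurable_indic.
have mu_ k : measurable_fun setT (u k) by apply: measurable_funM.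
have u0 k x : (0 <= u k x)%R by rewrite mulr_ge0// ltW.
have S0 x : 0 <= \sum_(k <oo) (u k x)%:E by apply: nneseries_ge0 => k _ _; rewrite lee_fin.
have mS : measurable_fun (cube_set c) (fun x => \sum_(k <oo) (u k x)%:E).
  apply: ge0_emeasurable_sum => k; first by move=> x _ _; rewrite lee_fin.
  by move=> _; exact: measurable_EFinT.
have pw x : (Num.max 0 (log_mean c - phi x))%:E <= g%:E + \sum_(k <oo) (u k x)%:E.
  have [h|h] := leP (log_mean c - phi x)%R g.
    apply: (@le_trans _ _ g%:E); last exact: leeDl.
    by rewrite lee_fin ge_max h ltW.
  have y0 : (0 < log_mean c - phi x - g)%R by lra.
  have [k /andP[k1 k2]] := ladder A0 y0.
  apply: (@le_trans _ _ (g%:E + (k.+1%:R * A)%:E)).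
    rewrite -EFinD lee_fin ge_max; apply/andP; split; lra.
  apply: leeD => //; apply: le_trans (nneseries_lim_ge k.+1 _); last first.
    by move=> j _ _; rewrite lee_fin.
  rewrite big_mkord sumEFin lee_fin (eq_bigr (fun=> A)).
    by rewrite sumr_const card_ord mulr_natl.
  move=> j _; rewrite /u indicE mem_set ?mulr1//= /sub_lev /t/=.
  have : (j%:R * A <= k%:R * A)%R by apply: ler_wpM2r; [exact: ltW|rewrite ler_nat -ltnS].
  lra.
apply: (@le_trans _ _ (\int[mu]_(x in cube_set c) (g%:E + \sum_(k <oo) (u k x)%:E))).
  apply: ge0_le_integral.
  - exact: mc.
  - by move=> x _; rewrite lee_fin le_max lexx.
  - by apply: measurable_EFinT; mfun.
  - by apply: emeasurable_funD.
  - by move=> x _; exact: pw.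
rewrite (ge0_integralD mu (mc c) _ _ (fun x _ => S0 x) mS); last 2 first.
- by move=> x _; rewrite lee_fin ltW.
- exact: measurable_cst.
rewrite mulrDl EFinD; apply: leeD; first by rewrite int_const// mu_cube// EFinM.
rewrite integral_nneseries; first last.
- by move=> k x _; rewrite lee_fin.
- by move=> k; exact: measurable_EFinT.
- exact: mc.
apply: (@le_trans _ _ (\sum_(k <oo) (A * (th ^+ k * side c ^+ n))%:E)).
  apply: lee_nneseries => [k _ _|k _].
    by apply: integral_ge0 => x _; rewrite lee_fin.
  rewrite (intZ mu (mc c) (mi k) _ (ltW A0))// EFinM; apply: lee_wpmul2l.
    by rewrite lee_fin ltW.
  by apply: le_trans (level k); rewrite integral_indic.
apply: nneseries_le => [k|k].
  by apply: mulr_ge0; [exact: ltW|apply: mulr_ge0; [exact: exprn_ge0|exact: ltW]].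
rewrite (eq_bigr (fun i : 'I_k => (A * side c ^+ n) * th ^+ i)%R); last by move=> i _; ring.
rewrite -mulr_sumr [leRHS]mulrAC; apply: ler_wpM2l; first by apply: mulr_ge0; exact: ltW.
by apply: geometric_le; rewrite th0 th1.
Qed.

End from_gehring.
End lower.

(** * Luxemburg norms, arbitrary cubes and averages *)

Section luxemburg.
Variables (R : realType) (n : nat).
Hypothesis n_gt0 : (0 < n)%N.
Local Notation E := (euclidean R n).
Local Notation mu := (@lebesgue_n R n).
Local Notation hcube := (hcube R n).
Implicit Types (c : hcube).
Let mc c : measurable (c : set E). Proof. exact: measurable_cube. Qed.

(** Both cubes lie in the closed cube, and all three have the same measure. *)
Lemma cube_hcube (Q : set E) : cube Q -> exists c, [/\ (0 < side c)%R, measurable Q,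
  mu Q = mu c & {ae mu, forall x, Q x <-> (c : set E) x}].
Proof.
move=> [a [l [b [b' [l0 ->]]]]]; set Q' := [set x | _].
have [mQ muQ] := lebesgue_cube a b b' l0; rewrite -/Q' in mQ muQ.
have [mD muD] := lebesgue_cube a (fun=> true) (fun=> false) l0.
set D := [set x | _] in mD muD.
pose c : hcube := Hcube a l; exists c.
have muc : mu c = (l ^+ n)%:E by exact: mu_cube.
have QD : Q' `<=` D.
  move=> x Qx i; have := Qx i; rewrite !itv_boundlr => /andP[h1 h2].
  rewrite !bnd_simp in h1 h2 *.
  by case: (b i) (b' i) h1 h2 => -[]; rewrite !bnd_simp => ? ?; apply/andP; split; try exact: ltW.
have cD : (c : set E) `<=` D.
  by move=> x cx i; have /andP[? ?] := cx i; rewrite in_itv/=; apply/andP; split => //; exact: ltW.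
have null X : measurable X -> mu X = (l ^+ n)%:E -> X `<=` D -> mu (D `\` X) = 0.
  move=> mX muX XD.
  have : mu X + mu (D `\` X) = mu D.
    rewrite -[in RHS](setDUK XD); apply/esym; apply: measureU => //.
      exact: measurableD.
    exact: setDIK.
  rewrite muX muD; case: (mu (D `\` X)) => [r| |]//= -[h].
  by congr EFin; move: h; rewrite -[RHS]addr0 => /addrI.
split => //; first by rewrite muQ muc.
exists ((D `\` Q') `|` (D `\` c)); split.
- by apply: measurableU; apply: measurableD.
- apply/eqP; rewrite eq_le measure_ge0 andbT; apply: le_trans (mu_setU _ _) _.
  by rewrite !null// adde0.
- move=> x /= h; have [Dx|nDx] := pselect (D x); last first.
    by exfalso; apply: h; split => [/QD|/cD].
  apply: contrapT => nx; apply: h; split => [Qx|cx]; apply: contrapT => ?; apply: nx.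
    by right; split.
  by left; split.
Qed.

Lemma hcube_cube c : (0 < side c)%R -> cube (c : set E).
Proof.
move=> c0; exists (origin c), (side c), (fun=> true), (fun=> true); split => //.
Qed.

Lemma int_ae_set (Q : set E) c (f : E -> R) : measurable Q ->
  {ae mu, forall x, Q x <-> (c : set E) x} -> measurable_fun setT f ->
  \int[mu]_(x in Q) (f x)%:E = \int[mu]_(x in cube_set c) (f x)%:E.
Proof.
move=> mQ ae mf; rewrite [LHS]integral_mkcond [RHS]integral_mkcond.
apply: ae_eq_integral => //.
- by apply/(measurable_restrictT _ mQ); exact: measurable_EFinT.
- by apply/(measurable_restrictT _ (mc c)); exact: measurable_EFinT.
apply: filterS ae => x Qc _; rewrite !patchE.
by congr (if _ then _ else _); apply/idP/idP; rewrite !inE => /Qc.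
Qed.

(** Only almost everywhere information on f is used; completeness of the measure
supplies the measurability of the integrand. *)
Lemma vnorm_modular (q : E -> R) (f phi : E -> R) c : measurable_fun setT q ->
  (forall x, 0 < q x)%R -> measurable_fun setT phi ->
  {ae mu, forall x, f x = (\1_(c : set E) x * expR (phi x))%R} ->
  vnorm q f = ereal_inf [set l%:E | l in [set l : R | (0 < l)%R /\ modular q phi c (ln l) <= 1]].
Proof.
move=> mq q0 mphi ae; rewrite /vnorm; congr ereal_inf.
suff main l : (0 < l)%R -> \int[mu]_x ((`|f x / l| `^ q x)%R)%:E = modular q phi c (ln l).
  by apply/seteqP; split => _ [l [l0 hl] <-]; exists l => //; split => //; rewrite ?main// -main.
move=> l0; rewrite /modular [RHS]integral_mkcond.
have mr : measurable_fun setT ((fun x => (expR (q x * (phi x - ln l)))%:E) \_ (c : set E)).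
  by apply/(measurable_restrictT _ (mc c)); apply: measurable_EFinT; mfun.
have aeq : ae_eq mu setT ((fun x => (expR (q x * (phi x - ln l)))%:E) \_ (c : set E))
    (fun x => ((`|f x / l| `^ q x)%R)%:E).
  apply: filterS ae => x fx _; rewrite fx patchE indicE.
  have [cx|ncx] := boolP (x \in (c : set E)).
    rewrite mul1r ger0_norm ?divr_ge0 ?expR_ge0 ?(ltW l0)//.
    rewrite -[in RHS](lnK l0) -expRN -expRD /powR gt_eqF ?expR_gt0// expRK.
    by rewrite mulrC.
  by rewrite mul0r mul0r normr0 powR0// gt_eqF.
apply/esym; apply: ge0_ae_eq_integral => //.
- exact: (ae_measurable_fun (@lebesgue_n_complete R n) aeq mr).
- by move=> x _; rewrite patchE; case: ifP => // _; rewrite lee_fin expR_ge0.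
Qed.

Section bounded_exponent.
Variables (p : E -> R) (m M : R).
Hypotheses (mp : measurable_fun setT p) (m0 : (0 < m)%R)
  (pm : forall x, (m <= p x)%R) (pM : forall x, (p x <= M)%R).
Variables (phi : E -> R) (mphi : measurable_fun setT phi).
Local Notation J := (modular p phi).

Let p0 x : (0 < p x)%R. Proof. exact: lt_le_trans m0 (pm x). Qed.

Lemma modular_gt0 c a : (0 < side c)%R -> 0 < J c a.
Proof.
move=> c0; rewrite lt_neqAle modular_ge0 andbT; apply/negP => /eqP J0.
have mJ := measurable_modular mp mphi a.
have := ae_eq_integral_abs mu (mc c) (measurable_EFinT mJ).
rewrite (eq_integral (fun x => (expR (p x * (phi x - a)))%:E)); last first.
  by move=> x _; rewrite gee0_abs// lee_fin expR_ge0.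
rewrite -/(modular _ _ _ _) -J0 => -[/(_ erefl)[N [mN N0 sub]] _].
have : mu c <= mu N.
  apply: mu_le => x cx; apply: sub => /= /(_ cx) [h].
  by have := expR_gt0 (p x * (phi x - a)); rewrite h ltxx.
rewrite (_ : mu N = 0)// mu_cube// lee_fin leNgt.
by rewrite exprn_gt0.
Qed.

(** The modular is decreasing and continuous in its parameter by the two shift
estimates, hence equals 1 at the infimum of the parameters where it is at most
1. *)
Lemma modular_solve c : (0 < side c)%R -> (exists a, J c a <= 1) -> exists a, J c a = 1.
Proof.
move=> c0 [a1 Ja1]; have M0 : (0 < M)%R := lt_le_trans (p0 point) (pM point).
pose S : set R := [set a | J c a <= 1].
have [j [j0 jE]] : exists j : R, (0 < j)%R /\ J c a1 = j%:E.
  have := modular_gt0 a1 c0; move: Ja1; case: (J c a1) => [r| |]//; by exists r.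
have lbS : has_lbound S.
  exists (a1 + ln j / m)%R => a /= Ja.
  apply: (modular_lower mp m0 pm mphi (mc c) Ja); first by rewrite jE.
  by rewrite j0 -lee_fin -jE.
have hS : has_inf S by split => //; exists a1.
exists (inf S); apply/eqP; rewrite eq_le; apply/andP; split.
  apply/lee_addgt0Pr => e e0.
  have l0 : (0 < ln (1 + e) / M)%R by rewrite divr_gt0// ln_gt0//; lra.
  have [a Sa aS] := inf_adherent l0 hS.
  have d0 : (0 <= a - inf S)%R by rewrite subr_ge0; exact: ge_inf.
  have := modular_shift_ge mp pM mphi (inf S) (mc c) d0.
  rewrite (_ : inf S + (a - inf S) = a)%R; last by ring.
  move=> /le_trans; apply; apply: le_trans (lee_wpmul2l _ (Sa : J c a <= 1)) _.
    by rewrite lee_fin expR_ge0.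
  rewrite mule1 -EFinD lee_fin -[leRHS]lnK ?posrE ?ler_expR; last lra.
  by rewrite mulrC -ler_pdivlMr//; lra.
rewrite leNgt; apply/negP => J1.
have [k [k0 kE]] : exists k : R, (0 < k)%R /\ J c (inf S) = k%:E.
  have := modular_gt0 (inf S) c0; move: J1; case: (J c (inf S)) => [r| |]//; by exists r.
have k1 : (k < 1)%R by rewrite -lte_fin -kE.
have lk : (0 < - ln k / M)%R by rewrite divr_gt0// oppr_gt0 ln_lt0// k0.
have := modular_shift_ge mp pM mphi (inf S - - ln k / M) (mc c) (ltW lk).
have lkM : (M * (- ln k / M) = - ln k)%R by field; rewrite gt_eqF.
rewrite subrK kE lkM expRN lnK ?posrE// -EFinM mulVf ?gt_eqF// => Jm.
have : (inf S <= inf S - - ln k / M)%R by exact: ge_inf.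
lra.
Qed.

Lemma vnorm_expR (f : E -> R) c a : (0 < side c)%R ->
  {ae mu, forall x, f x = (\1_(c : set E) x * expR (phi x))%R} ->
  J c a = 1 -> vnorm p f = (expR a)%:E.
Proof.
move=> c0 ae Ja; rewrite (vnorm_modular mp p0 mphi ae); apply/eqP; rewrite eq_le.
apply/andP; split.
  apply: ereal_inf_lbound; exists (expR a) => //; split; first exact: expR_gt0.
  by rewrite expRK Ja.
apply: le_ereal_inf_tmp => _ [l [l0 Jl] <-]; rewrite lee_fin -[leRHS]lnK// ler_expR.
have := modular_upper_large mp m0 pm mphi (mc c) (a := a) (b := ln l) (k := 1%R).
by rewrite ln1 mul0r addr0 Ja; apply.
Qed.

Lemma vnorm_lty (f : E -> R) c : (0 < side c)%R ->
  {ae mu, forall x, f x = (\1_(c : set E) x * expR (phi x))%R} ->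
  vnorm p f < +oo -> exists a, J c a = 1.
Proof.
move=> c0 ae; rewrite (vnorm_modular mp p0 mphi ae) => /ereal_inf_lt[_ [l [l0 Jl] <-] _].
by apply: modular_solve => //; exists (ln l).
Qed.

Lemma vnorm_le (f : E -> R) c a :
  {ae mu, forall x, f x = (\1_(c : set E) x * expR (phi x))%R} ->
  J c a <= 1 -> vnorm p f <= (expR a)%:E.
Proof.
move=> ae Ja; rewrite (vnorm_modular mp p0 mphi ae).
apply: ereal_inf_lbound; exists (expR a) => //; split; first exact: expR_gt0.
by rewrite expRK.
Qed.

Lemma vnorm_lt (f : E -> R) c a :
  {ae mu, forall x, f x = (\1_(c : set E) x * expR (phi x))%R} ->
  vnorm p f < (expR a)%:E -> J c a <= 1.
Proof.
move=> ae; rewrite (vnorm_modular mp p0 mphi ae) => /ereal_inf_lt[_ [l [l0 Jl] <-]].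
rewrite lte_fin => la; have d0 : (0 <= a - ln l)%R.
  by rewrite subr_ge0 -[leRHS]expRK ler_ln ?posrE ?expR_gt0// ltW.
have := modular_shift_le mp pm mphi (ln l) (mc c) d0.
rewrite (_ : ln l + (a - ln l) = a)%R; last by ring.
move=> /le_trans; apply; apply: le_trans (lee_wpmul2l _ Jl) _; first by rewrite lee_fin expR_ge0.
by rewrite mule1 lee_fin expR_le1 oppr_le0 mulr_ge0// ltW.
Qed.

End bounded_exponent.

Let ereal_real (X : \bar R) (r : R) : 0 <= X -> X <= r%:E -> exists x : R, X = x%:E.
Proof. by case: X => [x| |]// _ _; exists x. Qed.

(** Integrates the pointwise identity between the positive and negative parts of
T - f, f and T, in a form whose terms are all nonnegative: the integral of the
positive part of - f is allowed to be infinite here. *)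
Let signed_parts c (f : E -> R) (T C1 : R) : (0 < side c)%R -> measurable_fun setT f ->
  \int[mu]_(x in cube_set c) (Num.max 0 (f x - T))%:E <= (C1 * side c ^+ n)%:E ->
  exists G B : R, [/\ (0 <= G)%R, (G <= C1 * side c ^+ n)%R,
    \int[mu]_(x in cube_set c) (- f x)%:E =
    \int[mu]_(x in cube_set c) (Num.max 0 (- f x))%:E - B%:E &
    \int[mu]_(x in cube_set c) (Num.max 0 (T - f x))%:E + (B + Num.max 0 (- T) * side c ^+ n)%:E =
    \int[mu]_(x in cube_set c) (Num.max 0 (- f x))%:E + (G + Num.max 0 T * side c ^+ n)%:E].
Proof.
move=> c0 mf hG; have V0 : (0 <= side c ^+ n)%R by rewrite exprn_ge0// ltW.
have mx (g : E -> R) : measurable_fun setT g -> measurable_fun setT (fun x => Num.max 0 (g x))%R.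
  by move=> ?; mfun.
have mx0 (g : E -> R) x : (0 <= Num.max 0 (g x))%R by rewrite le_max lexx.
have m1 : measurable_fun setT (fun x => f x - T)%R by mfun.
have m2 : measurable_fun setT (fun x => T - f x)%R by mfun.
have m3 : measurable_fun setT (fun x => - f x)%R by mfun.
have i0 (g : E -> R) : 0 <= \int[mu]_(x in cube_set c) (Num.max 0 (g x))%:E.
  by apply: integral_ge0 => x _; rewrite lee_fin.
have k0 (k : R) : (0 <= Num.max 0 k)%R by rewrite le_max lexx.
have mk (k : R) : measurable_fun setT (fun _ : E => Num.max 0 k)%R by exact: measurable_cst.
have ik (k : R) : \int[mu]_(x in cube_set c) (Num.max 0 k)%:E = (Num.max 0 k * side c ^+ n)%:E.
  by rewrite int_const// mu_cube.
have [G GE] := ereal_real (i0 (fun x => f x - T)%R) hG.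
have hB : \int[mu]_(x in cube_set c) (Num.max 0 (f x))%:E <= (G + Num.max 0 T * side c ^+ n)%:E.
  rewrite EFinD -GE -ik -(intD mu (mc c) (mx _ m1) (mk T) (fun x _ => mx0 _ x) (fun _ _ => k0 T)).
  apply: (le_int mu (mc c) (mx _ mf)).
  - by apply: measurable_funD; [exact: mx|exact: mk].
  - by move=> x _.
  - move=> x _; rewrite ge_max; apply/andP; split; first exact: addr_ge0.
    have : (f x - T <= Num.max 0 (f x - T))%R by rewrite le_max lexx orbT.
    have : (T <= Num.max 0 T)%R by rewrite le_max lexx orbT.
    lra.
have [B BE] := ereal_real (i0 f) hB.
exists G, B; split.
- by rewrite -lee_fin -GE.
- by rewrite -lee_fin -GE.
- rewrite integralE -BE; congr (_ - _); apply: eq_integral => x _.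
    by rewrite funeposE -EFin_max maxC.
  by rewrite funenegE -EFinN -EFin_max opprK maxC.
rewrite !EFinD -BE -GE -!ik.
rewrite -(intD mu (mc c) (mx _ mf) (mk _) (fun x _ => mx0 _ x) (fun _ _ => k0 _)).
rewrite -(intD mu (mc c) (mx _ m1) (mk _) (fun x _ => mx0 _ x) (fun _ _ => k0 _)).
have m4 (g : E -> R) (k : R) : measurable_fun setT g ->
    measurable_fun setT (fun x => Num.max 0 (g x) + Num.max 0 k)%R.
  by move=> mg; apply: measurable_funD; [exact: mx|exact: mk].
have s0 (g : E -> R) (k : R) x : (0 <= Num.max 0 (g x) + Num.max 0 k)%R by rewrite addr_ge0.
rewrite -(intD mu (mc c) (mx _ m2) (m4 _ _ mf) (fun x _ => mx0 _ x) (fun x _ => s0 _ _ x)).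
rewrite -(intD mu (mc c) (mx _ m3) (m4 _ _ m1) (fun x _ => mx0 _ x) (fun x _ => s0 _ _ x)).
apply: eq_integral => x _; congr EFin.
have maxE (a : R) : (Num.max 0 a = (a + `|a|) / 2)%R.
  by have [h|h] := leP 0%R a; [rewrite ger0_norm//|rewrite ltr0_norm//]; field.
by rewrite !maxE normrN [in RHS]distrC normrN; field.
Qed.

(** An upper bound for the average of - f excludes an infinite positive part,
after which the identity between the parts can be solved. *)
Lemma average_upper c (f : E -> R) (T C1 K : R) : (0 < side c)%R -> measurable_fun setT f ->
  \int[mu]_(x in cube_set c) (Num.max 0 (f x - T))%:E <= (C1 * side c ^+ n)%:E ->
  ((side c ^+ n)^-1)%:E * \int[mu]_(x in cube_set c) (- f x)%:E <= K%:E ->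
  \int[mu]_(x in cube_set c) (Num.max 0 (T - f x))%:E <= ((T + K + C1) * side c ^+ n)%:E.
Proof.
move=> c0 mf hG; have [G [B [G0 GC -> id]]] := signed_parts c0 mf hG.
have V0 : (0 < side c ^+ n)%R by rewrite exprn_gt0.
have A0 : 0 <= \int[mu]_(x in cube_set c) (Num.max 0 (- f x))%:E.
  by apply: integral_ge0 => x _; rewrite lee_fin le_max lexx.
move: A0 id; case: (\int[mu]_(x in cube_set c) (Num.max 0 (- f x))%:E) => [A| |]//.
- case: (\int[mu]_(x in _) _) => [X| |]//= _; rewrite -!EFinD => -[id].
  rewrite -EFinM !lee_fin mulrC ler_pdivrMr// => hK.
  have TE : (Num.max 0 T - Num.max 0 (- T) = T)%R.
    by have [h|h] := leP 0%R T; have [h'|h'] := leP 0%R (- T)%R; lra.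
  have : ((Num.max 0 T - Num.max 0 (- T)) * side c ^+ n = T * side c ^+ n)%R by rewrite TE.
  lra.
- by move=> _ _; rewrite /= gt0_muley ?lte_fin ?invr_gt0.
Qed.

Lemma average_lower c (f : E -> R) (T C1 C : R) : (0 < side c)%R -> measurable_fun setT f ->
  \int[mu]_(x in cube_set c) (Num.max 0 (f x - T))%:E <= (C1 * side c ^+ n)%:E ->
  \int[mu]_(x in cube_set c) (Num.max 0 (T - f x))%:E <= (C * side c ^+ n)%:E ->
  ((side c ^+ n)^-1)%:E * \int[mu]_(x in cube_set c) (- f x)%:E <= (C - T)%:E.
Proof.
move=> c0 mf hG hC; have [G [B [G0 GC -> id]]] := signed_parts c0 mf hG.
have V0 : (0 < side c ^+ n)%R by rewrite exprn_gt0.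
have A0 : 0 <= \int[mu]_(x in cube_set c) (Num.max 0 (- f x))%:E.
  by apply: integral_ge0 => x _; rewrite lee_fin le_max lexx.
move: A0 id hC; case: (\int[mu]_(x in cube_set c) (Num.max 0 (- f x))%:E) => [A| |]//.
- case: (\int[mu]_(x in _) _) => [X| |]//= _; rewrite -!EFinD => -[id] hK.
  move: hK; rewrite -EFinM !lee_fin => hK; rewrite [leLHS]mulrC ler_pdivrMr//.
  have TE : (Num.max 0 T - Num.max 0 (- T) = T)%R.
    by have [h|h] := leP 0%R T; have [h'|h'] := leP 0%R (- T)%R; lra.
  have : ((Num.max 0 T - Num.max 0 (- T)) * side c ^+ n = T * side c ^+ n)%R by rewrite TE.
  lra.
- by case: (\int[mu]_(x in _) _).
Qed.

End luxemburg.

(** * Lower bound for the exponent *)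

Section exponent_bound.
Variables (R : realType) (n : nat).
Hypothesis n_gt0 : (0 < n)%N.
Local Notation E := (euclidean R n).
Local Notation mu := (@lebesgue_n R n).

(** By continuity, if p takes a value below m, then it stays below m on a small
cube, which is not a null set. *)
Lemma log_Hoelder_ess_inf (p : E -> R) (C0 : R) : (0 < C0)%R ->
  (forall x y, (Defs.edist x y < 2^-1)%R -> (`|p x - p y| <= - (C0 / ln (Defs.edist x y)))%R) ->
  0 < ess_inf mu (fun x => (p x)%:E) -> exists m : R, (0 < m)%R /\ forall x, (m <= p x)%R.
Proof.
move=> C00 LH p0.
have [m [m0 aem]] : exists m : R, (0 < m)%R /\ {ae mu, forall x, (m <= p x)%R}.
  case E0 : (ess_inf mu (fun x => (p x)%:E)) p0 => [r| |]// => [r0|_].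
    exists r; split; first by rewrite -lte_fin.
    by apply: filterS (ess_inf_le mu (fun x => (p x)%:E)) => x; rewrite E0 lee_fin.
  exists 1%R; split => //.
  by apply: filterS (ess_inf_le mu (fun x => (p x)%:E)) => x; rewrite E0.
exists m; split => // x; rewrite leNgt; apply/negP => pxm.
pose e : R := (m - p x)%R; have e0 : (0 < e)%R by rewrite /e; lra.
have ce : (0 < C0 / e)%R by rewrite divr_gt0.
(* within this distance of x the local condition yields an oscillation below e *)
pose d : R := expR (- (C0 / e + 1)).
have d0 : (0 < d)%R := expR_gt0 _.
have d2 : (d < 2^-1)%R.
  rewrite /d expRN ltf_pV2 ?posrE ?expR_gt0//.
  have := expR_ge1Dx (C0 / e + 1)%R; lra.
have nR : (0 < n%:R :> R)%R by rewrite ltr0n.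
pose c : hcube R n := Hcube (coordinate x) (d / n%:R)%R.
have c0 : (0 < side c)%R by rewrite /= divr_gt0.
have cx : (c : set E) x by move=> i; rewrite lexx/= ltrDl.
have near y : (c : set E) y -> (p y < m)%R.
  move=> cy; have dy := edist_cube n_gt0 c0 cx cy.
  have {}dy : (Defs.edist x y <= d)%R by move: dy; rewrite /= mulrC divfK// gt_eqF.
  have := LH x y (le_lt_trans dy d2).
  have [->|dn] := eqVneq (Defs.edist x y) 0%R.
    by rewrite ln0// invr0 mulr0 oppr0 normr_le0 subr_eq0 => /eqP <-.
  have dp : (0 < Defs.edist x y)%R by rewrite lt_neqAle eq_sym dn sqrtr_ge0.
  have ld : (ln (Defs.edist x y) <= - (C0 / e + 1))%R.
    by rewrite -[leRHS]expRK ler_ln ?posrE.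
  have : (- (C0 / ln (Defs.edist x y)) < e)%R.
    have l0 : (0 < - ln (Defs.edist x y))%R by lra.
    rewrite -mulrN -invrN ltr_pdivrMr//.
    have : (e * (C0 / e + 1) <= e * - ln (Defs.edist x y))%R by apply: ler_wpM2l; lra.
    rewrite mulrDr mulrCA divff ?gt_eqF// mulr1; lra.
  move=> h1 h2; have := le_lt_trans h2 h1; rewrite ltr_norml /e => /andP[]; lra.
have [N [mN N0 sub]] := aem.
have : mu c <= mu N.
  by apply: mu_le => y cy; apply: sub => /= my; have := near y cy; rewrite ltNge my.
rewrite (_ : mu N = 0)// mu_cube// lee_fin leNgt exprn_gt0//.
Qed.

End exponent_bound.

(** * The two conditions in logarithmic form *)

Section main.
Variables (R : realType) (n : nat).
Hypothesis n_gt0 : (0 < n)%N.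
Local Notation E := (euclidean R n).
Local Notation mu := (@lebesgue_n R n).
Local Notation hcube := (hcube R n).
Variables (p : E -> R) (m M : R).
Hypotheses (mp : measurable_fun setT p) (m0 : (0 < m)%R)
  (pm : forall x, (m <= p x)%R) (pM : forall x, (p x <= M)%R).
Variable w : E -> R.
Hypothesis w_weight : scalar_weight w.
Let phi x := ln (w x).
Let mc (c : hcube) : measurable (c : set E). Proof. exact: measurable_cube. Qed.
Let mz : measurable_fun setT (fun _ : E => 0%R : R). Proof. exact: measurable_cst. Qed.

Let mphi : measurable_fun setT phi.
Proof.
by case: w_weight => mw _ _; exact: (measurableT_comp (@measurable_ln R) mw).
Qed.

Let weight_ae (Q : set E) (c : hcube) : {ae mu, forall x, Q x <-> (c : set E) x} ->
  {ae mu, forall x, (w \* \1_Q)%R x = (\1_(c : set E) x * expR (phi x))%R}.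
Proof.
move=> aeQ; case: w_weight => _ _ aew; apply: filterS2 aeQ aew => x Qc wx.
have e : (x \in Q) = (x \in (c : set E)) by apply/idP/idP; rewrite !inE => /Qc.
by rewrite /phi /= lnK// !indicE e mulrC.
Qed.

Let one_ae (Q : set E) (c : hcube) : {ae mu, forall x, Q x <-> (c : set E) x} ->
  {ae mu, forall x, (\1_Q : E -> R) x = (\1_(c : set E) x * expR 0)%R}.
Proof.
move=> aeQ; apply: filterS aeQ => x Qc; rewrite expR0 mulr1 !indicE.
by have -> : (x \in Q) = (x \in (c : set E)) by apply/idP/idP; rewrite !inE => /Qc.
Qed.

Let refl_ae (c : hcube) : {ae mu, forall x, (c : set E) x <-> (c : set E) x}.
Proof. exact: nearW. Qed.

(** The modular of 1_c is at most 1 at the parameter log |c| / m if it is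
nonnegative, and at 0 otherwise. *)
Lemma exists_unit_norm c : (0 < side c)%R -> exists a, modular p (fun=> 0%R) c a = 1.
Proof.
move=> c0; apply: (modular_solve n_gt0 mp m0 pm pM mz c0).
pose a : R := (Num.max 0 (lnvol c) / m)%R; exists a.
have a0 : (0 <= a)%R by rewrite /a divr_ge0 ?(ltW m0)// le_max lexx.
apply: le_trans (le_int_expR mu (k := - lnvol c)%R (mc c) (measurable_modular_arg mp mz a) mz _) _.
  move=> x _; have := ler_wpM2r a0 (pm x).
  have : (m * a = Num.max 0 (lnvol c))%R by rewrite /a mulrC divfK// gt_eqF.
  have : (lnvol c <= Num.max 0 (lnvol c))%R by rewrite le_max lexx orbT.
  lra.
rewrite int_const// expR0 mul1e mu_cube// -EFinM lee_fin expRN expR_lnvol// mulVf//.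
by rewrite gt_eqF// exprn_gt0.
Qed.

Lemma unit_lognorms : exists nu : hcube -> R,
  forall c, (0 < side c)%R -> modular p (fun=> 0%R) c (nu c) = 1.
Proof.
have /choice[nu nuP] : forall c : hcube, exists a : R, (0 < side c)%R -> modular p (fun=> 0%R) c a = 1.
  move=> c; have [c0|c0] := ltP 0%R (side c); last by exists 0%R.
  by have [a ?] := exists_unit_norm c0; exists a.
by exists nu.
Qed.

Lemma weight_lognorms : (forall Q, cube Q -> vnorm p (w \* \1_Q)%R < +oo) ->
  exists Lam : hcube -> R, forall c, (0 < side c)%R -> modular p phi c (Lam c) = 1.
Proof.
move=> fin.
have /choice[Lam LamP] : forall c : hcube, exists a : R, (0 < side c)%R -> modular p phi c a = 1.
  move=> c; have [c0|c0] := ltP 0%R (side c); last by exists 0%R.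
  have [a ?] := vnorm_lty n_gt0 mp m0 pm pM mphi c0 (weight_ae (refl_ae c)) (fin _ (hcube_cube c0)).
  by exists a.
by exists Lam.
Qed.

Variables (nu Lam : hcube -> R).
Hypothesis nuP : forall c, (0 < side c)%R -> modular p (fun=> 0%R) c (nu c) = 1.
Hypothesis LamP : forall c, (0 < side c)%R -> modular p phi c (Lam c) = 1.

(** This is why T(Q) governs both conditions of the theorem. *)
Let ratio (Q : set E) (c : hcube) : (0 < side c)%R ->
  {ae mu, forall x, Q x <-> (c : set E) x} ->
  (vnorm p \1_Q)^-1 * vnorm p (w \* \1_Q)%R = (expR (log_mean Lam nu c))%:E.
Proof.
move=> c0 aeQ; rewrite (vnorm_expR n_gt0 mp m0 pm mz c0 (one_ae aeQ) (nuP c0)).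
rewrite (vnorm_expR n_gt0 mp m0 pm mphi c0 (weight_ae aeQ) (LamP c0)).
by rewrite inver gt_eqF ?expR_gt0// -EFinM -expRN -expRD /log_mean addrC.
Qed.

Let average_weight (Q : set E) (c : hcube) : (0 < side c)%R -> measurable Q -> mu Q = mu c ->
  {ae mu, forall x, Q x <-> (c : set E) x} ->
  average Q (fun y => (ln (w y)^-1)%:E) =
  ((side c ^+ n)^-1)%:E * \int[mu]_(x in cube_set c) (- phi x)%:E.
Proof.
move=> c0 mQ muQ aeQ; rewrite /average muQ mu_cube// inver gt_eqF ?exprn_gt0//.
have mn : measurable_fun setT (fun x => - phi x)%R by mfun.
rewrite -(int_ae_set n_gt0 mQ aeQ mn); congr (_ * _).
apply: eq_integral => x _; congr EFin; rewrite /phi.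
have := w_weight; case=> _ /(_ x); rewrite le_eqVlt => /orP[/eqP <-|wx] _.
  by rewrite invr0 ln0// oppr0.
by rewrite lnV.
Qed.

Variable C1 : R.
Hypothesis upper : forall c, (0 < side c)%R ->
  \int[mu]_(x in cube_set c) (Num.max 0 (phi x - log_mean Lam nu c))%:E <= (C1 * side c ^+ n)%:E.

(** The condition bounds T(Q) plus the average of - phi over Q by log K. *)
Lemma Apinfty_lower : Apinfty_constant p w < +oo ->
  exists C : R, (0 <= C)%R /\ forall c, (0 < side c)%R ->
  \int[mu]_(x in cube_set c) (Num.max 0 (log_mean Lam nu c - phi x))%:E <= (C * side c ^+ n)%:E.
Proof.
move=> hK.
have [K [K0 KP]] : exists K : R, (0 < K)%R /\ Apinfty_constant p w <= K%:E.
  move: hK; case: (Apinfty_constant p w) => [r| |]// _.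
    by exists (Num.max r 1)%R; rewrite lt_max ltr01 orbT lee_fin le_max lexx.
  by exists 1%R; rewrite leNye.
exists (Num.max 0 (ln K + C1))%R; split; first by rewrite le_max lexx.
move=> c c0; have cn : (0 < side c ^+ n)%R by rewrite exprn_gt0.
have avg : ((side c ^+ n)^-1)%:E * \int[mu]_(x in cube_set c) (- phi x)%:E <= (ln K - log_mean Lam nu c)%:E.
  rewrite -(average_weight c0 (mc c) erefl (refl_ae c)).
  have : (expR (log_mean Lam nu c))%:E * expeR (average c (fun y => (ln (w y)^-1)%:E)) <= K%:E.
    apply: le_trans KP; rewrite -(ratio c0 (refl_ae c)); apply: ereal_sup_ubound.
    by exists (c : set E) => //; exact: hcube_cube.
  case: (average _ _) => [a| |]; last by rewrite leNye.
  - rewrite /= -EFinM !lee_fin -expRD -[X in (_ <= X)%R -> _]lnK ?posrE// ler_expR; lra.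
  - by rewrite /= gt0_muley ?lte_fin ?expR_gt0.
apply: le_trans (average_upper n_gt0 c0 mphi (upper c0) avg) _.
rewrite lee_fin ler_pM2r// le_max; apply/orP; right; lra.
Qed.

Lemma lower_Apinfty (C : R) : (forall c, (0 < side c)%R ->
  \int[mu]_(x in cube_set c) (Num.max 0 (log_mean Lam nu c - phi x))%:E <= (C * side c ^+ n)%:E) ->
  Apinfty_constant p w < +oo.
Proof.
move=> low; apply: (@le_lt_trans _ _ (expR C)%:E); last exact: ltry.
apply: ge_ereal_sup => _ [Q cQ <-].
have [c [c0 mQ muQ aeQ]] := cube_hcube n_gt0 cQ.
rewrite (ratio c0 aeQ) (average_weight c0 mQ muQ aeQ).
have h := average_lower n_gt0 c0 mphi (upper c0) (low c c0).
rewrite -lee_expeR in h.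
apply: le_trans (lee_wpmul2l _ h) _; first by rewrite lee_fin expR_ge0.
by rewrite /= -EFinM lee_fin -expRD ler_expR; lra.
Qed.

Let scaled_exponent (r : R) : (0 < r)%R -> [/\ measurable_fun setT (fun x => r * p x)%R,
  (0 < r * m)%R, forall x, (r * m <= r * p x)%R & forall x, (r * p x <= r * M)%R].
Proof.
move=> r0; split; [by mfun|by rewrite mulr_gt0| |] => x; by rewrite ler_pM2l.
Qed.

(** The modular of 1_Q for the exponent r p at nu / r is the one for p at nu. *)
Let vnorm_one_scaled (r : R) (Q : set E) (c : hcube) : (0 < r)%R -> (0 < side c)%R ->
  {ae mu, forall x, Q x <-> (c : set E) x} ->
  vnorm (fun x => r * p x)%R \1_Q = (expR (nu c / r))%:E.
Proof.
move=> r0 c0 aeQ; have [mr rm pr rM] := scaled_exponent r0.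
apply: (vnorm_expR n_gt0 mr rm pr mz c0 (one_ae aeQ)).
rewrite -(nuP c0); apply: eq_integral => x _; congr (expR _)%:E.
by field; rewrite gt_eqF.
Qed.

(** A bound B for the integrals becomes a bound for the norms after enlarging the
parameter by k = log B / (r m). *)
Lemma reverse_holder_of_gehring (s B : R) : (0 < s)%R ->
  (forall c, (0 < side c)%R ->
    \int[mu]_(x in cube_set c) (expR (gehring p phi Lam nu s c x))%:E <= B%:E) ->
  exists r C : R, [/\ (1 < r)%R, (0 < C)%R & forall Q, cube Q ->
    (vnorm (fun x => r * p x)%R \1_Q)^-1 *
      vnorm (fun x => r * p x)%R (w \* \1_Q)%R
    <= C%:E * ((vnorm p \1_Q)^-1 * vnorm p (w \* \1_Q)%R)].
Proof.
move=> s0 hB; have r0 : (0 < 1 + s)%R by lra.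
have [mr rm pr rM] := scaled_exponent r0.
pose B' : R := Num.max 1%R B; have B1 : (1 <= B')%R by rewrite le_max lexx.
have BB : (B <= B')%R by rewrite le_max lexx orbT.
pose k : R := (ln B' / ((1 + s) * m))%R.
have k0 : (0 <= k)%R by rewrite divr_ge0 ?ln_ge0// ltW.
exists (1 + s)%R, (expR k); split; [lra|exact: expR_gt0|].
move=> Q cQ; have [c [c0 mQ muQ aeQ]] := cube_hcube n_gt0 cQ.
rewrite [X in _ <= _ * X](ratio c0 aeQ).
rewrite [X in X^-1](vnorm_one_scaled r0 c0 aeQ).
rewrite inver gt_eqF ?expR_gt0; last by [].
pose X : R := (k + log_mean Lam nu c + nu c / (1 + s))%R.
have hX : modular (fun x => (1 + s) * p x)%R phi c X <= 1.
  have mg := measurable_gehring mp mphi Lam nu s c.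
  apply: le_trans (le_int_expR mu (k := - ln B')%R (mc c) (measurable_modular_arg mr mphi X) mg _) _.
    move=> x _; have h1 := ler_wpM2r k0 (pr x).
    have h2 : ((1 + s) * m * k = ln B')%R by rewrite /k mulrC divfK// gt_eqF.
    have h3 : ((1 + s) * p x * (phi x - X) = gehring p phi Lam nu s c x - (1 + s) * p x * k)%R.
      by rewrite /X /gehring /log_mean; field; rewrite gt_eqF.
    rewrite h3; lra.
  apply: le_trans (lee_wpmul2l _ (hB c c0)) _; first by rewrite lee_fin expR_ge0.
  have B0 : (0 < B')%R by lra.
  by rewrite -EFinM lee_fin expRN lnK ?posrE// mulrC ler_pdivrMr// mul1r.
apply: le_trans (lee_wpmul2l _ (vnorm_le n_gt0 mr rm pr mphi (weight_ae aeQ) hX)) _.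
  by rewrite lee_fin invr_ge0 expR_ge0.
by rewrite -!EFinM lee_fin -expRN -!expRD ler_expR /X; lra.
Qed.

Lemma gehring_of_reverse_holder (r C : R) : (1 < r)%R -> (0 < C)%R ->
  (forall Q, cube Q ->
    (vnorm (fun x => r * p x)%R \1_Q)^-1 *
      vnorm (fun x => r * p x)%R (w \* \1_Q)%R
    <= C%:E * ((vnorm p \1_Q)^-1 * vnorm p (w \* \1_Q)%R)) ->
  exists B : R, (0 < B)%R /\ forall c, (0 < side c)%R ->
    \int[mu]_(x in cube_set c) (expR (gehring p phi Lam nu (r - 1) c x))%:E <= B%:E.
Proof.
move=> r1 C0 hC; have r0 : (0 < r)%R by lra.
have [mr rm pr rM] := scaled_exponent r0.
exists (expR (r * M * `|ln (2 * C)|)); split; first exact: expR_gt0.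
move=> c c0; have := hC c (hcube_cube c0).
rewrite [X in _ <= _ * X -> _](ratio c0 (refl_ae c)).
rewrite [X in X^-1](vnorm_one_scaled r0 c0 (refl_ae c)).
rewrite inver gt_eqF ?expR_gt0; last by [].
move=> h.
have C20 : (0 < 2 * C)%R by rewrite mulr_gt0.
pose X : R := (ln (2 * C) + log_mean Lam nu c + nu c / r)%R.
have hX : modular (fun x => r * p x)%R phi c X <= 1.
  apply: (vnorm_lt n_gt0 mr rm pr mphi (weight_ae (refl_ae c))).
  move: h; case: (vnorm _ _) => [v| |]; last by rewrite ltNyr.
    rewrite -!EFinM !lee_fin lte_fin /X => h.
    have : (v <= C * expR (log_mean Lam nu c) * expR (nu c / r))%R.
      by rewrite -ler_pdivrMr ?expR_gt0// mulrC.
    move=> /le_lt_trans; apply; rewrite 2!expRD lnK ?posrE//.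
    by rewrite ltr_pM2r ?expR_gt0// ltr_pM2r ?expR_gt0//; lra.
  by rewrite gt0_muley ?lte_fin ?invr_gt0 ?expR_gt0.
have mg := measurable_gehring mp mphi Lam nu (r - 1)%R c.
have hle := le_int_expR mu (k := (r * M * `|ln (2 * C)|)%R) (mc c) mg
  (measurable_modular_arg mr mphi X).
apply: (le_trans (hle _)) => [x _|].
  have h3 : (r * p x * (phi x - X) = gehring p phi Lam nu (r - 1) c x - r * p x * ln (2 * C))%R.
    by rewrite /X /gehring /log_mean; field; rewrite gt_eqF.
  have rp : (0 <= r * p x)%R by apply: le_trans (pr x); exact: ltW.
  have := ler_wpM2l rp (ler_norm (ln (2 * C))).
  have := ler_wpM2r (normr_ge0 (ln (2 * C))) (rM x).
  rewrite h3; lra.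
by rewrite -[leRHS]mule1; apply: lee_wpmul2l => //; rewrite lee_fin expR_ge0.
Qed.

End main.

Theorem theorem2p50 (R : realType) (n : nat) (n_gt0 : (0 < n)%N)
    (p : euclidean R n -> R)
    (p_P0 : exponentP0 (fun x => (p x)%:E)) (p_LH : log_Hoelder p)
    (w : euclidean R n -> R) (w_weight : scalar_weight w) :
  Apinfty p w <->
  exists r C : R, [/\ (1 < r)%R, (0 < C)%R & forall Q, cube Q ->
    vnorm p (w \* \1_Q)%R < +oo /\
    (vnorm (fun x => r * p x)%R \1_Q)^-1 *
      vnorm (fun x => r * p x)%R (w \* \1_Q)%R
    <= C%:E * ((vnorm p \1_Q)^-1 * vnorm p (w \* \1_Q)%R)].
Proof.
have [_ _ p_ess] := p_P0.
have [mp [C0 C00 LH0] [pinf [Cinf [pinf0 Cinf0 LHinf]]]] := p_LH.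
have [m1 [m10 pm1]] := log_Hoelder_ess_inf n_gt0 C00 LH0 p_ess.
pose m : R := Num.min m1 pinf.
have m0 : (0 < m)%R by rewrite lt_min m10.
have mpinf : (m <= pinf)%R by rewrite ge_min lexx orbT.
have pm x : (m <= p x)%R by rewrite ge_min pm1.
have pM := p_bounded Cinf0 LHinf.
set M : R := (pinf + Cinf)%R in pM.
have M0 : (0 <= M)%R by rewrite addr_ge0// ltW.
have [nu nuP] := unit_lognorms n_gt0 mp m0 pm pM.
have [K tame] := whitney_tame n_gt0 m0 pm C00 mpinf Cinf0 LH0 LHinf.
have [Ch [_ flat]] := whitney_flat n_gt0 mp m0 pm C00 mpinf Cinf0 LH0 LHinf nuP.
have [CL [tau [CL0 tau0 avg]]] := average_estimates n_gt0 mp m0 pm C00 mpinf Cinf0 LH0 LHinf nuP.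
have avg1 c c0 := (avg c c0).1; have avg2 c c0 := (avg c c0).2.
have mw : measurable_fun setT (fun x => ln (w x)).
  by case: w_weight => mw _ _; exact: (measurableT_comp (@measurable_ln R) mw).
split=> [[fin bound]|[r [C [r1 C_gt0 rh]]]].
- have [Lam LamP] := weight_lognorms n_gt0 mp m0 pm pM w_weight fin.
  have up := upper_oscillation n_gt0 mp m0 pm mw LamP avg1.
  have [D [D0 lowD]] := Apinfty_lower n_gt0 mp m0 pm w_weight nuP LamP up bound.
  have low c (c0 : (0 < side c)%R) := log_density_low n_gt0 mp m0 pm pM mw avg1 D0 c0 (lowD c c0).
  have MD : (0 < M * D + CL)%R by have := mulr_ge0 M0 D0; lra.
  have low' := unit_log_density_low n_gt0 mp avg1.
  have [s [B [s0 geh]]] := gehring_bound n_gt0 mp m0 pm pM mw LamP nuP MD low CL0 low' tame flat.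
  have [r [C [r1 C1 rh]]] := reverse_holder_of_gehring n_gt0 mp m0 pm pM w_weight nuP LamP s0 geh.
  exists r, C; split => // Q cQ; split; [exact: fin|exact: rh].
- have fin Q (cQ : cube Q) := (rh Q cQ).1; have rhQ Q (cQ : cube Q) := (rh Q cQ).2.
  have [Lam LamP] := weight_lognorms n_gt0 mp m0 pm pM w_weight fin.
  have up := upper_oscillation n_gt0 mp m0 pm mw LamP avg1.
  have [B [B0 geh]] := gehring_of_reverse_holder n_gt0 mp m0 pm pM w_weight nuP LamP r1 C_gt0 rhQ.
  have s0 : (0 < r - 1)%R by lra.
  have [D [_ low]] := lower_oscillation n_gt0 mp m0 pm mw LamP nuP CL0 tau0 avg1 avg2 s0 B0 geh.
  by split=> //; exact: (lower_Apinfty n_gt0 mp m0 pm w_weight nuP LamP up low).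
Qed.
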